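(* Let $\mathscr{B}\subseteq\mathbb{N}$ and let $\mathscr{C}\subseteq\mathbb{N}$ be taut. Then the following twelve conditions are all equivalent: (a) for every $b\in\mathscr{B}$ there is $c\in\mathscr{C}$ with $c\mid b$, and for every $c\in\mathscr{C}$ there is $b^*\in\mathscr{B}^*$ with $b^*\mid c$; (b) $\eta^*\le\eta_{\mathscr{C}}\le\eta$; (c) $X_{\eta_{\mathscr{C}}}\subseteq X_\eta$; (d) $\eta_{\mathscr{C}}\in X_\eta$; (e) $\nu_{\eta_{\mathscr{C}}}\in\mathcal{P}(X_\eta)$; (f) $\mathcal{P}(X_{\eta_{\mathscr{C}}})\subseteq\mathcal{P}(X_\eta)$; (a') for every $b'\in\mathscr{B}'$ there is $c\in\mathscr{C}$ with $c\mid b'$, and for every $c\in\mathscr{C}$ there is $b^*\in\mathscr{B}^*$ with $b^*\mid c$; (b') $\eta^*\le\eta_{\mathscr{C}}\le\eta'$; (c') $X_{\eta_{\mathscr{C}}}\subseteq X_{\eta'}$; (d') $\eta_{\mathscr{C}}\in X_{\eta'}$; (e') $\nu_{\eta_{\mathscr{C}}}\in\mathcal{P}(X_{\eta'})$; (f') $\mathcal{P}(X_{\eta_{\mathscr{C}}})\subseteq\mathcal{P}(X_{\eta'})$.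
   Context: $\mathbb{N}=\{1,2,\dots\}$. For $\mathscr{A}\subseteq\mathbb{N}$: $\mathcal{M}_{\mathscr{A}}=\bigcup_{a\in\mathscr{A}}a\mathbb{Z}$, $\mathcal{F}_{\mathscr{A}}=\mathbb{Z}\setminus\mathcal{M}_{\mathscr{A}}$, and $\mathscr{A}^{prim}$ is the set of those $a\in\mathscr{A}$ not divisible by any other element of $\mathscr{A}$. The logarithmic density $\boldsymbol{\delta}(\mathcal{M}_{\mathscr{A}})=\lim_{L\to\infty}\frac1{\ln L}\sum_{\ell\in\mathcal{M}_{\mathscr{A}}\cap[1,L]}\frac1\ell$ always exists (Davenport–Erdős). $\mathscr{A}$ is Behrend if $\boldsymbol{\delta}(\mathcal{M}_{\mathscr{A}})=1$; $\mathscr{A}$ is taut if $\boldsymbol{\delta}(\mathcal{M}_{\mathscr{A}\setminus\{a\}})<\boldsymbol{\delta}(\mathcal{M}_{\mathscr{A}})$ for every $a\in\mathscr{A}$. $\mathscr{B}'=(\mathscr{B}\cup C)^{prim}$, where $C=\{c\in\mathbb{N}:c\mathcal{A}\subseteq\mathscr{B}\text{ for some Behrend set }\mathcal{A}\}$. $\mathscr{B}^*=(\mathscr{B}\cup D)^{prim}$, where $D=\{d\in\mathbb{N}: d\mathcal{A}\subseteq\mathscr{B}\text{ for some infinite pairwise coprime set }\mathcal{A}\subseteq\mathbb{N}\}$. Put $\eta=\mathbf{1}_{\mathcal{F}_{\mathscr{B}}}$, $\eta'=\mathbf{1}_{\mathcal{F}_{\mathscr{B}'}}$, $\eta^*=\mathbf{1}_{\mathcal{F}_{\mathscr{B}^*}}$,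 $\eta_{\mathscr{C}}=\mathbf{1}_{\mathcal{F}_{\mathscr{C}}}$, all in $\{0,1\}^{\mathbb{Z}}$; $\le$ is coordinatewise. Let $\sigma$ be the left shift on $\{0,1\}^{\mathbb{Z}}$; for $x\in\{0,1\}^{\mathbb{Z}}$, $X_x$ is the closure of $\{\sigma^kx:k\in\mathbb{Z}\}$. For a closed $\sigma$-invariant $X\subseteq\{0,1\}^{\mathbb{Z}}$, $\mathcal{P}(X)$ is the set of $\sigma$-invariant Borel probability measures on $X$ (viewed as measures on $\{0,1\}^{\mathbb{Z}}$). The Mirsky measure $\nu_{\eta_{\mathscr{C}}}$ is the weak limit of $\frac1{\ell_i}\sum_{1\le\ell\le\ell_i}\delta_{\sigma^\ell\eta_{\mathscr{C}}}$ along any sequence $\ell_i\to\infty$ realizing the lower density of $\mathcal{M}_{\mathscr{C}}$, i.e. with $\lim_i\frac1{\ell_i}|\mathcal{M}_{\mathscr{C}}\cap[1,\ell_i]|=\liminf_{L\to\infty}\frac1L|\mathcal{M}_{\mathscr{C}}\cap[1,L]|$ (the limit is known to exist and not to depend on the sequence). *)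

(* Defs.v *)
From HB Require Import structures.
From mathcomp Require Import all_boot all_order all_algebra.
From mathcomp Require Import all_classical all_reals all_analysis.

Set Implicit Arguments.
Unset Strict Implicit.
Unset Printing Implicit Defensive.

Import Order.TTheory GRing.Theory Num.Theory.
Import numFieldNormedType.Exports.

Local Open Scope classical_set_scope.
Local Open Scope ring_scope.

(* The positive integers; subsets of them are [A : set nat] with
   [A `<=` posn]. *)
Definition posn : set nat := [set n | (0 < n)%N].

Definition multiples (A : set nat) : set int :=
  [set n | exists2 a : nat, A a & (a%:Z %| n)%Z].

Definition free_set (A : set nat) : set int := ~` multiples A.

Definition prim (A : set nat) : set nat :=
  [set a | A a /\ forall b : nat, A b -> b <> a -> ~ (b %| a)%N].

Section Densities.
Variable R : realType.

Definition log_avg (M : set int) (L : nat) : R :=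
  (ln L%:R)^-1 * \sum_(1 <= l < L.+1 | l%:Z \in M) l%:R^-1.

(* [limn] is a total operator, so this is the logarithmic density wherever the
   latter exists; for sets of multiples it exists by Davenport-Erdos. *)
Definition log_density (M : set int) : R := limn (log_avg M).

Definition nat_avg (M : set int) (L : nat) : R :=
  L%:R^-1 * (\sum_(1 <= l < L.+1 | l%:Z \in M) 1%N)%:R.

Definition lower_density (M : set int) : R := limn_inf (nat_avg M).

Definition behrend (A : set nat) : Prop := log_density (multiples A) = 1.

Definition taut (A : set nat) : Prop :=
  forall a : nat, A a ->
    log_density (multiples (A `\ a)) < log_density (multiples A).

Definition behrend_divisors (B : set nat) : set nat :=
  [set c | posn c /\ exists A : set nat,
     [/\ A `<=` posn, behrend A & forall a : nat, A a -> B (c * a)%N]].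

Definition Bprime (B : set nat) : set nat := prim (B `|` behrend_divisors B).

End Densities.

Definition pairwise_coprime (A : set nat) : Prop :=
  forall a b : nat, A a -> A b -> a <> b -> coprime a b.

Definition coprime_divisors (B : set nat) : set nat :=
  [set d | posn d /\ exists A : set nat,
     [/\ A `<=` posn, infinite_set A, pairwise_coprime A
       & forall a : nat, A a -> B (d * a)%N]].

Definition Bstar (B : set nat) : set nat := prim (B `|` coprime_divisors B).

(* {0,1}^Z with the product topology. *)
Definition full_shift : Type := prod_topology (fun _ : int => bool).

HB.instance Definition _ := Pointed.on full_shift.
HB.instance Definition _ := Nbhs.on full_shift.
HB.instance Definition _ := Topological.on full_shift.

Definition eta_seq (A : set nat) : full_shift := fun n : int => n \in free_set A.

Definition le_coord (x y : full_shift) : Prop :=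
  forall n : int, (x n <= y n)%O.

(* [shiftz k] is the k-th power of the left shift; the left shift is
   [shiftz 1]. *)
Definition shiftz (k : int) (x : full_shift) : full_shift :=
  fun n : int => x (n + k).

Definition orbit_closure (x : full_shift) : set full_shift :=
  closure [set shiftz k x | k in [set: int]].

Definition borel_shift : Type := g_sigma_algebraType (@open full_shift).

HB.instance Definition _ := Pointed.on borel_shift.
HB.instance Definition _ := Measurable.on borel_shift.

Section Measures.
Variable R : realType.

Definition invariant_measures (X : set full_shift) :
    set (probability borel_shift R) :=
  [set mu | mu X = 1%E /\
     forall A : set borel_shift, measurable A ->
       mu (shiftz 1 @^-1` A) = mu A].

Definition empirical (x : full_shift) (n : nat) :
    {measure set borel_shift -> \bar R} :=
  mscale (n%:R^-1)%:nng
    (msum (fun l : nat => \d_(shiftz l.+1%:Z x : borel_shift)) n).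

(* Test functions need no boundedness condition: the full shift is compact. *)
Definition weakly_converges (mu_ : nat -> {measure set borel_shift -> \bar R})
    (mu : {measure set borel_shift -> \bar R}) : Prop :=
  forall f : full_shift -> R, continuous f ->
    (\int[mu_ i]_x (f x)%:E)%E @[i --> \oo] --> (\int[mu]_x (f x)%:E)%E.

Definition is_mirsky (A : set nat) (nu : probability borel_shift R) : Prop :=
  forall l : nat -> nat, l i @[i --> \oo] --> \oo ->
    nat_avg R (multiples A) (l i) @[i --> \oo]
      --> lower_density R (multiples A) ->
    weakly_converges (fun i => empirical (eta_seq A) (l i)) nu.

(* A probability satisfying [is_mirsky A] exists, and its values on Borel sets
   are determined, so the choice made by [get] is immaterial. *)
Definition mirsky (A : set nat) : probability borel_shift R :=
  get (is_mirsky A).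

End Measures.

(* Main.v *)
Require Import Defs.
From mathcomp Require Import all_boot all_order all_algebra.
From mathcomp Require Import all_classical all_reals all_analysis measurable_realfun.
From mathcomp Require Import zify ring lra.

Set Implicit Arguments.
Unset Strict Implicit.
Unset Printing Implicit Defensive.

Import Order.TTheory GRing.Theory Num.Theory.
Import numFieldNormedType.Exports.

(** Write M_A for the set of multiples of A, and M_Bstar for that of [Bstar B]. Conditions (a) and (b) both say that
M_B <= M_C <= M_Bstar, and (a'), (b') say the same with B' in the place of B on the left
([le_eta]). Membership in M_Bstar has a description free of infinite sets: c lies in it if
and only if for every J > 0 there are d dividing c and a prime to J with d * a in B
([Bstar_approachable]).

From divisibility to dynamics. To find the window of eta_C around 0 somewhere in eta_B,
pick for each n of M_C in the window an element d_n * a_n of B with d_n dividing n and with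
the a_n pairwise coprime and free of small primes. The Chinese remainder theorem gives k,
divisible by a prescribed number J0 with many divisors, such that every such k + n is
divisible by d_n * a_n ([crt_cover]); this k is determined modulo some Q, and for the
remaining n of the window gcd (k + n, Q) = |n|. It remains to choose k in its class so that
these k + n avoid M_C, and this is where tautness enters: if n is not in M_C, then M_C
occupies a small proportion of the progression k + n + QZ ([taut_sparse_AP]). Indeed an
element c of C that divides a term of it is g * a, with g a divisor of n and a free of small
primes. For each of the finitely many g, either these a have a small density of multiples,
or by a zero-one law ([zero_one]) their multiples have density 1; the latter is excluded
because a taut set contains no g * A with A Behrend, unless 1 is in A ([taut_no_behrend]).
A union bound over the window shows that a positive proportion of all k works
([window_freq]).

From dynamics to divisibility. If b is in B, every point of X_eta vanishes on a residue
class modulo b. So M_C contains such a class, and by sparseness it contains b itself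
([backward_taut]). If c in C were outside M_Bstar, there would be finitely many primes p such
that every element of B is divisible by some p^(v_p(c)+1) ([not_approachable]). Then every
point of X_eta vanishes only on one residue class modulo each p^(v_p(c)+1), and finitely
many such classes do not cover cZ ([backward_exceeds]). The passage from B to B' is harmless
in both arguments: Behrend divisors of B inherit divisibility by the p^(v_p(c)+1), because
the multiples of finitely many primes do not have density 1 ([Bprime_exceeds]), and they lie
in M_C by sparseness ([behrend_divisor_mult]).

Densities. Only densities of finitely generated sets of multiples are computed, as means of
periodic functions, and [delta A] is the supremum of those obtained from finite parts of A.
The theorem of Davenport and Erdos says that the logarithmic density and the lower density of
M_A both equal [delta A] ([log_densityE], [lower_densityE]). Its core
([davenport_erdos_core]) is that the integers n * r with r free of primes <= x form disjoint
sets for different n <= x, each of density V / n with V of order 1 / ln x. For n in the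
part of M_A not accounted for by small elements of A they stay in that part, so that the sum
of 1 / n over these n <= x is at most a constant times ln x times a small density.

Measures. The Mirsky measure is constructed as the law of the random point
n |-> [no c in C divides r + n], where r is a uniformly distributed profinite integer,
obtained from a uniform real number by reversing its factorial-base digits; it is the limit
of the empirical measures because, along a sequence realizing the lower density, the part of
M_C not coming from small elements of C becomes negligible ([nu_is_mirsky]). It is invariant
and carried by the orbit closure of eta_C, and for taut C it charges every neighbourhood of
eta_C, by [window_freq] applied to B = C. Hence it is carried by the orbit closure of a
point y exactly when that orbit closure contains eta_C, which links (c), (d), (e) and (f)
([mirsky_orbit_equivalences]). *)

(** * Smooth parts of integers *)

Lemma logn_fact_le p n : prime p -> p.-1 * logn p n`! <= n.
Proof.
move=> pp; rewrite logn_fact //.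
have key m : p.-1 * (\sum_(1 <= k < m.+1) n %/ p ^ k) + n %/ p ^ m <= n.
  elim: m => [|m IH]; first by rewrite big_nil muln0 expn0 divn1.
  rewrite big_nat_recr //= mulnDr.
  have e : n %/ p ^ m.+1 = (n %/ p ^ m) %/ p by rewrite expnSr divnMA.
  have := leq_divM (n %/ p ^ m) p; rewrite -e.
  have := prime_gt0 pp; set a := n %/ p ^ m.+1.
  have -> : a * p = p.-1 * a + a by case: (p) (prime_gt0 pp) => // q _; lia.
  lia.
by apply: leq_trans (key n); rewrite leq_addr.
Qed.

Lemma logn_fact_ge p n : prime p -> n %/ p <= logn p n`!.
Proof.
move=> pp; rewrite logn_fact //; case: n => [|n]; first by rewrite div0n.
by rewrite big_ltn // expn1 leq_addr.
Qed.

(** Legendre's formula: the exponent of p in m! is between m / p - 1 and m / (p - 1), so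
for p <= m multiplying the argument by t multiplies the exponent by at most 4 t. *)
Lemma logn_fact_mul p x t : prime p -> p <= x ->
  logn p (x * t)`! <= 4 * t * logn p x`!.
Proof.
move=> pp px; have p2 := prime_gt1 pp.
have h1 := logn_fact_le (x * t) pp.
have h2 := logn_fact_ge x pp.
have q1 : 0 < x %/ p by rewrite divn_gt0 // prime_gt0.
have h3 : x < (x %/ p).+1 * p by rewrite -ltn_divLR ?prime_gt0.
suff h : logn p (x * t)`! <= 4 * t * (x %/ p).
  by apply: (leq_trans h); rewrite leq_mul2l h2 orbT.
rewrite -(@leq_pmul2l p.-1); last by lia.
apply: (leq_trans h1).
move: (x %/ p) q1 h3 => q q1 h3.
have : x <= 4 * p.-1 * q by nia.
nia.
Qed.

Definition upto (x : nat) : nat_pred := [pred p | p <= x].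

Lemma fact_le_exp n : n`! <= n ^ n.
Proof.
rewrite fact_prod -[X in _ <= _ ^ X](subn1 n.+1) -prod_nat_const_nat.
by rewrite big_nat [X in _ <= X]big_nat; apply: leq_prod => i; lia.
Qed.

(** The product of the x-smooth parts is the x-smooth part of (xt)!, which by the previous
comparison divides (x!)^(4t). This replaces any estimate on the distribution of primes. *)
Lemma prod_smooth_part x t : 1 < x ->
  \prod_(1 <= m < (x * t).+1) m`_(upto x) <= x ^ (4 * (x * t)).
Proof.
move=> x1.
have e n : \prod_(1 <= m < n.+1) m`_(upto x) = (n`!)`_(upto x).
  elim: n => [|n IH]; first by rewrite big_nil fact0 partn1.
  by rewrite big_nat_recr //= IH factS partnM ?fact_gt0 // mulnC.
rewrite e.
have dv : (x * t)`!`_(upto x) %| x`! ^ (4 * t).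
  apply/dvdn_partP => [|p]; first by rewrite part_gt0.
  rewrite mem_primes => /and3P[pp _].
  rewrite p_part pfactor_dvdn ?expn_gt0 ?fact_gt0 // lognX => _.
  case: (leqP p x) => px; last first.
    rewrite lognE pp part_gt0 /= ifN // -p'natE //.
    apply: sub_in_pnat (part_pnat (upto x) _) => q _ qx.
    by rewrite !inE; apply/eqP => qp; move: qx; rewrite qp inE leqNgt px.
  apply: leq_trans (logn_fact_mul t pp px).
  by apply: dvdn_leq_log; rewrite ?fact_gt0 ?dvdn_part.
apply: leq_trans (dvdn_leq _ dv) _; first by rewrite expn_gt0 fact_gt0.
apply: (@leq_trans ((x ^ x) ^ (4 * t))).
  by case: (posnP t) => [->|t0]; rewrite ?muln0 // leq_exp2r ?fact_le_exp ?muln_gt0.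
by rewrite -expnM; apply/eq_leq; congr (_ ^ _); lia.
Qed.

(** Markov's inequality in multiplicative form: a geometric mean of at most x^4 leaves at
most half of the integers with a smooth part above x^8. *)
Lemma few_large_smooth_part x t : 1 < x ->
  2 * count (fun m => x ^ 8 < m`_(upto x)) (iota 1 (x * t)) <= x * t.
Proof.
move=> x1; set c := count _ _.
have h := prod_smooth_part t x1.
have h' : x ^ (8 * c) <= x ^ (4 * (x * t)).
  apply: leq_trans h.
  have -> : (x * t).+1 = 1 + x * t by [].
  rewrite /index_iota addKn /c.
  elim: (iota 1 _) => [|m s IH] /=; first by rewrite muln0 big_nil.
  rewrite big_cons mulnDr expnD leq_mul //.
  by case: ltnP => [|_]; rewrite ?muln1 ?muln0 ?part_gt0 // => /ltnW.
move: h'; rewrite leq_exp2l //; lia.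
Qed.

Lemma upto_fact x : (upto x).-nat x`!.
Proof.
rewrite fact_prod big_nat; elim/big_ind: _ => // [m n|i /andP[i0 ix]].
  by rewrite pnatM => -> ->.
apply/pnatP => // p pp pi; rewrite inE.
by apply: leq_trans (dvdn_leq i0 pi) _.
Qed.

Lemma coprime_rough_part x m : 0 < m -> coprime (m %/ m`_(upto x)) x`!.
Proof.
move=> m0; rewrite -{1}(partnC (upto x) m0) mulKn ?part_gt0 // coprime_sym.
exact: pnat_coprime (upto_fact x) (part_pnat _ _).
Qed.

Lemma rough_dvd x a n r : 0 < a <= x -> coprime r x`! ->
  (a %| n * r) = (a %| n).
Proof.
move=> ax /(coprime_dvdr (dvdn_fact ax)) ra.
by rewrite Gauss_dvdl // coprime_sym.
Qed.

(** Two numbers n, n' <= x whose cofactors in m are prime to x! divide each other, since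
neither can share a factor with the cofactor of the other. *)
Lemma rough_decomp_inj x n n' m : 0 < n <= x -> 0 < n' <= x ->
  n %| m -> n' %| m -> coprime (m %/ n) x`! -> coprime (m %/ n') x`! -> n = n'.
Proof.
move=> nx n'x /divnK e /divnK e' c c'.
have d : n' %| n by rewrite -(rough_dvd _ n'x c) mulnC e -e' dvdn_mull.
have d' : n %| n' by rewrite -(rough_dvd _ nx c') mulnC e' -e dvdn_mull.
by apply/eqP; rewrite eqn_dvd d d'.
Qed.

Lemma not_coprime_prime a b : 0 < a -> ~~ coprime a b ->
  exists p, [/\ prime p, p %| a & p %| b].
Proof.
move=> a0; rewrite /coprime => ab.
have g1 : 1 < gcdn a b by rewrite ltn_neqAle eq_sym ab gcdn_gt0 a0.
exists (pdiv (gcdn a b)); split; first exact: pdiv_prime.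
  exact: dvdn_trans (pdiv_dvd _) (dvdn_gcdl _ _).
exact: dvdn_trans (pdiv_dvd _) (dvdn_gcdr _ _).
Qed.

Lemma dvdn_fact_fact m n : m <= n -> m`! %| n`!.
Proof.
move=> /subnK <-; elim: (n - m) => // k IH.
by rewrite addSn factS; apply: dvdn_mull.
Qed.

Local Open Scope classical_set_scope.
Local Open Scope ring_scope.

(** * Means of periodic functions *)

Definition has_period (T : Type) (q : nat) (f : nat -> T) :=
  (0 < q)%N /\ forall n, f (n + q)%N = f n.

Definition periodic (T : Type) (f : nat -> T) := exists q, has_period q f.

Lemma has_periodM T (f : nat -> T) q t : has_period q f -> (0 < t)%N ->
  has_period (q * t) f.
Proof.
move=> [q0 fq] t0; split; first by rewrite muln_gt0 q0.
move=> n; elim: t {t0} => [|t IH]; first by rewrite muln0 addn0.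
by rewrite mulnS addnCA addnC fq.
Qed.

Lemma has_period_modn T (f : nat -> T) q n : has_period q f -> f (n %% q)%N = f n.
Proof.
move=> [q0 fq]; rewrite {2}(divn_eq n q) addnC.
by elim: (n %/ q)%N => [|t IH]; rewrite ?addn0 // mulSn addnCA addnC fq.
Qed.

Lemma periodic_cst T (c : T) : periodic (fun=> c).
Proof. by exists 1%N. Qed.

Lemma periodic_comp T U (g : T -> U) (f : nat -> T) :
  periodic f -> periodic (fun n => g (f n)).
Proof. by move=> [q [q0 fq]]; exists q; split=> // n; rewrite fq. Qed.

Lemma periodic_comp2 T U V (g : T -> U -> V) (f : nat -> T) (h : nat -> U) :
  periodic f -> periodic h -> periodic (fun n => g (f n) (h n)).
Proof.
move=> [q fq] [r hr]; exists (q * r)%N; split=> [|n].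
  by rewrite muln_gt0 fq.1 hr.1.
rewrite (has_periodM fq hr.1).2; congr (g _ _).
by rewrite mulnC (has_periodM hr fq.1).2.
Qed.

Lemma has_period_affine T (f : nat -> T) q h Q :
  has_period q f -> has_period q (fun n => f (h + Q * n)%N).
Proof.
move=> fq; split=> [|n]; first exact: fq.1.
rewrite mulnDr addnA -(has_period_modn _ fq) -[in RHS](has_period_modn _ fq).
by congr (f _); rewrite addnC modnMDl.
Qed.

Lemma periodic_affine T (f : nat -> T) h Q :
  periodic f -> periodic (fun n => f (h + Q * n)%N).
Proof. by move=> [q fq]; exists q; apply: has_period_affine. Qed.

Lemma periodic_modn T (f : nat -> T) q : (0 < q)%N ->
  periodic (fun n => f (n %% q)%N).
Proof. by move=> q0; exists q; split=> // n; rewrite modnDr. Qed.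

Lemma periodic_sum (R : nmodType) I (r : seq I) (P : pred I) (f : I -> nat -> R) :
  (forall i, P i -> periodic (f i)) ->
  periodic (fun n => \sum_(i <- r | P i) f i n).
Proof.
move=> hf; elim: r => [|i r IH].
  by apply: eq_ind (periodic_cst _) _ _; apply/funext => n; rewrite big_nil.
under eq_fun do rewrite big_cons.
case: (boolP (P i)) => // Pi; exact: (periodic_comp2 +%R (hf i Pi) IH).
Qed.

Section Mean.
Variable R : realType.
Implicit Types f g : nat -> R.

Definition psum f N : R := \sum_(0 <= i < N) f i.

Definition mean f : R := limn (fun N => N%:R^-1 * psum f N).

Lemma psum_add f m n : psum f (m + n) = psum f m + psum (fun i => f (m + i)%N) n.
Proof.
rewrite /psum (@big_cat_nat _ _ _ m) //= ?leq_addr //; congr (_ + _).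
by rewrite -{1}(add0n m) big_addn addKn; apply: eq_bigr => i _; rewrite addnC.
Qed.

Lemma psum_period f q t : has_period q f -> psum f (q * t) = t%:R * psum f q.
Proof.
move=> fq; elim: t => [|t IH]; first by rewrite muln0 mul0r /psum big_geq.
rewrite mulnS addnC psum_add IH -natr1 mulrDl mul1r; congr (_ + _).
apply: eq_bigr => i _; rewrite addnC; case: t {IH} => [|t]; first by rewrite muln0 addn0.
by rewrite (has_periodM fq _).2.
Qed.

Lemma cvg_psum_period f q : has_period q f ->
  N%:R^-1 * psum f N @[N --> \oo] --> q%:R^-1 * psum f q.
Proof.
move=> fq; have q0 := fq.1.
have q0' : 0 < q%:R :> R by rewrite ltr0n.
pose M := \sum_(0 <= i < q) `|f i|.
have hM r : (r <= q)%N -> `|psum f r| <= M.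
  move=> rq; apply: le_trans (ler_norm_sum _ _ _) _.
  by rewrite /M (@big_cat_nat _ _ _ r 0 q) //= lerDl sumr_ge0.
have M0 : 0 <= M by apply: sumr_ge0.
apply/cvgrPdist_le => e e0; near=> N.
have N0 : (0 < N)%N by near: N; exact: nbhs_infty_gt.
have N0' : 0 < N%:R :> R by rewrite ltr0n.
have hN : M + M <= e * N%:R.
  by rewrite mulrC -ler_pdivrMr //; near: N; exact: nbhs_infty_ger.
set t := (N %/ q)%N; set r := (N %% q)%N.
have eN : N = (q * t + r)%N by rewrite mulnC -divn_eq.
have rq : (r <= q)%N by rewrite ltnW // ltn_pmod.
have eS : psum f N = t%:R * psum f q + psum f r.
  rewrite {1}eN psum_add (psum_period _ fq); congr (_ + _).
  apply: eq_bigr => i _; rewrite addnC; case: (t) => [|t']; first by rewrite muln0 addn0.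
  by rewrite (has_periodM fq _).2.
have -> : q%:R^-1 * psum f q - N%:R^-1 * psum f N =
    N%:R^-1 * (r%:R / q%:R * psum f q - psum f r).
  apply: (mulfI (lt0r_neq0 N0')); rewrite mulrBr !mulrA mulfV ?lt0r_neq0 // !mul1r eS.
  by rewrite {1}eN natrD natrM; field; rewrite lt0r_neq0.
rewrite normrM gtr0_norm ?invr_gt0 // mulrC ler_pdivrMr //.
apply: le_trans hN; apply: le_trans (ler_normB _ _) _.
apply: lerD; last exact: hM.
rewrite normrM ger0_norm ?divr_ge0 //; apply: le_trans (hM q (leqnn _)).
by rewrite ler_piMl // ler_pdivrMr // mul1r ler_nat.
Unshelve. all: by end_near. Qed.

Lemma meanE f q : has_period q f -> mean f = q%:R^-1 * psum f q.
Proof. by move=> fq; apply/cvg_lim => //; apply: cvg_psum_period fq. Qed.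

Lemma cvg_mean f : periodic f -> N%:R^-1 * psum f N @[N --> \oo] --> mean f.
Proof. by move=> [q fq]; rewrite (meanE fq); apply: cvg_psum_period. Qed.

Lemma mean_cst (c : R) : mean (fun=> c) = c.
Proof.
by rewrite (@meanE _ 1%N) // /psum big_nat1 invr1 mul1r.
Qed.

Lemma meanZ c f : periodic f -> mean (fun n => c * f n) = c * mean f.
Proof.
move=> [q fq]; rewrite (meanE fq) (@meanE _ q).
  by rewrite /psum -mulr_sumr mulrCA.
by split=> [|n]; rewrite ?fq.1 // fq.2.
Qed.

Lemma meanD f g : periodic f -> periodic g ->
  mean (fun n => f n + g n) = mean f + mean g.
Proof.
move=> pf pg; apply/cvg_lim => //.
have -> : (fun N => N%:R^-1 * psum (fun n => f n + g n) N) =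
    (fun N => N%:R^-1 * psum f N + N%:R^-1 * psum g N).
  by apply/funext => N; rewrite -mulrDr /psum big_split.
exact: cvgD (cvg_mean pf) (cvg_mean pg).
Qed.

Lemma mean_sum I (r : seq I) (P : pred I) (f : I -> nat -> R) :
  (forall i, P i -> periodic (f i)) ->
  mean (fun n => \sum_(i <- r | P i) f i n) = \sum_(i <- r | P i) mean (f i).
Proof.
move=> hf; elim: r => [|i r IH].
  by under eq_fun do rewrite big_nil; rewrite mean_cst big_nil.
under eq_fun do rewrite big_cons; rewrite big_cons.
case: (boolP (P i)) => // Pi; rewrite -IH meanD //; [exact: hf|].
by apply: periodic_sum => j; exact: hf.
Qed.

Lemma ler_mean f g : periodic f -> periodic g -> (forall n, f n <= g n) ->
  mean f <= mean g.
Proof.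
move=> pf pg fg; apply: ler_cvg_to (cvg_mean pf) (cvg_mean pg) _.
by near=> N; rewrite ler_wpM2l ?invr_ge0 // ler_sum.
Unshelve. all: by end_near. Qed.

Lemma mean_ge0 f : periodic f -> (forall n, 0 <= f n) -> 0 <= mean f.
Proof.
by move=> pf f0; rewrite -(mean_cst 0); apply: ler_mean => //; apply: periodic_cst.
Qed.

(** An affine map with slope prime to the period permutes the residue classes. *)
Lemma mean_affine f h Q q : has_period q f -> coprime Q q ->
  mean (fun n => f (h + Q * n)%N) = mean f.
Proof.
move=> fq Qq; have q0 := fq.1.
rewrite (meanE fq) (meanE (has_period_affine h Q fq)).
congr (_ * _); rewrite /psum !big_mkord.
pose s (i : 'I_q) : 'I_q := Ordinal (ltn_pmod (h + Q * i) q0).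
have sinj : injective s.
  move=> i j /(congr1 val)/eqP; rewrite /= eqn_modDl => ij.
  apply/val_inj/eqP; rewrite /= -(modn_small (ltn_ord i)) -(modn_small (ltn_ord j)).
  wlog le : i j ij / (i <= j)%N => [H|].
    by case: (leqP i j) => [|/ltnW] le; [|rewrite eq_sym]; apply: H => //; rewrite eq_sym.
  rewrite eq_sym eqn_mod_dvd // -(@Gauss_dvdr _ Q) 1?coprime_sym //.
  by rewrite mulnBr -eqn_mod_dvd ?leq_mul2l ?le ?orbT // eq_sym.
rewrite [RHS](reindex_inj sinj) /=.
by apply: eq_bigr => i _; rewrite (has_period_modn _ fq).
Qed.

(** A progression of step Q carries 1 / Q of the mass. *)
Lemma mean_AP f h Q : (h < Q)%N -> periodic f ->
  mean (fun n => (n %% Q == h)%N%:R * f n) =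
  Q%:R^-1 * mean (fun n => f (h + Q * n)%N).
Proof.
move=> hQ [q fq]; have Q0 : (0 < Q)%N by case: Q hQ.
have pg : has_period (Q * q) (fun n => (n %% Q == h)%N%:R * f n).
  split=> [|n]; first by rewrite muln_gt0 Q0 fq.1.
  by rewrite -modnDmr modnMr addn0 mulnC (has_periodM fq Q0).2.
rewrite (meanE pg) (meanE (has_period_affine h Q fq)).
rewrite natrM invfM mulrA; congr (_ * _).
elim: q {fq pg} => [|q IH]; first by rewrite muln0 /psum !big_geq.
rewrite mulnS addnC psum_add IH [in RHS]/psum big_nat_recr //=; congr (_ + _).
rewrite /psum (bigD1_seq h) ?iota_uniq //=; last by rewrite mem_index_iota.
have eQ i : (i < Q)%N -> ((Q * q + i) %% Q)%N = i.
  by move=> iQ; rewrite mulnC modnMDl modn_small.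
rewrite eQ // eqxx mul1r addnC big1_seq ?addr0 //.
move=> i /andP[ih]; rewrite mem_index_iota /= => iQ.
by rewrite eQ // (negbTE ih) mul0r.
Qed.

(** Chinese remainder theorem, as independence of functions with coprime periods: split
according to the class modulo the second period and use that the first function has the same
mean on each class. *)
Lemma meanM f g q r : has_period q f -> has_period r g -> coprime q r ->
  mean (fun n => f n * g n) = mean f * mean g.
Proof.
move=> fq gr qr.
have pf : periodic f by exists q.
have r0 := gr.1.
have -> : (fun n => f n * g n) =
   (fun n => \sum_(0 <= h < r) g h * ((n %% r == h)%N%:R * f n)).
  apply/funext => n; rewrite (bigD1_seq (n %% r)%N) ?iota_uniq //=; last first.
    by rewrite mem_index_iota /= ltn_pmod.
  rewrite eqxx mul1r (has_period_modn _ gr) big1 ?addr0 1?mulrC // => i ih.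
  by rewrite eq_sym (negbTE ih) mul0r mulr0.
have pAP h : periodic (fun n => (n %% r == h)%N%:R * f n).
  apply: (periodic_comp2 *%R) => //.
  exact: (@periodic_modn _ (fun m => (m == h)%N%:R : R)).
rewrite mean_sum; last first.
  by move=> h _; apply: periodic_comp.
rewrite (meanE gr) [RHS]mulrC -mulrA [RHS]mulrC mulr_suml mulr_suml.
rewrite big_nat [RHS]big_nat; apply: eq_bigr => h hr.
by rewrite meanZ // mean_AP // (mean_affine _ fq) 1?coprime_sym // mulrA mulrAC.
Qed.

End Mean.

(** * Densities of sets of multiples and rough numbers *)

Definition mult (A : set nat) (n : nat) : bool :=
  `[< exists2 a, A a & (a %| n)%N >].

(** Finite parts of A; their sets of multiples are periodic and exhaust M_A. *)
Definition below (A : set nat) (X : nat) : set nat :=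
  [set a | A a /\ (a <= X)%N].

Lemma multP A n : reflect (exists2 a, A a & (a %| n)%N) (mult A n).
Proof. exact: asboolP. Qed.

Lemma mult_self (A : set nat) a : A a -> mult A a.
Proof. by move=> Aa; apply/multP; exists a. Qed.

Lemma mult_dvd A m n : mult A m -> (m %| n)%N -> mult A n.
Proof.
by move=> /multP[a Aa am] mn; apply/multP; exists a => //; apply: dvdn_trans mn.
Qed.

Lemma sub_mult (A A' : set nat) n : A `<=` A' -> mult A n -> mult A' n.
Proof. by move=> AA' /multP[a Aa an]; apply/multP; exists a => //; apply: AA'. Qed.

Lemma below_sub A X Y : (X <= Y)%N -> below A X `<=` below A Y.
Proof. by move=> XY a [Aa aX]; split=> //; apply: leq_trans XY. Qed.

Lemma below_sub_id A X : below A X `<=` A.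
Proof. by move=> a []. Qed.

Lemma mult_below A n X : A `<=` posn -> (0 < n <= X)%N ->
  mult (below A X) n = mult A n.
Proof.
move=> Ap /andP[n0 nX]; apply/idP/idP; first by apply: sub_mult => a [].
move=> /multP[a Aa an]; apply/multP; exists a => //; split=> //.
exact: leq_trans (dvdn_leq n0 an) nX.
Qed.

Lemma has_period_mult (A : set nat) q : (0 < q)%N ->
  (forall a, A a -> (a %| q)%N) -> has_period q (mult A).
Proof.
move=> q0 hA; split=> // n.
by apply/multP/multP => -[a Aa an]; exists a => //; move: an; rewrite dvdn_addl // hA.
Qed.

Lemma has_period_mult_below A X : A `<=` posn -> has_period X`! (mult (below A X)).
Proof.
move=> Ap; apply: has_period_mult; first exact: fact_gt0.
by move=> a [/Ap a0 aX]; apply: dvdn_fact; rewrite [in X in X && _]a0.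
Qed.

Lemma periodic_mult_below A X : A `<=` posn -> periodic (mult (below A X)).
Proof. by move=> Ap; exists X`!; apply: has_period_mult_below. Qed.

Section Dens.
Variable R : realType.
Implicit Types P Q : pred nat.

Definition dens P : R := mean (fun n => (P n)%:R).

Lemma periodic_ind P : periodic P -> periodic (fun n => (P n)%:R : R).
Proof. exact: (periodic_comp (fun b : bool => b%:R : R)). Qed.
Hint Resolve periodic_ind : core.

Lemma le_dens P Q : periodic P -> periodic Q -> (forall n, P n -> Q n) ->
  dens P <= dens Q.
Proof.
move=> pP pQ PQ; apply: ler_mean; [exact: periodic_ind..|].
by move=> n; case: (P n) (PQ n) => [->|_] //; case: (Q n).
Qed.

Lemma dens_ge0 P : periodic P -> 0 <= dens P.
Proof. by move=> pP; apply: mean_ge0; [exact: periodic_ind|]. Qed.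

Lemma dens_le1 P : periodic P -> dens P <= 1.
Proof.
move=> pP; rewrite -(mean_cst 1); apply: ler_mean; [exact: periodic_ind|exact: periodic_cst|].
by move=> n; case: (P n).
Qed.

Lemma densN P : periodic P -> dens (fun n => ~~ P n) = 1 - dens P.
Proof.
move=> pP; apply/eqP; rewrite eq_sym subr_eq -meanD.
- apply/eqP/esym/(etrans _ (mean_cst 1)); congr mean; apply/funext => n.
  by case: (P n); rewrite ?addr0 ?add0r.
- exact: (periodic_comp (fun b => (~~ b)%:R : R)).
- exact: periodic_ind.
Qed.

(** Union bound. *)
Lemma dens_le_sum I (r : seq I) (S : pred I) P (Q : I -> pred nat) :
  periodic P -> (forall i, periodic (Q i)) ->
  (forall n, P n -> (\sum_(i <- r | S i) (Q i n) > 0)%N) ->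
  dens P <= \sum_(i <- r | S i) dens (Q i).
Proof.
move=> pP pQ PQ; rewrite /dens -mean_sum; last by move=> i _; exact: periodic_ind.
apply: ler_mean; [exact: periodic_ind|by apply: periodic_sum => i _; exact: periodic_ind|].
move=> n; rewrite -natr_sum; case: (P n) (PQ n) => [h|_]; last by rewrite ler0n.
by rewrite ler_nat h.
Qed.

Lemma dens_AP P h (Q : nat) : (h < Q)%N -> periodic P ->
  dens (fun n => (n %% Q == h)%N && P n) = Q%:R^-1 * dens (fun n => P (h + Q * n)%N).
Proof.
move=> hQ pP; rewrite /dens -(@mean_AP _ (fun n => (P n)%:R)) //; last exact: periodic_ind.
by congr mean; apply/funext => n; case: eqP => _; rewrite ?mul1r ?mul0r.
Qed.

End Dens.
#[export] Hint Resolve periodic_ind : core.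

Section Rough.
Variable R : realType.

(** The integers n * r with r free of prime factors <= x. *)
Definition rough_mult (x n m : nat) : bool :=
  (n %| m)%N && coprime (m %/ n) x`!.

Definition rough_dens x : R := dens R (fun n => coprime n x`!).

Lemma has_period_coprime q : (0 < q)%N -> has_period q (fun n => coprime n q).
Proof. by move=> q0; split=> // n; rewrite /coprime gcdnC gcdnDr gcdnC. Qed.

Lemma has_period_rough_mult x n : (0 < n)%N ->
  has_period (n * x`!) (rough_mult x n).
Proof.
move=> n0; split=> [|m]; first by rewrite muln_gt0 n0 fact_gt0.
rewrite /rough_mult dvdn_addl ?dvdn_mulr //.
by rewrite divnDr ?dvdn_mulr // mulKn // /coprime gcdnC gcdnDr gcdnC.
Qed.

Lemma periodic_rough_mult x n : (0 < n)%N -> periodic (rough_mult x n).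
Proof. by move=> n0; eexists; apply: has_period_rough_mult. Qed.

Lemma dens_rough_mult x n : (0 < n)%N ->
  dens R (rough_mult x n) = n%:R^-1 * rough_dens x.
Proof.
move=> n0; have -> : rough_mult x n = fun m => (m %% n == 0)%N && coprime (m %/ n) x`!.
  by [].
rewrite dens_AP //.
  by congr (_ * mean _); apply/funext => m; rewrite add0n mulKn.
exists (n * x`!)%N; split=> [|m]; first by rewrite muln_gt0 n0 fact_gt0.
by rewrite divnDr ?dvdn_mulr // mulKn // /coprime gcdnC gcdnDr gcdnC.
Qed.

(** Lower bound V >= c / ln x for the density V of the integers free of primes <= x. At least
half of all integers have an x-smooth part n <= x^8, and those with smooth part n form a set
of density V / n. *)
Lemma rough_dens_lb x : (1 < x)%N ->
  1 <= 2 * (rough_dens x * \sum_(1 <= n < (x ^ 8).+1) n%:R^-1).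
Proof.
move=> x1; set y := (x ^ 8)%N.
pose U m : R := \sum_(1 <= n < y.+1) (rough_mult x n m)%:R.
have pr n : (1 <= n < y.+1)%N -> periodic (fun m => (rough_mult x n m)%:R : R).
  by move=> /andP[n0 _]; apply: periodic_ind; apply: periodic_rough_mult.
have EU : U = fun m => \sum_(1 <= n < y.+1 | (1 <= n < y.+1)%N) (rough_mult x n m)%:R.
  by apply/funext => m; rewrite /U big_nat.
have -> : rough_dens x * \sum_(1 <= n < y.+1) n%:R^-1 = mean U.
  rewrite EU mean_sum // mulr_sumr big_nat_cond [RHS]big_nat_cond.
  apply: eq_big => [n|n /andP[/andP[n0 _] _]]; first by rewrite andbT andbb.
  by rewrite -[RHS]/(dens R (rough_mult x n)) dens_rough_mult // mulrC.
have pU : periodic U by rewrite EU; apply: periodic_sum.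
have [q qU] := pU; have q0 := qU.1; have x0 : (0 < x)%N by lia.
have hU := has_periodM qU x0.
rewrite (meanE hU); set N := (q * x)%N.
have N0 : 0 < N%:R :> R by rewrite ltr0n muln_gt0 q0 x0.
(* The sum over a full period may start at 1 instead of 0, by periodicity. *)
have e : psum U N = \sum_(1 <= m < N.+1) U m.
  have : psum U N + U N = U 0%N + \sum_(1 <= m < N.+1) U m.
    by rewrite -big_nat_recr //= big_nat_recl // big_add1.
  have -> : U N = U 0%N by rewrite -[N]add0n hU.2.
  by rewrite addrC => /addrI.
rewrite mulrCA -ler_pdivrMl ?invr_gt0 // invrK mulr1 e.
have h := @few_large_smooth_part x q x1.
have hc := count_predC (fun m => x ^ 8 < m`_(upto x))%N (iota 1 (x * q)).
rewrite size_iota in hc.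
set c := count (predC _) _ in hc.
have {h}hc : (N <= 2 * c)%N by rewrite /N mulnC; lia.
apply: (@le_trans _ _ (2 * c%:R)); first by rewrite -natrM ler_nat.
rewrite ler_wpM2l // /c -sumn_count /index_iota subSS subn0 /N (mulnC q).
rewrite sumnE big_map natr_sum big_seq [X in _ <= X]big_seq.
apply: ler_sum => m; rewrite mem_iota => /andP[m0 _].
rewrite /= -leqNgt; case: leqP => // sm; last by apply: sumr_ge0.
rewrite /U (bigD1_seq (m`_(upto x))%N) ?iota_uniq //=; last first.
  by rewrite mem_index_iota part_gt0 ltnS.
rewrite /rough_mult dvdn_part coprime_rough_part // lerDl; exact: sumr_ge0.
Qed.

(** If n <= x is in M_A but no multiple of an element of A up to K, all n * r with r prime to x! are again of that
kind: an element of A not exceeding x that divides n * r divides n. These sets are disjoint,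
so their densities V / n add up to at most the density of the difference. *)
Lemma davenport_erdos_core A x K : A `<=` posn -> (K <= x)%N ->
  rough_dens x * (\sum_(1 <= n < x.+1 | mult A n && ~~ mult (below A K) n) n%:R^-1)
  <= dens R (mult (below A x)) - dens R (mult (below A K)).
Proof.
move=> Ap Kx; set S := fun n => mult A n && ~~ mult (below A K) n.
have pb X : periodic (fun n => (mult (below A X) n)%:R : R).
  by apply: periodic_ind; apply: periodic_mult_below.
have pr n : (1 <= n < x.+1)%N && S n -> periodic (fun m => (rough_mult x n m)%:R : R).
  by move=> /andP[/andP[n0 _] _]; apply: periodic_ind; apply: periodic_rough_mult.
have -> : rough_dens x * (\sum_(1 <= n < x.+1 | S n) n%:R^-1) =
   mean (fun m => \sum_(1 <= n < x.+1 | (1 <= n < x.+1)%N && S n) (rough_mult x n m)%:R).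
  rewrite mean_sum // mulr_sumr [LHS]big_nat_cond [RHS]big_nat_cond.
  apply: eq_big => [n|n /andP[/andP[n0 _] _]]; first by rewrite andbA andbb.
  by rewrite -[RHS]/(dens R (rough_mult x n)) dens_rough_mult // mulrC.
rewrite lerBrDr /dens -meanD //; last exact: periodic_sum.
apply: ler_mean => //; first by apply: (periodic_comp2 +%R) => //; exact: periodic_sum.
move=> m.
have [/hasP[n]|/hasPn h] := boolP (has (fun n => S n && rough_mult x n m) (index_iota 1 x.+1)).
  rewrite mem_index_iota ltnS => nx /andP[/andP[An Kn] /andP[nm cm]].
  have -> : mult (below A x) m.
    by apply: (mult_dvd _ nm); rewrite mult_below.
  have -> : mult (below A K) m = false.
    apply/negbTE; apply: contra Kn => /multP[a [Aa aK] am]; apply/multP; exists a => //.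
    have ax : (0 < a <= x)%N by rewrite (leq_trans aK Kx) andbT; apply: Ap.
    by rewrite -(rough_dvd _ ax cm) mulnC divnK.
  rewrite addr0 big_mkcond (bigD1_seq n) ?iota_uniq ?mem_index_iota ?ltnS //=.
  rewrite big1_seq ?addr0; first by case: ifP; case: (rough_mult _ _ _).
  move=> n' /andP[nn' _]; case: ifP => // /andP[n'x _].
  case: (boolP (rough_mult _ _ _)) => // /andP[nm' cm'].
  case/negP: nn'; apply/eqP; exact: (@rough_decomp_inj x _ _ m).
rewrite big1_seq ?add0r.
  rewrite ler_nat; case: (boolP (mult (below A K) m)) => // /(sub_mult (below_sub Kx)).
  by move=> ->.
move=> n /andP[/andP[_ Sn] /h]; rewrite Sn /=.
by case: (rough_mult _ _ _).
Qed.

End Rough.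

(** * Logarithmic density: the theorem of Davenport and Erdos *)

Section LogSums.
Variable R : realType.
Implicit Types P Q : pred nat.

Lemma ln_succ_le n : ln n.+2%:R - ln n.+1%:R <= n.+1%:R^-1 :> R.
Proof.
rewrite -ln_div ?posrE ?ltr0n //.
have -> : n.+2%:R / n.+1%:R = 1 + n.+1%:R^-1 :> R.
  by rewrite -natr1 mulrDl mulfV ?pnatr_eq0 // mul1r.
by apply: le_ln1Dx; apply: lt_trans (ltrN10 _) _; rewrite invr_gt0 ltr0n.
Qed.

Lemma le_ln_succ n : n.+2%:R^-1 <= ln n.+2%:R - ln n.+1%:R :> R.
Proof.
rewrite -[leRHS]opprK opprB -ln_div ?posrE ?ltr0n // lerNr.
have -> : n.+1%:R / n.+2%:R = 1 - n.+2%:R^-1 :> R.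
  rewrite -[n.+2%:R]natr1; field.
  by rewrite -[_ + 1]/(1 + n%:R + 1) nat1r natr1 pnatr_eq0.
by apply: le_ln1Dx; rewrite ltrN2 invf_lt1 ?ltr0n // ltr1n.
Qed.

(** Used to absorb bounded error terms after division by ln N. *)
Lemma ln_large (M : R) : \forall N \near \oo, M <= ln N%:R.
Proof.
near=> N.
have N0 : (0 < N)%N by near: N; exact: nbhs_infty_gt.
rewrite -[M]expRK ler_ln ?posrE ?expR_gt0 ?ltr0n //.
by near: N; exact: nbhs_infty_ger.
Unshelve. all: by end_near. Qed.

Definition hsum P N : R := \sum_(1 <= n < N.+1 | P n) n%:R^-1.
Definition freq P N : R := \sum_(1 <= n < N.+1) (P n)%:R.

Lemma hsum_ge0 P N : 0 <= hsum P N.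
Proof. exact: sumr_ge0. Qed.

Lemma freq_ge0 P N : 0 <= freq P N.
Proof. exact: sumr_ge0. Qed.

Lemma hsumS P N : hsum P N.+1 = hsum P N + (P N.+1)%:R * N.+1%:R^-1.
Proof.
rewrite /hsum big_mkcond big_nat_recr //= -big_mkcond; congr (_ + _).
by case: (P _); rewrite ?mul1r ?mul0r.
Qed.

Lemma freqS P N : freq P N.+1 = freq P N + (P N.+1)%:R.
Proof. by rewrite /freq big_nat_recr. Qed.

Lemma hsumC P N : hsum P N + hsum (predC P) N = hsum predT N.
Proof. by rewrite /hsum [RHS](bigID P). Qed.

Lemma freqC P N : freq P N + freq (predC P) N = N%:R.
Proof.
rewrite /freq -big_split /=.
rewrite (eq_bigr (fun=> 1)); first by rewrite sumr_const_nat subSS subn0.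
by move=> i _; case: (P i); rewrite ?addr0 ?add0r.
Qed.

Lemma le_freq P Q N : (forall n, (0 < n <= N)%N -> P n -> Q n) -> freq P N <= freq Q N.
Proof.
move=> PQ; rewrite /freq big_nat [leRHS]big_nat.
apply: ler_sum => n nN; have := PQ n nN.
by case: (P n) => [->|_] //; case: (Q n).
Qed.

Lemma hsumT_le N : (0 < N)%N -> hsum predT N <= 1 + ln N%:R.
Proof.
case: N => // N _; elim: N => [|N IH].
  by rewrite /hsum big_nat1 invr1 ln1 addr0.
rewrite hsumS mul1r; apply: (le_trans (lerD IH (le_ln_succ N))).
by rewrite -addrA lerD2l addrC subrK.
Qed.

(** Summation by parts: a lower bound c for the natural averages from n0 on is passed on to
the logarithmic sum. The terms freq / N on both sides make the induction on N go through. *)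
Lemma hsum_ge (c : R) P n0 N : 0 <= c -> (0 < n0 <= N)%N ->
  (forall n, (n0 <= n)%N -> c * n%:R <= freq P n) ->
  c * (ln N.+1%:R - ln n0.+1%:R) + freq P N / N%:R <= hsum P N + freq P n0 / n0%:R.
Proof.
move=> c0 /andP[n00 +] hP; elim: N => [|N IH]; first by rewrite leqn0 gtn_eqF.
rewrite leq_eqVlt => /predU1P[->|]; first by rewrite subrr mulr0 lerD2r hsum_ge0.
rewrite ltnS => nN; have {}IH := IH nN.
rewrite hsumS freqS.
have h1 : c * ln N.+2%:R <= c * ln N.+1%:R + c * N.+1%:R^-1.
  by rewrite -mulrDr ler_wpM2l // -lerBlDl ln_succ_le.
have h2 : freq P N / N.+1%:R + c * N.+1%:R^-1 <= freq P N / N%:R.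
  have N0 : 0 < N%:R :> R by rewrite ltr0n (leq_trans n00).
  have hc := hP _ nN; rewrite -mulrDl ler_pdivrMr ?ltr0n // mulrAC.
  by rewrite ler_pdivlMr // -natr1; nra.
rewrite [(_ + _) / _]mulrDl; move: IH h1 h2; rewrite !mulrBr.
set L2 := ln N.+2%:R; set L1 := ln N.+1%:R; set i := N.+1%:R^-1; lra.
Qed.

Lemma freq_le P N : freq P N <= N%:R.
Proof. by rewrite -(freqC P) lerDl freq_ge0. Qed.

Lemma hsum_near_ge (c e : R) P : 0 < e ->
  (\forall n \near \oo, c * n%:R <= freq P n) ->
  \forall N \near \oo, (c - e) * ln N%:R <= hsum P N.
Proof.
move=> e0; have [c0|c0] := ltP c 0.
  move=> _; near=> N.
  apply: le_trans (hsum_ge0 _ _); apply: mulr_le0_ge0; first by lra.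
  by near: N; exact: ln_large.
case=> n1 _ hn1; set n0 := n1.+1.
have hn0 n : (n0 <= n)%N -> c * n%:R <= freq P n by move=> h; apply: hn1 => /=; exact: ltnW.
near=> N.
have nN : (0 < n0 <= N)%N by rewrite /=; near: N; exact: nbhs_infty_ge.
have := hsum_ge c0 nN hn0.
have h1 : freq P n0 / n0%:R <= 1 by rewrite ler_pdivrMr ?ltr0n // mul1r freq_le.
have h2 : 0 <= freq P N / N%:R by rewrite divr_ge0 ?freq_ge0.
have h3 : c * ln N%:R <= c * ln N.+1%:R.
  rewrite ler_wpM2l // ler_ln ?posrE ?ltr0n ?ler_nat //.
  by case/andP: nN => _; exact: leq_trans.
have h4 : 1 + c * ln n0.+1%:R <= e * ln N%:R.
  by rewrite [leRHS]mulrC -ler_pdivrMr //; near: N; exact: ln_large.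
rewrite mulrBr mulrBl; lra.
Unshelve. all: by end_near. Qed.

Lemma hsum_near_le (c e : R) P : 0 < e ->
  (\forall n \near \oo, freq P n <= c * n%:R) ->
  \forall N \near \oo, hsum P N <= (c + e) * ln N%:R.
Proof.
move=> e0 hP; have e2 : 0 < e / 2 by lra.
have hC : \forall n \near \oo, (1 - c) * n%:R <= freq (predC P) n.
  near=> n; have h : freq P n <= c * n%:R by near: n.
  by have := freqC P n; lra.
near=> N.
have N0 : (0 < N)%N by near: N; exact: nbhs_infty_gt.
have h1 : (1 - c - e / 2) * ln N%:R <= hsum (predC P) N.
  by near: N; exact: hsum_near_ge hC.
have h2 : 1 <= e / 2 * ln N%:R.
  by rewrite [leRHS]mulrC -ler_pdivrMr //; near: N; exact: ln_large.
by have := hsumC P N; have := hsumT_le N0; lra.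
Unshelve. all: by end_near. Qed.

Lemma cvg_freq P : periodic P -> N%:R^-1 * freq P N @[N --> \oo] --> dens R P.
Proof.
move=> [q qP].
have qP' : has_period q (fun n => (P n)%:R : R) by split=> [|n]; rewrite ?qP.1 // qP.2.
rewrite /dens -(mean_affine 1 qP' (coprime1n q)).
have -> : freq P = psum (fun n => (P (1 + 1 * n)%N)%:R).
  apply/funext => N; rewrite /freq big_add1 /=.
  by apply: eq_bigr => i _; rewrite mul1n.
apply: cvg_mean; apply: (@periodic_affine _ (fun n => (P n)%:R : R)).
by exists q.
Qed.

Lemma freq_near P (e : R) : periodic P -> 0 < e ->
  \forall N \near \oo,
     (dens R P - e) * N%:R <= freq P N <= (dens R P + e) * N%:R.
Proof.
move=> pP e0; have /cvgrPdist_le/(_ _ e0) h := cvg_freq pP.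
near=> N.
have N0 : 0 < N%:R :> R by rewrite ltr0n; near: N; exact: nbhs_infty_gt.
have : `|dens R P - N%:R^-1 * freq P N| <= e by near: N.
rewrite ler_norml => /andP[h1 h2].
apply/andP; split; first by rewrite -ler_pdivlMr //; lra.
by rewrite -ler_pdivrMr //; lra.
Unshelve. all: by end_near. Qed.

End LogSums.

Section DavenportErdos.
Variable R : realType.
Variable A : set nat.
Hypothesis Ap : A `<=` posn.

(** The density of M_A in the only sense needed for computations; it turns out to be both
the logarithmic and the lower density. *)
Definition delta : R := sup (range (fun X => dens R (mult (below A X)))).

Lemma dens_le_delta X : dens R (mult (below A X)) <= delta.
Proof.
apply: ub_le_sup; last by exists X.
by exists 1 => _ [Y _ <-]; apply: dens_le1; apply: periodic_mult_below.
Qed.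

Lemma delta_le c : (forall X, dens R (mult (below A X)) <= c) -> delta <= c.
Proof.
by move=> h; apply: ge_sup => [|_ [X _ <-]//]; exists (dens R (mult (below A 0))), 0%N.
Qed.

Lemma delta_approx e : 0 < e -> exists X, delta - e < dens R (mult (below A X)).
Proof.
move=> e0; have [|_ [X _ <-] h] := @sup_adherent R (range (fun X => dens R (mult (below A X)))) e e0; last by exists X.
split; first by exists (dens R (mult (below A 0))), 0%N.
by exists 1 => _ [Y _ <-]; apply: dens_le1; apply: periodic_mult_below.
Qed.

Lemma delta_le1 : delta <= 1.
Proof. by apply: delta_le => X; apply: dens_le1; apply: periodic_mult_below. Qed.

(** The part of M_A that the elements of A up to K do not explain. It need not be small in
natural density. *)
Definition tail K n := mult A n && ~~ mult (below A K) n.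

(** The tail is small in logarithmic density, with a loss of a constant factor only. The 18
is 2 * 9, from [rough_dens_lb] and ln (x^8) + 1 <= 9 ln x. *)
Lemma hsum_tail K : \forall x \near \oo,
  hsum R (tail K) x <= 18 * (delta - dens R (mult (below A K))) * ln x%:R.
Proof.
near=> x.
have x1 : (1 < x)%N by near: x; exact: nbhs_infty_gt.
have Kx : (K <= x)%N by near: x; exact: nbhs_infty_ge.
have lx : 1 <= ln x%:R :> R by near: x; exact: ln_large.
have h1 := davenport_erdos_core R Ap Kx.
have h2 := rough_dens_lb R x1.
have h3 : \sum_(1 <= n < (x ^ 8).+1) n%:R^-1 <= 9 * ln x%:R :> R.
  have := @hsumT_le R (x ^ 8) _; rewrite expn_gt0 (ltnW x1) => /(_ isT).
  rewrite natrX lnXn ?ltr0n ?(ltnW x1) // => h; apply: (le_trans h).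
  lra.
set V := rough_dens R x in h1 h2.
have V0 : 0 <= V.
  apply: dens_ge0; exists x`!; apply: has_period_coprime; exact: fact_gt0.
rewrite -/(hsum R (tail K) x) in h1.
set D := delta - _.
have hD : V * hsum R (tail K) x <= D by apply: (le_trans h1); rewrite lerD2r dens_le_delta.
have H0 := hsum_ge0 R (tail K) x.
set H := hsum _ _ _ in hD H0 *; set L := ln _ in lx h3 *.
have h4 : 1 <= 18 * (V * L).
  by apply: (le_trans h2); nra.
have : H <= H * (18 * (V * L)) by rewrite ler_peMr.
nra.
Unshelve. all: by end_near. Qed.

Lemma hsum_mult_ub e : 0 < e ->
  \forall N \near \oo, hsum R (mult A) N <= (delta + e) * ln N%:R.
Proof.
move=> e0; have e1 : 0 < e / 36 by lra.
have e2 : 0 < e / 4 by lra.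
have [K hK] := delta_approx e1.
have pK := periodic_mult_below K Ap.
have hb : \forall n \near \oo, freq R (mult (below A K)) n <= (dens R (mult (below A K)) + e / 4) * n%:R.
  by near=> n; have : (dens R (mult (below A K)) - e/4) * n%:R <= freq R (mult (below A K)) n <= (dens R (mult (below A K)) + e/4) * n%:R; [near: n; exact: freq_near|case/andP].
near=> N.
have h1 : hsum R (mult (below A K)) N <= (dens R (mult (below A K)) + e / 4 + e / 4) * ln N%:R.
  by near: N; exact: hsum_near_le.
have h2 : hsum R (tail K) N <= 18 * (delta - dens R (mult (below A K))) * ln N%:R.
  by near: N; exact: hsum_tail.
have h3 : hsum R (mult A) N <= hsum R (mult (below A K)) N + hsum R (tail K) N.
  rewrite /hsum big_mkcond [X in _ <= X + _]big_mkcond [X in _ <= _ + X]big_mkcond /=.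
  rewrite -big_split /=; apply: ler_sum => n _.
  rewrite /tail; case: (mult A n) => /=; case: (mult (below A K) n) => //=; rewrite ?addr0 ?add0r //.
have L0 : 0 <= ln N%:R :> R by near: N; exact: ln_large.
have dK := dens_le_delta K.
move: h1 h2; set d := dens _ _ in hK dK *; set L := ln _ in L0 *; nra.
Unshelve. all: by end_near. Qed.

Lemma freq_mult_lb e : 0 < e ->
  \forall N \near \oo, (delta - e) * N%:R <= freq R (mult A) N.
Proof.
move=> e0; have e2 : 0 < e / 2 by lra.
have [K hK] := delta_approx e2.
near=> N.
have : (dens R (mult (below A K)) - e/2) * N%:R <= freq R (mult (below A K)) N <= (dens R (mult (below A K)) + e/2) * N%:R.
  by near: N; apply: freq_near => //; exact: periodic_mult_below.
case/andP => h _.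
apply: (@le_trans _ _ (freq R (mult (below A K)) N)).
  by apply: le_trans h; rewrite ler_wpM2r //; lra.
by apply: le_freq => n _; apply: sub_mult; exact: below_sub_id.
Unshelve. all: by end_near. Qed.

(** If the natural averages stayed above delta + e, so would the logarithmic ones. *)
Lemma freq_mult_ub e n : 0 < e ->
  exists2 N, (n <= N)%N & freq R (mult A) N <= (delta + e) * N%:R.
Proof.
move=> e0; apply: contrapT => H.
have hN N : (n <= N)%N -> (delta + e) * N%:R <= freq R (mult A) N.
  by move=> nN; rewrite leNgt; apply/negP => /ltW h; apply: H; exists N.
have e4 : 0 < e / 4 by lra.
have h1 : \forall N \near \oo, (delta + e - e / 4) * ln N%:R <= hsum R (mult A) N.
  by apply: hsum_near_ge => //; exists n.
near \oo => N.
have L1 : 1 <= ln N%:R :> R by near: N; exact: ln_large.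
have : (delta + e - e / 4) * ln N%:R <= hsum R (mult A) N by near: N.
have : hsum R (mult A) N <= (delta + e / 4) * ln N%:R by near: N; exact: hsum_mult_ub.
nra.
Unshelve. all: by end_near. Qed.

Lemma mem_multiples l : (l%:Z \in multiples A) = mult A l.
Proof.
apply/idP/multP; first by rewrite inE => -[a Aa /= al]; exists a.
by move=> [a Aa al]; rewrite inE; exists a.
Qed.

Lemma log_densityE : log_density R (multiples A) = delta.
Proof.
have eL L : log_avg R (multiples A) L = (ln L%:R)^-1 * hsum R (mult A) L.
  by congr (_ * _); apply: eq_bigl => l; rewrite mem_multiples.
apply/cvg_lim => //; rewrite (funext eL).
apply/cvgrPdist_le => e e0; have e2 : 0 < e / 2 by lra.
near=> N.
have L1 : 1 <= ln N%:R :> R by near: N; exact: ln_large.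
have h1 : hsum R (mult A) N <= (delta + e) * ln N%:R.
  by near: N; exact: hsum_mult_ub.
have h2 : (delta - e / 2 - e / 2) * ln N%:R <= hsum R (mult A) N.
  by near: N; apply: hsum_near_ge => //; exact: freq_mult_lb.
have L0 : 0 < ln N%:R :> R by lra.
have h3 : (ln N%:R)^-1 * hsum R (mult A) N <= delta + e.
  by rewrite [leLHS]mulrC ler_pdivrMr.
have h4 : delta - e <= (ln N%:R)^-1 * hsum R (mult A) N.
  by rewrite [leRHS]mulrC ler_pdivlMr //; lra.
by rewrite ler_norml; apply/andP; split; lra.
Unshelve. all: by end_near. Qed.

Lemma nat_avgE L : nat_avg R (multiples A) L = L%:R^-1 * freq R (mult A) L.
Proof.
rewrite /nat_avg natr_sum big_mkcond; congr (_ * _).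
by apply: eq_bigr => l _; rewrite mem_multiples; case: (mult A l).
Qed.

Lemma nat_avg_lb e : 0 < e ->
  \forall N \near \oo, delta - e <= nat_avg R (multiples A) N.
Proof.
move=> e0; near=> N.
have N0 : 0 < N%:R :> R by rewrite ltr0n; near: N; exact: nbhs_infty_gt.
rewrite nat_avgE [leRHS]mulrC ler_pdivlMr //; near: N; exact: freq_mult_lb.
Unshelve. all: by end_near. Qed.

Lemma nat_avg_ub e n : 0 < e ->
  exists2 N, (n <= N)%N & nat_avg R (multiples A) N <= delta + e.
Proof.
move=> e0; have [N nN h] := freq_mult_ub n.+1 e0; exists N; first exact: ltnW.
by rewrite nat_avgE [leLHS]mulrC ler_pdivrMr // ltr0n; apply: leq_trans nN.
Qed.

Lemma lower_densityE : lower_density R (multiples A) = delta.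
Proof.
apply/cvg_lim => //; apply/cvgrPdist_le => e e0.
have u0 k : 0 <= nat_avg R (multiples A) k.
  by rewrite nat_avgE mulr_ge0 ?invr_ge0 // freq_ge0.
have hl n : has_lbound (sdrop (nat_avg R (multiples A)) n).
  by exists 0 => _ [k _ <-].
near=> n.
have hu : infs (nat_avg R (multiples A)) n <= delta.
  apply/ler_addgt0Pr => e' e'0; have [N nN h] := nat_avg_ub n e'0.
  by apply: le_trans h; apply: ge_inf => //; exists N.
have : delta - e <= infs (nat_avg R (multiples A)) n.
  apply: lb_le_inf; first by exists (nat_avg R (multiples A) n), n => //=.
  move=> _ [k /= nk <-]; move: k nk; near: n.
  have [N0 _ hN0] := nat_avg_lb e0; exists N0 => // n /= Nn k nk.
  by apply: hN0 => /=; apply: leq_trans nk.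
by rewrite ger0_norm; lra.
Unshelve. all: by end_near. Qed.

End DavenportErdos.

(** * Taut sets are sparse in suitable progressions *)

Section Taut.
Variable R : realType.

Lemma periodicN (P : pred nat) : periodic P -> periodic (fun n => ~~ P n).
Proof. exact: (periodic_comp negb). Qed.

Lemma dens_leU (P Q S : pred nat) : periodic P -> periodic Q -> periodic S ->
  (forall n, P n -> Q n || S n) -> dens R P <= dens R Q + dens R S.
Proof.
move=> pP pQ pS PQS.
have := @dens_le_sum R bool [:: true; false] predT P (fun b => if b then Q else S) pP.
rewrite !big_cons big_nil addr0 /=; apply; first by case.
move=> n /PQS; rewrite !big_cons big_nil /=.
by case: (Q n); case: (S n).
Qed.

Lemma periodic_scale (P : pred nat) g : (0 < g)%N -> periodic P ->
  periodic (fun n => (n %% g == 0)%N && P (n %/ g)%N).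
Proof.
move=> g0 [q qP]; exists (g * q)%N; split=> [|n]; first by rewrite muln_gt0 g0 qP.1.
by rewrite -modnDmr modnMr addn0 divnDr ?dvdn_mulr // mulKn // qP.2.
Qed.

Lemma dens_scale (P : pred nat) g : (0 < g)%N -> periodic P ->
  dens R (fun n => (n %% g == 0)%N && P (n %/ g)%N) = g%:R^-1 * dens R P.
Proof.
move=> g0 [q qP]; rewrite dens_AP //.
  by congr (_ * mean _); apply/funext => n; rewrite add0n mulKn.
exists (g * q)%N; split=> [|n]; first by rewrite muln_gt0 g0 qP.1.
by rewrite divnDr ?dvdn_mulr // mulKn // qP.2.
Qed.

(** A multiple of a that is no multiple of the other elements is a times an integer with the
same property, so removing a changes the density of the complement by a factor of at most
1 - 1 / a, which cannot make 0 out of a positive number. *)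
Lemma delta_remove A a : A `<=` posn -> (1 < a)%N ->
  delta R A = 1 -> delta R (A `\ a) = 1.
Proof.
move=> Ap a1 dA; have Ap' : A `\ a `<=` posn by move=> b [/Ap].
set D := delta R (A `\ a).
have a0 : (0 < a)%N by exact: ltnW.
have i1 : a%:R^-1 < 1 :> R by rewrite invf_lt1 ?ltr1n ?ltr0n.
apply/eqP; rewrite eq_le delta_le1 //= leNgt; apply/negP => D1.
suff : delta R A <= 1 - (1 - a%:R^-1) * (1 - D) by nra.
apply: delta_le => X.
set P := mult (below A X); set P' := mult (below (A `\ a) X).
have pP : periodic P by exact: periodic_mult_below.
have pP' : periodic P' by exact: periodic_mult_below.
have : dens R (fun n => ~~ P' n) <= dens R (fun n => ~~ P n) +
     dens R (fun n => (n %% a == 0)%N && ~~ P' (n %/ a)%N).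
  apply: dens_leU; [exact: periodicN|exact: periodicN|exact: periodic_scale (periodicN pP')|].
  move=> n nP'; case: (boolP (P n)) => //= /multP[b [Ab bX] bn].
  have ba : b = a.
    apply: contrapT => ba; case/negP: nP'; apply/multP; exists b => //.
  rewrite {}ba in bn; rewrite -[_ == _]/(a %| n)%N bn /=; apply: contra nP' => /mult_dvd; apply.
  exact: dvdn_div.
rewrite (dens_scale a0 (periodicN pP')) !densN //; have : dens R P' <= D by exact: dens_le_delta.
set i := a%:R^-1 in i1 *; nra.
Qed.

Lemma delta_set0 : delta R set0 = 0.
Proof.
apply/eqP; rewrite eq_le; apply/andP; split.
  apply: delta_le => X; rewrite (_ : mult _ = fun=> false) /dens ?mean_cst //.
  by apply/funext => n; apply/negbTE/negP => /multP[a []].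
have h : set0 `<=` posn by [].
by apply: le_trans (dens_le_delta R h 0); apply: dens_ge0; apply: periodic_mult_below.
Qed.

(** If g * A is in C with A Behrend and 1 not in A, then A without one of its elements a is
still Behrend. So almost all multiples of g, in particular of g * a, are multiples of other
elements of C, and g * a could be removed from C without loss of density. *)
Lemma taut_no_behrend C A g : C `<=` posn -> taut R C -> (0 < g)%N ->
  A `<=` posn -> delta R A = 1 -> (forall a, A a -> C (g * a)%N) -> A 1%N.
Proof.
move=> Cp tC g0 Ap dA gA; apply: contrapT => A1.
have [a Aa] : A !=set0.
  by apply/set0P/eqP => A0; move: dA; rewrite A0 delta_set0 => /eqP; rewrite eq_sym oner_eq0.
have a1 : (1 < a)%N.
  by have := Ap _ Aa; rewrite /posn /= leq_eqVlt => /predU1P[a1|//]; case: A1; rewrite a1.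
have dA' := delta_remove Ap a1 dA.
set c := (g * a)%N.
have Ap' : A `\ a `<=` posn by move=> b [/Ap].
have Cp' : C `\ c `<=` posn by move=> b [/Cp].
have := tC c (gA _ Aa); rewrite !log_densityE // ltNge => /negP; apply.
apply: delta_le => X; apply/ler_addgt0Pr => e e0.
have [Y] := delta_approx Ap' e0; rewrite dA' => hY.
(* Large enough for the finite part of C to contain both g times the finite part of A
   and the elements up to X. *)
pose Z := maxn X (g * Y).
set P := mult (below (C `\ c) Z); set P' := mult (below (A `\ a) Y) in hY.
have pP : periodic P by exact: periodic_mult_below.
have pP' : periodic P' by exact: periodic_mult_below.
apply: (@le_trans _ _ (dens R P + dens R (fun n => (n %% g == 0)%N && ~~ P' (n %/ g)%N))).
  apply: dens_leU => //; [exact: periodic_mult_below|exact: periodic_scale (periodicN pP')|].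
  move=> n /multP[b [Cb bX] bn].
  have [bc|/eqP bc] := eqVneq b c; last first.
    by apply/orP; left; apply/multP; exists b => //; split => //; rewrite leq_max bX.
  case: (boolP (P n)) => //= nP.
  have gn : (g %| n)%N by apply: dvdn_trans bn; rewrite bc dvdn_mulr.
  rewrite -[_ == _]/(g %| n)%N gn /=; apply: contra nP => /multP[a' [[Aa' aa'] aY] an].
  apply/multP; exists (g * a')%N; last by rewrite mulnC -dvdn_divRL.
  split; last by rewrite leq_max leq_mul2l aY !orbT.
  split; first exact: gA.
  by move=> /= /eqP; rewrite eqn_pmul2l // => /eqP.
apply: lerD; first exact: dens_le_delta.
rewrite (dens_scale g0 (periodicN pP')) densN //.
have i1 : g%:R^-1 <= 1 :> R by rewrite invf_le1 ?ler1n ?ltr0n.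
have i0 : 0 <= g%:R^-1 :> R by rewrite invr_ge0.
have := dens_le1 R pP'.
by set i := g%:R^-1 in i0 i1 *; nra.
Qed.

Lemma coprime_period (T : set nat) X Q : T `<=` posn ->
  (forall a, T a -> (a <= X)%N /\ coprime a Q) ->
  exists2 r, coprime Q r & has_period r (mult T).
Proof.
move=> Tp hT; exists (\prod_(1 <= a < X.+1 | coprime a Q) a)%N.
  rewrite coprime_sym; elim/big_ind: _ => [|m n hm hn|a //]; first exact: coprime1n.
  by rewrite coprimeMl hm hn.
apply: has_period_mult.
  by rewrite big_nat_cond; apply: prodn_cond_gt0 => a /andP[/andP[]].
move=> a Ta; have [aX aQ] := hT a Ta; have a0 : (0 < a)%N := Tp _ Ta.
rewrite big_mkcond (bigD1_seq a) ?iota_uniq ?mem_index_iota ?a0 ?ltnS //= aQ.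
exact: dvdn_mulr.
Qed.

Definition rough_part (A : set nat) (K : nat) : set nat :=
  [set a | A a /\ coprime a K`!].

(** If finite parts prime to any given number kept a density of multiples above e, one could
choose successively finite parts with coprime periods; by independence the complement would
lose a factor 1 - e each time, and A would be Behrend. *)
Lemma zero_one A e : A `<=` posn -> delta R A < 1 -> 0 < e ->
  exists K, delta R (rough_part A K) <= e.
Proof.
move=> Ap dA e0; apply: contrapT => /forallNP H.
have {}H K : e < delta R (rough_part A K) by rewrite ltNge; apply/negP/H.
have rp K : rough_part A K `<=` posn by move=> a [/Ap].
have e1 : e < 1 by apply: lt_le_trans (H 0%N) _; apply: delta_le1.
(* Each step multiplies the density of the complement by at most 1 - e. *)
have key j : exists X, dens R (fun n => ~~ mult (below A X) n) <= (1 - e) ^+ j.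
  elim: j => [|j [X IH]].
    by exists 0%N; rewrite expr0; apply/dens_le1/periodicN/periodic_mult_below.
  have h : 0 < delta R (rough_part A X) - e by rewrite subr_gt0.
  have [Y hY] := delta_approx (rp X) h.
  exists (maxn X Y); rewrite exprSr.
  set S := below A X in IH *; set T := below (rough_part A X) Y in hY.
  have Tp : T `<=` posn by move=> a [[/Ap]].
  have [r cr pr] : exists2 r, coprime X`! r & has_period r (mult T).
    by apply: (@coprime_period T Y) => // a [[_ ?] ?].
  have pS : has_period X`! (mult S) by exact: has_period_mult_below.
  have pT : periodic (mult T) by exists r.
  have pS' : periodic (mult S) by exists X`!.
  apply: (@le_trans _ _ (dens R (fun n => ~~ mult S n && ~~ mult T n))).
    apply: le_dens; [exact/periodicN/periodic_mult_below|apply: (periodic_comp2 andb); exact: periodicN|].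
    move=> n h1; apply/andP; split; apply: contra h1; apply: sub_mult.
      by apply: below_sub; exact: leq_maxl.
    by move=> a [[Aa _] aY]; split=> //; rewrite leq_max aY orbT.
  have -> : dens R (fun n => ~~ mult S n && ~~ mult T n) =
      dens R (fun n => ~~ mult S n) * dens R (fun n => ~~ mult T n).
    rewrite /dens -(@meanM R _ _ X`! r) //.
    - by congr mean; apply/funext => n; case: (~~ _); rewrite ?mul1r ?mul0r.
    - by split=> [|n]; rewrite ?pS.1 // pS.2.
    - by split=> [|n]; rewrite ?pr.1 // pr.2.
  apply: ler_pM; rewrite ?dens_ge0 //; [exact: periodicN..|].
  by rewrite densN //; lra.
have : \forall j \near \oo, (1 - e) ^+ j < 1 - delta R A.
  have c0 : (1 - e) ^+ j @[j --> \oo] --> 0.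
    by apply: cvg_expr; rewrite ger0_norm; lra.
  have d0 : 0 < 1 - delta R A by lra.
  have /cvgrPdist_lt/(_ _ d0) h := c0.
  near=> j; have : `|0 - (1 - e) ^+ j| < 1 - delta R A by near: j.
  by rewrite sub0r normrN; apply: le_lt_trans; exact: ler_norm.
case=> j _ /(_ j (leqnn j)) /= hj; have [X] := key j.
rewrite densN; last exact: periodic_mult_below.
have := dens_le_delta R Ap X; lra.
Unshelve. all: by end_near. Qed.

(** If c in C divides m0 + Q * t, then g = gcd (c, Q) divides gcd (m0, Q) = d and c / g is
prime to Q: a prime p of both would, since K! * d divides Q, make p * g a common divisor of c
and Q. So M_C meets the progression only in the multiples of the sets {c / g} for g dividing
d. These sets do not contain 1 because d is not in M_C, hence they are not Behrend, and the
zero-one law makes their parts prime to K! sparse. Being prime to Q, they are as sparse in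
the progression as in the integers. *)
Lemma taut_sparse_AP C d e : C `<=` posn -> taut R C -> (0 < d)%N ->
  ~~ mult C d -> 0 < e ->
  exists K, forall Q m0, (0 < Q)%N -> gcdn m0 Q = d -> (K`! * d %| Q)%N ->
    forall X, dens R (fun t => mult (below C X) (m0 + Q * t)%N) <= e.
Proof.
move=> Cp tC d0 dC e0.
pose A g : set nat := [set a | (0 < a)%N /\ C (g * a)%N].
have Ap g : A g `<=` posn by move=> a [].
have d0' : 0 < d%:R :> R by rewrite ltr0n.
have hK g : exists K, (g %| d)%N -> delta R (rough_part (A g) K) <= e / d%:R.
  case: (boolP (g %| d)%N) => gd; last by exists 0%N.
  have [||K hK] := @zero_one (A g) (e / d%:R) (Ap g); [|by rewrite divr_gt0|by exists K].
  rewrite lt_neqAle delta_le1 // andbT; apply/negP => /eqP dA.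
  have g0 : (0 < g)%N by exact: dvdn_gt0 gd.
  have [_] := taut_no_behrend Cp tC g0 (Ap g) dA (fun a h => h.2).
  by rewrite muln1 => Cg; case/negP: dC; apply/multP; exists g.
have [K_ {}hK] := choice hK.
(* K >= d, so that primes above K do not divide d; K >= K_ g for each divisor g of d. *)
pose K := (d + \sum_(1 <= g < d.+1) K_ g)%N.
have K_le g : (g %| d)%N -> (K_ g <= K)%N.
  move=> gd; rewrite /K (bigD1_seq g) ?iota_uniq //=; first lia.
  rewrite mem_index_iota; apply/andP; split; first exact: dvdn_gt0 gd.
  by rewrite ltnS; exact: dvdn_leq gd.
exists K => Q m0 Q0 gQ KQ X.
pose T g := below (rough_part (A g) (K_ g) `&` [set a | coprime a Q]) X.
have Tp g : T g `<=` posn by move=> a [[[[]]]].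
have hr g : exists2 r, coprime Q r & has_period r (mult (T g)).
  by apply: (@coprime_period _ X) => // a [[_ ?] ?].
have pT g : periodic (mult (T g)) by have [r _ ?] := hr g; exists r.
apply: (@le_trans _ _ (\sum_(1 <= g < d.+1 | (g %| d)%N)
    dens R (fun t => mult (T g) (m0 + Q * t)%N))).
  apply: dens_le_sum.
  - by apply/periodic_affine/periodic_mult_below.
  - by move=> g; exact/periodic_affine.
  move=> t /multP[c [Cc cX] cn]; set n := (m0 + Q * t)%N in cn *.
  have c0 : (0 < c)%N := Cp _ Cc.
  set g := gcdn c Q.
  have gc : (g %| c)%N by exact: dvdn_gcdl.
  have gQ' : (g %| Q)%N by exact: dvdn_gcdr.
  have gd : (g %| d)%N.
    rewrite -gQ dvdn_gcd gQ' andbT.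
    by have := dvdn_trans gc cn; rewrite /n dvdn_addl // dvdn_mulr.
  have g0 : (0 < g)%N by exact: dvdn_gt0 gd.
  set a := (c %/ g)%N.
  have ea : (g * a = c)%N by rewrite /a mulnC divnK.
  have a0 : (0 < a)%N by rewrite /a divn_gt0 // dvdn_leq.
  have aQ : coprime a Q.
    apply: contraT => /(not_coprime_prime a0)[p [pp pa pQ]].
    suff pgQ : (p * g %| Q)%N.
      have : (p * g %| g)%N.
        by rewrite /g dvdn_gcd -/g pgQ andbT -ea mulnC dvdn_pmul2l.
      by move=> /(dvdn_leq g0); rewrite leqNgt ltn_Pmull ?prime_gt1.
    have [pK|Kp] := leqP p K.
      apply: dvdn_trans KQ; apply: dvdn_mul => //.
      by apply: dvdn_fact; rewrite prime_gt0.
    rewrite Gauss_dvd ?pQ // prime_coprime //; apply/negP => pg.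
    have := dvdn_leq d0 (dvdn_trans pg gd); rewrite leqNgt => /negP; apply.
    by apply: leq_ltn_trans Kp; exact: leq_addr.
  rewrite big_mkcond (bigD1_seq g) ?iota_uniq //=; last first.
    by rewrite mem_index_iota g0 ltnS dvdn_leq.
  rewrite gd addn_gt0 lt0b; apply/orP; left; apply/multP; exists a; last first.
    by apply: dvdn_trans cn; rewrite -ea dvdn_mull.
  split; last by apply: leq_trans cX; rewrite -ea leq_pmull.
  split=> //; split; first by rewrite /A /= ea.
  apply: coprime_dvdr aQ; apply: dvdn_trans KQ; apply: dvdn_mulr.
  exact/dvdn_fact_fact/K_le.
have hg g : (g %| d)%N -> dens R (fun t => mult (T g) (m0 + Q * t)%N) <= e / d%:R.
  move=> gd; have [r cr pr] := hr g.
  rewrite [dens _ _](@mean_affine R (fun n => (mult (T g) n)%:R) m0 Q r) //; last first.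
    by split=> [|n]; rewrite ?pr.1 // pr.2.
  apply: le_trans (hK _ gd).
  have rp : rough_part (A g) (K_ g) `<=` posn by move=> a [/Ap].
  apply: le_trans (dens_le_delta R rp X).
  apply: le_dens => //; first exact: periodic_mult_below.
  by move=> n; apply: sub_mult => a [[? _] ?]; split.
apply: (@le_trans _ _ (\sum_(1 <= g < d.+1) e / d%:R)); last first.
  by rewrite sumr_const_nat subSS subn0 -[leLHS]mulr_natr divfK ?lt0r_neq0.
rewrite big_mkcond; apply: ler_sum => g _; case: ifP => [/hg//|_].
by rewrite divr_ge0 // ltW.
Qed.

End Taut.

(** * Frequencies along sequences realizing the lower density *)

Section RealizingSequences.
Variable R : realType.

(** The sequences along which the Mirsky measure is defined. *)
Definition realizing (A : set nat) (l : nat -> nat) : Prop :=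
  l i @[i --> \oo] --> \oo /\
  nat_avg R (multiples A) (l i) @[i --> \oo] --> lower_density R (multiples A).

Lemma exists_realizing A : A `<=` posn -> exists l, realizing A l.
Proof.
move=> Ap.
have h i : exists N, (i <= N)%N /\ nat_avg R (multiples A) N <= delta R A + i.+1%:R^-1.
  have i0 : 0 < i.+1%:R^-1 :> R by rewrite invr_gt0 ltr0n.
  by have [N ? ?] := nat_avg_ub Ap i i0; exists N.
have [l hl] := choice h; exists l.
have l_oo : l i @[i --> \oo] --> \oo.
  by apply/cvgnyPge => M; exists M => // i /= Mi; apply: leq_trans (hl i).1.
split=> //; rewrite lower_densityE //.
apply/cvgrPdist_le => e e0; near=> i.
have h1 : delta R A - e <= nat_avg R (multiples A) (l i).
  by near: i; apply: (l_oo _ (nat_avg_lb Ap e0)).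
have h2 : i.+1%:R^-1 <= e.
  by apply: ltW; near: i; exact: near_infty_natSinv_lt (PosNum e0).
have := (hl i).2; move: h2; set u := i.+1%:R^-1; rewrite ler_norml => h2 h3.
by apply/andP; split; lra.
Unshelve. all: by end_near. Qed.

Lemma near_seq (l : nat -> nat) (P : nat -> Prop) :
  l i @[i --> \oo] --> \oo -> (\forall N \near \oo, P N) -> \forall i \near \oo, P (l i).
Proof. by move=> hl hP; apply: (hl _ hP). Qed.

(** Along these sequences the natural frequency of M_A tends to delta A, the limit of the
frequencies of the multiples of finite parts of A, so that the tails become negligible in natural frequency
too. *)
Lemma realizing_tail A l e : A `<=` posn -> realizing A l -> 0 < e ->
  exists X0, forall X, (X0 <= X)%N ->
    \forall i \near \oo, freq R (tail A X) (l i) <= e * (l i)%:R.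
Proof.
move=> Ap [l_oo hl] e0; have e3 : 0 < e / 3 by lra.
have [X0 hX0] := delta_approx Ap e3; exists X0 => X XX.
have hX : delta R A - e / 3 < dens R (mult (below A X)).
  apply: (lt_le_trans hX0); apply: le_dens; [exact: periodic_mult_below..|].
  by move=> n; apply: sub_mult; exact: below_sub.
rewrite lower_densityE // in hl; have /cvgrPdist_le/(_ _ e3) hl3 := hl.
have l1 := near_seq l_oo (nbhs_infty_gt 0).
have l2 := near_seq l_oo (freq_near (periodic_mult_below X Ap) e3).
near=> i.
have l0 : 0 < (l i)%:R :> R by rewrite ltr0n; near: i.
have h1 : freq R (mult A) (l i) <= (delta R A + e / 3) * (l i)%:R.
  have : `|delta R A - nat_avg R (multiples A) (l i)| <= e / 3 by near: i.
  rewrite ler_norml nat_avgE => /andP[h _].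
  by rewrite -ler_pdivrMr // mulrC; lra.
have : (dens R (mult (below A X)) - e/3) * (l i)%:R <= freq R (mult (below A X)) (l i)
       <= (dens R (mult (below A X)) + e/3) * (l i)%:R.
  by near: i.
case/andP => h2 _.
have h3 : freq R (tail A X) (l i) + freq R (mult (below A X)) (l i) = freq R (mult A) (l i).
  rewrite /freq -big_split /=; apply: eq_bigr => n _; rewrite /tail.
  have := @sub_mult _ _ n (@below_sub_id A X).
  by case: (mult (below _ _) n) => [->//|_]; rewrite ?add0r ?andbT ?addr0.
move: h2; set d := dens _ _ in hX *; set L := (l i)%:R in l0 h1 *; nra.
Unshelve. all: by end_near. Qed.

Lemma freq_shift (P : pred nat) i N : freq R (fun n => P (n + i)%N) N <= freq R P N + i%:R.
Proof.
apply: (@le_trans _ _ (freq R P (N + i))).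
  rewrite /freq -[(N + i).+1]/(N.+1 + i)%N [leRHS](@big_cat_nat _ _ _ (1 + i)) //=; last by rewrite leq_add2r.
  rewrite [X in _ <= _ + X]big_addn addnK lerDr; exact: sumr_ge0.
elim: i => [|i IH]; first by rewrite addn0 addr0.
by rewrite addnS freqS -natr1 addrA; apply: lerD => //; case: (P _).
Qed.

(** Union bound over W inside the progression h + QZ, first for a finite part of C, for which
densities exist, then for C at the price of the tail. *)
Lemma taut_AP_freq C l (W : seq nat) Q h e : C `<=` posn -> realizing C l ->
  (h < Q)%N ->
  (forall i, i \in W -> forall X, dens R (fun t => mult (below C X) (h + i + Q * t)%N) <= e) ->
  (size W)%:R * e < 1 ->
  exists2 c : R, 0 < c & \forall i \near \oo,
    c * (l i)%:R <= freq R (fun n => (n %% Q == h)%N && all (fun j => ~~ mult C (n + j)) W) (l i).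
Proof.
move=> Cp hl hQ hW We; have Q0 : 0 < Q%:R :> R by rewrite ltr0n; case: Q hQ {hW}.
set m := (size W)%:R in We; have m0 : 0 <= m by rewrite ler0n.
(* The density left in the progression by the union bound for a finite part of C. *)
pose c := (1 - m * e) / Q%:R.
have c0 : 0 < c by rewrite divr_gt0 // subr_gt0.
have c4 : 0 < c / 4 by lra.
have e'0 : 0 < c / (4 * (m + 1)) by rewrite divr_gt0 // mulr_gt0 //; lra.
have [X0 /(_ _ (leqnn _)) hX] := realizing_tail Cp hl e'0.
pose P := mult (below C X0).
have pP : periodic P by exact: periodic_mult_below.
have ps i : periodic (fun n => P (n + i)%N).
  have -> : (fun n => P (n + i)%N) = fun n => P (i + 1 * n)%N.
    by apply/funext => n; rewrite mul1n addnC.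
  exact: periodic_affine.
pose G n := (n %% Q == h)%N && all (fun j => ~~ P (n + j)%N) W.
have pQ : periodic (fun n => n %% Q == h)%N.
  by apply: (@periodic_modn _ (fun m => m == h)); rewrite -(ltr0n R).
have pall s : periodic (fun n => all (fun j => ~~ P (n + j)%N) s).
  elim: s => [|j s IH] /=; first exact: periodic_cst.
  by apply: (periodic_comp2 andb) => //; apply: (periodic_comp negb).
have pG : periodic G by apply: (periodic_comp2 andb).
have dG : c <= dens R G.
  have -> : c = Q%:R^-1 - m * (e / Q%:R) by rewrite /c mulrBl mul1r mulrA.
  have pQP j : periodic (fun n => (n %% Q == h)%N && P (n + j)%N) by apply: (periodic_comp2 andb).
  have : dens R (fun n => (n %% Q == h)%N) <= dens R G +
      \sum_(j <- W) dens R (fun n => (n %% Q == h)%N && P (n + j)%N).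
    have := @dens_le_sum R (option nat) (None :: map Some W) predT (fun n => (n %% Q == h)%N)
      (fun o => if o is Some j then fun n => (n %% Q == h)%N && P (n + j)%N else G).
    rewrite !big_cons big_map; apply => //; first by case.
    move=> n nh; rewrite big_cons big_map; case: (boolP (G n)) => //.
    rewrite /G nh /= -has_predC => /hasP[j jW /= /negPn jP].
    by rewrite (big_rem j) //= jP.
  have -> : dens R (fun n => (n %% Q == h)%N) = Q%:R^-1.
    have := @dens_AP R predT h Q hQ (periodic_cst _).
    by rewrite {2}/dens mean_cst mulr1 => <-; congr mean; apply/funext => n; rewrite andbT.
  have : \sum_(j <- W) dens R (fun n => (n %% Q == h)%N && P (n + j)%N) <= m * (e / Q%:R).
    apply: (@le_trans _ _ (\sum_(j <- W) e / Q%:R)); last first.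
      by rewrite big_const_seq count_predT iter_addr_0 -[leLHS]mulr_natl.
    rewrite big_seq [leRHS]big_seq; apply: ler_sum => j jW.
    rewrite (dens_AP R hQ (ps j)) mulrC ler_pM2r ?invr_gt0 //.
    have -> : (fun n => P (h + Q * n + j)%N) = fun n => P (h + j + Q * n)%N.
      by apply/funext => n; rewrite addnAC.
    exact: hW.
  lra.
exists (c / 4) => //.
pose s : R := \sum_(j <- W) j%:R.
have l_oo := hl.1.
have l1 := near_seq l_oo (freq_near pG c4).
have l2 := near_seq l_oo (nbhs_infty_ger (s / (c / 4))).
near=> i.
have h1 : freq R (tail C X0) (l i) <= c / (4 * (m + 1)) * (l i)%:R by near: i.
have : (dens R G - c / 4) * (l i)%:R <= freq R G (l i) <= (dens R G + c / 4) * (l i)%:R.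
  by near: i.
case/andP => h2 _.
have h3 : s <= (l i)%:R * (c / 4).
  by rewrite -ler_pdivrMr //; near: i.
set L := (l i)%:R in h1 h2 h3 *; have L0 : 0 <= L by rewrite ler0n.
have h4 : freq R G (l i) <=
   freq R (fun n => (n %% Q == h)%N && all (fun j => ~~ mult C (n + j)) W) (l i) +
   \sum_(j <- W) freq R (fun n => tail C X0 (n + j)%N) (l i).
  rewrite /freq exchange_big -big_split /=; apply: ler_sum => n _.
  rewrite -natr_sum -natrD ler_nat /G; case: (_ == h) => //=.
  case: (boolP (all _ _)) => //= hP; case: (boolP (all _ _)) => //=.
  rewrite -has_predC => /hasP[j jW /= /negPn jC].
  have jP := allP hP j jW.
  by rewrite (big_rem j) //= /tail jC jP.
have h5 : \sum_(j <- W) freq R (fun n => tail C X0 (n + j)%N) (l i) <=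
    m * (c / (4 * (m + 1)) * L) + s.
  apply: (@le_trans _ _ (\sum_(j <- W) (c / (4 * (m + 1)) * L + j%:R))).
    by apply: ler_sum => j _; apply: le_trans (freq_shift _ _ _) _; rewrite lerD2r.
  by rewrite big_split /= big_const_seq count_predT iter_addr_0 -[_ *+ _]mulr_natl.
have h6 : m * (c / (4 * (m + 1)) * L) <= c / 4 * L.
  rewrite mulrA ler_wpM2r // mulrA ler_pdivrMr; last by apply: mulr_gt0; lra.
  nra.
have h7 : c * L <= dens R G * L by rewrite ler_wpM2r.
lra.
Unshelve. all: by end_near. Qed.

End RealizingSequences.

(** * Divisibility description of the coprime divisors, and windows *)

Close Scope ring_scope.

Lemma mult_prim A n : A `<=` posn -> mult (prim A) n = mult A n.
Proof.
move=> Ap; apply/idP/idP; first by apply: sub_mult => a [].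
suff h a : A a -> mult (prim A) a by move=> /multP[a /h ha an]; apply: mult_dvd an.
elim/ltn_ind: a => a IH Aa.
have [pa|npa] := pselect (prim A a); first exact: mult_self.
have [b [Ab ba dba]] : exists b, [/\ A b, b <> a & (b %| a)%N].
  apply: contrapT => h; apply: npa; split=> // b Ab ba dba; apply: h; by exists b.
have ba' : (b < a)%N.
  by have := dvdn_leq (Ap _ Aa) dba; rewrite leq_eqVlt => /predU1P[].
by apply: mult_dvd dba; exact: IH.
Qed.

(** The finite description of M_Bstar: a coprime sequence a_1, a_2, ... with d * a_i in B can be
found for some d dividing c exactly when this holds, see [Bstar_approachable]. *)
Definition approachable (B : set nat) (c : nat) : Prop :=
  forall J, (0 < J)%N -> exists d a, [/\ (d %| c)%N, coprime a J & B (d * a)%N].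

(** Otherwise choosing for each a in A a common prime with J gives an injection of A into the
divisors of J. *)
Lemma infinite_coprime A J : A `<=` posn -> infinite_set A -> pairwise_coprime A ->
  (0 < J)%N -> exists2 a, A a & coprime a J.
Proof.
move=> Ap iA cA J0; apply: contrapT => H; apply: iA.
have hp a : exists p, A a -> [/\ prime p, (p %| a)%N & (p %| J)%N].
  have [Aa|nAa] := pselect (A a); last by exists 0%N.
  have [|p hp] := @not_coprime_prime a J (Ap _ Aa); last by exists p.
  by apply/negP => aJ; apply: H; exists a.
have [f hf] := choice hp.
have inj : {in A &, injective f}.
  move=> a b /set_mem Aa /set_mem Ab fab; apply: contrapT => ab.
  have [pp pa _] := hf _ Aa; have [_ pb _] := hf _ Ab; rewrite -fab in pb.
  have : (f a %| gcdn a b)%N by rewrite dvdn_gcd pa.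
  have /eqP -> := cA _ _ Aa Ab ab; rewrite dvdn1 => /eqP f1.
  by rewrite f1 in pp.
rewrite -(eq_finite_set (inj_card_eq inj)).
apply: (@sub_finite_set _ _ `I_J.+1); last exact: finite_II.
by move=> _ [a Aa <-] /=; have [_ _ fJ] := hf _ Aa; rewrite ltnS dvdn_leq.
Qed.

(** Greedy choice: each new element is taken prime to the product of all the previous ones,
and not being 1 it is different from them. *)
Lemma infinite_coprime_of (P : set nat) : P `<=` posn -> ~ P 1%N ->
  (forall J, (0 < J)%N -> exists2 a, P a & coprime a J) ->
  exists A, [/\ A `<=` P, infinite_set A & pairwise_coprime A].
Proof.
move=> Pp P1 hP.
have hg J : exists a, (0 < J)%N -> P a /\ coprime a J.
  have [J0|] := boolP (0 < J)%N; last by exists 0%N.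
  by have [a Pa aJ] := hP J J0; exists a.
have [g {}hg] := choice hg.
pose Q n := iter n (fun q => q * g q)%N 1%N.
have Q0 n : (0 < Q n)%N.
  elim: n => //= n IH; rewrite muln_gt0 IH; exact: Pp (hg _ IH).1.
pose a n := g (Q n).
have Pa n : P (a n) := (hg _ (Q0 n)).1.
have aQ m n : (m < n)%N -> (a m %| Q n)%N.
  elim: n => // n IH; rewrite ltnS leq_eqVlt => /predU1P[->|mn] /=.
    exact: dvdn_mull.
  by apply: dvdn_mulr; exact: IH.
have ca m n : (m < n)%N -> coprime (a n) (a m).
  by move=> mn; apply: coprime_dvdr (aQ _ _ mn) (hg _ (Q0 n)).2.
have ne m n : (m < n)%N -> a m <> a n.
  move=> mn e; have := ca _ _ mn; rewrite e /coprime gcdnn => /eqP a1.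
  by apply: P1; rewrite -a1.
have inj : {in [set: nat] &, injective a}.
  by move=> m n _ _ e; case: (ltngtP m n) => // /ne; rewrite e.
exists (range a); split.
- by move=> _ [n _ <-].
- by rewrite (eq_finite_set (inj_card_eq inj)); exact: infinite_nat.
- move=> _ _ [m _ <-] [n _ <-] mn; case: (ltngtP m n) => h.
  + by rewrite coprime_sym; exact: ca.
  + exact: ca.
  + by rewrite h in mn.
Qed.

(** For the converse, if every divisor d of c failed for some J_d, then c would fail for the
product of the J_d. So one d works for all J, and the greedy choice applies. *)
Lemma Bstar_approachable B c : B `<=` posn -> (0 < c)%N ->
  mult (Bstar B) c <-> approachable B c.
Proof.
move=> Bp c0; have BDp : B `|` coprime_divisors B `<=` posn by move=> b [/Bp|[]].
rewrite mult_prim //; split.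
  move=> /multP[d [Bd|[d0 [A [Ap iA cA dA]]]] dc] J J0.
    by exists d, 1%N; rewrite muln1 coprime1n.
  have [a Aa aJ] := infinite_coprime Ap iA cA J0.
  by exists d, a; split=> //; exact: dA.
move=> hB; apply: contrapT => /negP nc.
have hJ d : exists J, (0 < J)%N /\ ((d %| c)%N -> forall a, coprime a J -> ~ B (d * a)%N).
  have [dc|ndc] := boolP (d %| c)%N; last by exists 1%N.
  apply: contrapT => H; case/negP: nc; apply/multP; exists d => //.
  have [Bd|nBd] := pselect (B d); [by left|right].
  have d0 : (0 < d)%N by exact: dvdn_gt0 dc.
  split=> //.
  have [|||A [AP iA cA]] := @infinite_coprime_of [set a | B (d * a)%N].
  - by move=> a /Bp; rewrite /posn /= muln_gt0 => /andP[].
  - by rewrite /= muln1.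
  - move=> J J0; apply: contrapT => H'; apply: H; exists J; split=> // _ a aJ Bda.
    by apply: H'; exists a.
  exists A; split=> // a /AP /Bp; by rewrite /posn /= muln_gt0 => /andP[].
have [J {}hJ] := choice hJ.
have J0 : (0 < \prod_(1 <= d < c.+1) J d)%N by apply: prodn_gt0 => d; exact: (hJ d).1.
have [d [a [dc aJ Bda]]] := hB _ J0.
apply: ((hJ d).2 dc a) => //; apply: coprime_dvdr aJ.
rewrite (bigD1_seq d) ?iota_uniq ?dvdn_mulr //=.
by rewrite mem_index_iota ltnS (dvdn_leq c0 dc) andbT; exact: dvdn_gt0 dc.
Qed.

(** Some prime of J divides b to a higher power than c. *)
Definition exceeds (J c b : nat) : Prop :=
  exists p, [/\ prime p, (p %| J)%N & (p ^ (logn p c).+1 %| b)%N].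

(** Apply the failing J to d = gcd (b, c): the cofactor b / d shares with J a prime p, and p
divides b / gcd (b, c) only if v_p (b) > v_p (c). *)
Lemma not_approachable B c : B `<=` posn -> (0 < c)%N -> ~ approachable B c ->
  exists2 J, (0 < J)%N & forall b, B b -> exceeds J c b.
Proof.
move=> Bp c0 /existsNP[J /not_implyP[J0 H]]; exists J => // b Bb.
have b0 : (0 < b)%N := Bp _ Bb.
set d := gcdn b c; have db : (d %| b)%N := dvdn_gcdl _ _.
have d0 : (0 < d)%N by exact: dvdn_gt0 db.
have a0 : (0 < b %/ d)%N by rewrite divn_gt0 // dvdn_leq.
have /(not_coprime_prime a0)[p [pp pa pJ]] : ~~ coprime (b %/ d) J.
  apply/negP => aJ; apply: H; exists d, (b %/ d)%N; split=> //; first exact: dvdn_gcdr.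
  by rewrite mulnC divnK.
exists p; split=> //; rewrite pfactor_dvdn //.
have h1 : (0 < logn p (b %/ d))%N by rewrite logn_gt0 mem_primes pp a0.
have h2 : (logn p b = logn p (b %/ d) + logn p d)%N by rewrite -lognM // divnK.
have h3 : logn p d = minn (logn p b) (logn p c) by rewrite /d logn_gcd.
lia.
Qed.

(** Otherwise each a in A would contribute a prime of J, and the integers prime to J, which
have positive density, would contain no multiple of A. *)
Lemma behrend_exceeds (R : realType) A J c e : A `<=` posn -> behrend R A ->
  (0 < J)%N -> (0 < e)%N ->
  (forall a, A a -> exceeds J c (e * a)%N) -> exceeds J c e.
Proof.
move=> Ap; rewrite /behrend log_densityE // => dA J0 e0 hA; apply: contrapT => ne.
have ncop a : A a -> ~~ coprime a J.
  move=> Aa; have [p [pp pJ pea]] := hA _ Aa; apply/negP => caJ; apply: ne.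
  exists p; split=> //; move: pea; rewrite Gauss_dvdl //.
  by rewrite coprimeXl //; apply: coprime_dvdl pJ _; rewrite coprime_sym.
have pJ : periodic (fun n => coprime n J) by exists J; exact: has_period_coprime.
have h : (delta R A <= 1 - J%:R^-1)%R.
  apply: delta_le => X.
  apply: (@le_trans _ _ (dens R (fun n => ~~ coprime n J))).
    apply: le_dens; [exact: periodic_mult_below|exact: periodicN|].
    move=> n /multP[a [/ncop na _] an]; apply: contra na; exact: coprime_dvdl.
  rewrite densN // lerD2l lerN2 /dens (meanE (q := J)); last first.
    have [_ hq] := has_period_coprime J0.
    by split=> // n; rewrite hq.
  rewrite ler_peMr ?invr_ge0 //.
  have [J1|J1] := eqVneq J 1%N; first by rewrite /psum J1 big_nat1 coprimen1.
  rewrite /psum (bigD1_seq 1%N) ?iota_uniq ?mem_index_iota //=; last by lia.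
  by rewrite coprime1n lerDl; apply: sumr_ge0.
have : (0 < J%:R^-1 :> R)%R by rewrite invr_gt0 ltr0n.
lra.
Qed.

(** Windows are indexed by 0, ..., 2w, so that position j stands for the integer j - w and
[dist j w] is its absolute value. *)
Definition dist (i j : nat) : nat := (i - j) + (j - i).

Lemma dist_le i j m : i <= m -> j <= m -> dist i j <= m.
Proof. by rewrite /dist; lia. Qed.

Lemma dist_gt0 i j : (0 < dist i j) = (i != j).
Proof. by rewrite /dist; lia. Qed.

Lemma dvdn_dist d h i j : (d %| h + j)%N -> (d %| dist i j)%N = (d %| h + i)%N.
Proof.
rewrite /dist => dj; case: (leqP i j) => ij.
  have -> : (i - j + (j - i) = j - i)%N by lia.
  apply/idP/idP => H.
    have -> : (h + i = h + j - (j - i))%N by lia.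
    exact: dvdn_sub.
  have -> : (j - i = h + j - (h + i))%N by lia.
  exact: dvdn_sub.
have -> : (i - j + (j - i) = i - j)%N by lia.
have -> : (h + i = h + j + (i - j))%N by lia.
by rewrite dvdn_addr.
Qed.

Lemma dvdn_modeq d M x y w : (d %| M)%N -> x = y %[mod M] ->
  (d %| x + w)%N = (d %| y + w)%N.
Proof.
move=> dM xy; rewrite /dvdn -modnDml -[in RHS]modnDml.
by rewrite -(modn_dvdm x dM) xy modn_dvdm.
Qed.

Lemma coprime_modeq r M x y w : (r %| M)%N -> x = y %[mod M] ->
  coprime (x + w) r = coprime (y + w) r.
Proof.
move=> dM xy; rewrite -coprime_modl -[RHS]coprime_modl -modnDml -[in RHS]modnDml.
by rewrite -(modn_dvdm x dM) xy modn_dvdm.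
Qed.

(** The moduli Q = J0 * r are built one position at a time. For the position j a new a, prime
to the current modulus, is chosen with d * a in B and d dividing c j; the congruence
h = - j (mod a) is added to those already satisfied. Divisibility by d comes for free, since d
divides J0, hence h + w, and j - w. The factor a is prime to the other h + i because it is prime to
the differences i - j, which divide J0. *)
Lemma crt_cover B w J0 (s : seq nat) (c : nat -> nat) :
  B `<=` posn -> (0 < J0)%N -> ((2 * w)`! %| J0)%N ->
  (forall j, j \in s -> [/\ (j <= 2 * w)%N, (c j %| J0)%N, (c j %| dist j w)%N
     & approachable B (c j)]) ->
  exists r h, [/\ (0 < r)%N, coprime r J0, (J0 %| h + w)%N,
    forall j, j \in s -> exists2 b, B b & (b %| J0 * r)%N && (b %| h + j)%N
  & forall i, (i <= 2 * w)%N -> i \notin s -> coprime (h + i) r].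
Proof.
move=> Bp J00 wJ; elim: s => [|j s IH] hs.
  exists 1%N, (J0 * w - w)%N; split=> //; [exact: coprime1n| |by move=> *; exact: coprimen1].
  by rewrite subnK ?dvdn_mulr // leq_pmull.
have [r [h [r0 rJ hw hsr hni]]] : exists r h, [/\ (0 < r)%N, coprime r J0, (J0 %| h + w)%N,
    forall j, j \in s -> exists2 b, B b & (b %| J0 * r)%N && (b %| h + j)%N
  & forall i, (i <= 2 * w)%N -> i \notin s -> coprime (h + i) r].
  by apply: IH => i si; apply: hs; rewrite inE si orbT.
have [jw cJ cd] := hs j (mem_head _ _).
set M := (J0 * r)%N; have M0 : (0 < M)%N by rewrite muln_gt0 J00.
move=> /(_ M M0)[d [a [dc aM Bda]]].
have a0 : (0 < a)%N by have := Bp _ Bda; rewrite /posn /= muln_gt0 => /andP[].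
have Ma : coprime M a by rewrite coprime_sym.
have aJ : coprime a J0 by apply: coprime_dvdr aM; exact: dvdn_mulr.
have ar : coprime a r by apply: coprime_dvdr aM; exact: dvdn_mull.
pose h' := chinese M a h (a * j - j)%N.
have e1 : h' = h %[mod M] by exact: chinese_modl.
have e2 : h' = (a * j - j)%N %[mod a] by exact: chinese_modr.
have ah : (a %| h' + j)%N.
  by rewrite (dvdn_modeq j (dvdnn a) e2) subnK ?dvdn_mulr // leq_pmull.
have hw' : (J0 %| h' + w)%N by rewrite (dvdn_modeq w (dvdn_mulr r (dvdnn J0)) e1).
exists (r * a)%N, h'; split=> //.
- by rewrite muln_gt0 r0.
- by rewrite coprimeMl rJ.
- move=> i; rewrite inE => /predU1P[->|si].
    exists (d * a)%N => //.
    have dJ : (d %| J0)%N by exact: dvdn_trans cJ.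
    apply/andP; split.
      by rewrite mulnA dvdn_mul // dvdn_mulr.
    rewrite Gauss_dvd ?ah ?andbT; last by rewrite coprime_sym; exact: coprime_dvdr aJ.
    by rewrite -(dvdn_dist j (dvdn_trans dJ hw')); exact: dvdn_trans cd.
  have [b Bb /andP[bM bh]] := hsr _ si; exists b => //.
  by rewrite (dvdn_modeq i bM e1) bh andbT mulnA dvdn_mulr.
- move=> i iw; rewrite inE negb_or => /andP[ij si].
  rewrite coprimeMr (coprime_modeq i (dvdn_mull J0 (dvdnn r)) e1) hni //=.
  apply: contraT; rewrite coprime_sym => /(not_coprime_prime a0)[p [pp pa ph]].
  have : (p %| dist i j)%N by rewrite (dvdn_dist i (dvdn_trans pa ah)).
  have : (0 < dist i j <= 2 * w)%N by rewrite dist_gt0 ij dist_le.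
  move=> /dvdn_fact dw pd; have := dvdn_trans (dvdn_trans pd dw) wJ => pJ.
  have : (p %| gcdn a J0)%N by rewrite dvdn_gcd pa.
  by rewrite (eqP aJ) dvdn1 => /eqP p1; rewrite p1 in pp.
Qed.

Local Open Scope ring_scope.

(** Positive frequency of the window of eta_C in eta_(B1), for any B1 between B and C. The
positions in M_C are covered by [crt_cover]. The others have gcd (h + j, Q) = |j - w|, which
is what [taut_sparse_AP] asks for, and [taut_AP_freq] keeps them outside M_C. *)
Lemma window_freq (R : realType) B B1 C l w :
  B `<=` posn -> C `<=` posn -> taut R C -> realizing R C l ->
  (forall n, mult B n -> mult B1 n) -> (forall n, mult B1 n -> mult C n) ->
  (forall c, C c -> approachable B c) ->
  exists2 x : R, 0 < x & \forall i \near \oo, x * (l i)%:R <=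
    freq R (fun n => all (fun j => mult B1 (n + j) == mult C (dist j w)) (iota 0 (2 * w).+1)) (l i).
Proof.
move=> Bp Cp tC hl BB1 B1C hC.
(* If C is nonempty, 0 is in M_C and the remaining positions have |j - w| > 0. *)
have [C0|/set0P/negP/negPn/eqP C0] := pselect (C !=set0); last first.
  have mC n : mult C n = false by apply/negbTE/negP => /multP[a]; rewrite C0.
  exists 1 => //; near=> i; rewrite mul1r -(freqC R predT (l i)).
  rewrite [X in _ + X](_ : _ = 0) ?addr0; last by rewrite /freq big1.
  apply: le_freq => n _ _; apply/allP => j _; rewrite mC eqbF_neg.
  by apply/negP => /B1C; rewrite mC.
have mC0 : mult C 0 by case: C0 => c Cc; apply/multP; exists c.
pose idx := iota 0 (2 * w).+1.
pose s := [seq j <- idx | mult C (dist j w)].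
pose W := [seq j <- idx | ~~ mult C (dist j w)].
have hc j : exists c, mult C (dist j w) -> C c /\ (c %| dist j w)%N.
  have [/multP[c ? ?]|_] := boolP (mult C (dist j w)); last by exists 0%N.
  by exists c.
have [c {}hc] := choice hc.
pose e : R := (2 * (2 * w).+1%:R)^-1.
have w0 : 0 < (2 * w).+1%:R :> R by rewrite ltr0n.
have e0 : 0 < e by rewrite invr_gt0 mulr_gt0.
have hK j : exists K, ~~ mult C (dist j w) -> forall Q m0, (0 < Q)%N ->
    gcdn m0 Q = dist j w -> (K`! * dist j w %| Q)%N ->
    forall X, dens R (fun t => mult (below C X) (m0 + Q * t)%N) <= e.
  have [nC|_] := boolP (~~ mult C (dist j w)); last by exists 0%N.
  have d0 : (0 < dist j w)%N by rewrite lt0n; apply: contra nC => /eqP ->.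
  by have [K hK] := taut_sparse_AP Cp tC d0 nC e0; exists K.
have [K {}hK] := choice hK.
(* Divisible by K_j! * |j - w| for every j, by the c_j, and by all differences of positions. *)
pose J0 := ((2 * w)`! * (2 * w)`! * (\sum_(j <- idx) K j)`! * \prod_(j <- s) c j)%N.
have cs j : j \in s -> C (c j) /\ (c j %| dist j w)%N.
  by rewrite mem_filter => /andP[/hc].
have J00 : (0 < J0)%N.
  rewrite /J0 !muln_gt0 !fact_gt0 /= big_seq; apply: prodn_cond_gt0 => j /cs[Cc _].
  exact: Cp.
have wJ : ((2 * w)`! %| J0)%N by rewrite /J0 -!mulnA dvdn_mulr.
have [|r [h [r0 rJ hw hs hni]]] := @crt_cover B w J0 s c Bp J00 wJ.
  move=> j js; have [Cc cd] := cs _ js; split=> //; last exact: hC.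
    by move: js; rewrite mem_filter mem_iota add0n ltnS => /andP[_ /andP[]].
  by rewrite /J0 (big_rem j js) dvdn_mull // dvdn_mulr.
pose Q := (J0 * r)%N; have Q0 : (0 < Q)%N by rewrite muln_gt0 J00.
have eh : (h %% Q)%N = h %[mod Q] by rewrite modn_mod.
have [|||x x0 hx] := @taut_AP_freq R C l W Q (h %% Q)%N e Cp hl.
- exact: ltn_pmod.
- move=> j; rewrite mem_filter mem_iota add0n ltnS => /andP[jC /andP[_ jw]] X.
  have d0 : (0 < dist j w)%N by rewrite lt0n; apply: contra jC => /eqP ->.
  have dw : (dist j w <= 2 * w)%N by rewrite dist_le // mul2n -addnn leq_addr.
  have dvw : (dist j w %| (2 * w)`!)%N by apply: dvdn_fact; rewrite d0.
  have jid : j \in idx by rewrite mem_iota add0n ltnS.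
  apply: (hK j jC) => //.
    have cr : coprime (h %% Q + j) r.
      rewrite (coprime_modeq j (dvdn_mull J0 (dvdnn r)) eh); apply: hni => //.
      by rewrite mem_filter (negbTE jC).
    rewrite [X in gcdn _ X](mulnC J0 r : Q = _) Gauss_gcdr //.
    have hj : (J0 %| h %% Q + w)%N by rewrite (dvdn_modeq w (dvdn_mulr r (dvdnn J0)) eh).
    apply/eqP; rewrite eqn_dvd; apply/andP; split.
      rewrite (@dvdn_dist _ (h %% Q)%N); first exact: dvdn_gcdl.
      by apply: dvdn_trans hj; exact: dvdn_gcdr.
    have dJ : (dist j w %| J0)%N by exact: dvdn_trans wJ.
    rewrite dvdn_gcd dJ andbT -(dvdn_dist j (dvdn_trans dJ hj)); exact: dvdnn.
  apply: (dvdn_mulr r); rewrite /J0; apply: dvdn_mulr.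
  rewrite [X in (X %| _)%N]mulnC -mulnA; apply: dvdn_mul => //.
  apply: dvdn_mull; apply: dvdn_fact_fact.
  by rewrite (big_rem j) //= leq_addr.
- apply: (@le_lt_trans _ _ ((2 * w).+1%:R * e)).
    rewrite ler_pM2r // ler_nat size_filter; apply: leq_trans (count_size _ _) _.
    by rewrite size_iota.
  by rewrite /e invfM mulrCA mulfV ?lt0r_neq0 // mulr1 invf_lt1 // ltr1n.
exists x => //; near=> i.
apply: (@le_trans _ _ (freq R (fun n => (n %% Q == h %% Q)%N && all (fun j => ~~ mult C (n + j)) W) (l i))).
  by near: i.
apply: le_freq => n _ /andP[/eqP nh /allP hW]; apply/allP => j jid.
have [jC|jC] := boolP (mult C (dist j w)); last first.
  rewrite eqbF_neg; have /hW : j \in W by rewrite mem_filter jC.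
  by apply: contra; exact: B1C.
rewrite eqb_id; apply: BB1.
have [|b Bb /andP[bQ bh]] := hs j; first by rewrite mem_filter jC.
apply/multP; exists b => //.
by rewrite (dvdn_modeq j bQ nh).
Unshelve. all: by end_near. Qed.

(** * Orbit closures *)

(** The basic neighbourhoods of x in the product topology are the sets of points agreeing
with x on a window around 0. *)
Definition agree (w : nat) (x y : full_shift) : Prop :=
  forall n : int, (`|n| <= w)%N -> x n = y n.

Lemma agree_le w w' x y : (w <= w')%N -> agree w' x y -> agree w x y.
Proof. by move=> ww h n nw; apply: h; apply: leq_trans ww. Qed.

Lemma agree_sym w x y : agree w x y -> agree w y x.
Proof. by move=> h n nw; rewrite h. Qed.

Lemma agree_trans w x y z : agree w x y -> agree w y z -> agree w x z.
Proof. by move=> h h' n nw; rewrite h // h'. Qed.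

Definition cyl_filter (x : full_shift) : set_system full_shift :=
  [set A | exists w, forall y, agree w x y -> A y].

Lemma cyl_filter_filter x : Filter (cyl_filter x).
Proof.
split.
- by exists 0%N.
- move=> A B [w hA] [v hB]; exists (maxn w v) => y h; split.
    by apply: hA; apply: agree_le h; exact: leq_maxl.
  by apply: hB; apply: agree_le h; exact: leq_maxr.
- by move=> A B AB [w hA]; exists w => y /hA /AB.
Qed.

Lemma nbhs_agree (x : full_shift) A :
  nbhs x A <-> exists w, forall y, agree w x y -> A y.
Proof.
split; last first.
  move=> [w hw]; have : \forall y \near x, forall i : 'I_(2 * w).+1, x (i%:Z - w%:Z) = y (i%:Z - w%:Z).
    apply: (@filter_forall _ 'I_(2 * w).+1
      (fun i => [set y | x (i%:Z - w%:Z) = y (i%:Z - w%:Z)]) (nbhs x)) => i.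
    have h := @proj_continuous int (fun=> bool) (i%:Z - w%:Z) x [set x (i%:Z - w%:Z)].
    by apply: filterS (h _) => [y /= -> //|]; rewrite nbhs_principalE.
  apply: filterS => y hy; apply: hw => n nw.
  have nw' : (`|(n + w%:Z)%R| < (2 * w).+1)%N by lia.
  by have := hy (Ordinal nw') => /=; have -> : `|(n + w%:Z)%R|%N%:Z - w%:Z = n by lia.
have FF := cyl_filter_filter x.
suff : cyl_filter x --> x by apply.
apply/cvg_sup => i A' /= [B [[C oC <-] Cx] BA].
by exists `|i|%N => y h; apply: BA => /=; rewrite -h.
Qed.

Lemma orbit_closureP (x y : full_shift) :
  orbit_closure x y <-> forall w, exists k, agree w (shiftz k x) y.
Proof.
split=> [h w|h A /nbhs_agree[w hw]].
  have /h[_ [[k _ <-] hk]] : nbhs y [set z | agree w y z] by apply/nbhs_agree; exists w.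
  by exists k; exact: agree_sym.
have [k hk] := h w; exists (shiftz k x); split; first by exists k.
by apply: hw; exact: agree_sym.
Qed.

Lemma orbit_closure_self x : orbit_closure x x.
Proof. by apply/orbit_closureP => w; exists 0 => n _; rewrite /shiftz addr0. Qed.

Lemma orbit_closure_trans x y : orbit_closure x y ->
  orbit_closure y `<=` orbit_closure x.
Proof.
move=> /orbit_closureP xy z /orbit_closureP yz; apply/orbit_closureP => w.
have [k hk] := yz w; have [m hm] := xy (w + `|k|)%N.
exists (m + k) => n nw; rewrite -hk // /shiftz -hm; last by lia.
by rewrite /shiftz addrAC addrA addrAC.
Qed.

Lemma eta_seqE A n : eta_seq A n = ~~ mult A `|n|.
Proof.
rewrite /eta_seq; apply/idP/idP.
  by rewrite inE => h; apply/multP => -[a Aa an]; apply: h; exists a.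
by move=> /multP h; rewrite inE => -[a Aa an]; apply: h; exists a.
Qed.

(** Both sides say that M_(A') is contained in M_A. *)
Lemma le_eta A A' : le_coord (eta_seq A) (eta_seq A') <->
  forall a, A' a -> mult A a.
Proof.
split=> h.
  move=> a Aa; have := h a%:Z; rewrite !eta_seqE absz_nat (mult_self Aa) /=.
  by case: (mult A a).
move=> n; rewrite !eta_seqE; case: (boolP (mult A' _)) => [|_]; last by case: (~~ _).
by move=> /multP[a /h Aa an]; rewrite (mult_dvd Aa an).
Qed.

Lemma mult_sub_mult A A' n : (forall a, A a -> mult A' a) -> mult A n -> mult A' n.
Proof. by move=> h /multP[a /h Aa an]; apply: mult_dvd an. Qed.

Section Forward.
Variable R : realType.

Lemma orbit_closure_eta B B1 C : B `<=` posn -> C `<=` posn -> taut R C ->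
  (forall b, B b -> mult B1 b) -> (forall b, B1 b -> mult C b) ->
  (forall c, C c -> approachable B c) ->
  orbit_closure (eta_seq B1) (eta_seq C).
Proof.
move=> Bp Cp tC BB1 B1C hC; apply/orbit_closureP => w.
have [l hl] := exists_realizing R Cp.
have [x x0 hx] := window_freq w Bp Cp tC hl (fun n => mult_sub_mult BB1)
  (fun n => mult_sub_mult B1C) hC.
have l0 := near_seq hl.1 (nbhs_infty_gt 0).
have [i [h1 h2]] : exists i, (0 < l i)%N /\ x * (l i)%:R <=
    freq R (fun n => all (fun j => mult B1 (n + j) == mult C (dist j w)) (iota 0 (2 * w).+1)) (l i).
  by near \oo => i; exists i; split; near: i.
set P := fun n => all _ _ in h2.
have [n Pn] : exists n, P n.
  apply: contrapT => nP; move: h2; rewrite [freq _ _ _](_ : _ = 0).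
    by rewrite leNgt mulr_gt0 // ltr0n.
  rewrite /freq big1 // => n _; case: (boolP (P n)) => // Pn.
  by case: nP; exists n.
exists (n + w)%N%:Z => m mw; rewrite /shiftz !eta_seqE; congr (~~ _).
have := allP Pn (`|(m + w%:Z)%R|%N); rewrite mem_iota add0n => /(_ _)/eqP.
have -> : dist `|(m + w%:Z)%R|%N w = `|m|%N by rewrite /dist; lia.
have -> : (n + `|(m + w%:Z)%R| = `|(m + (n + w)%N%:Z)%R|)%N by lia.
by apply; lia.
Unshelve. all: by end_near. Qed.

End Forward.

Section Backward.
Variable R : realType.

(** Let d = gcd (r, b) be outside M_C. The class of r modulo b contains d * u with u prime to
any given number, so it contains a progression in which M_C is sparse. *)
Lemma taut_class C r b : C `<=` posn -> taut R C -> (0 < b)%N ->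
  (forall n, n = r %[mod b] -> mult C n) -> mult C b.
Proof.
move=> Cp tC b0 hr; apply: contrapT => /negP nCb.
(* A positive representative of the class, so that it has a set of prime divisors. *)
set r0 := (r + b)%N; have r00 : (0 < r0)%N by rewrite addn_gt0 b0 orbT.
set d := gcdn r0 b; have d0 : (0 < d)%N by rewrite gcdn_gt0 r00.
have nCd : ~~ mult C d by apply: contra nCb => /mult_dvd; apply; exact: dvdn_gcdr.
have half : (0 : R) < 2^-1 by rewrite invr_gt0.
have [K hK] := taut_sparse_AP Cp tC d0 nCd half.
set r' := (r0 %/ d)%N; set b' := (b %/ d)%N.
have er : (d * r' = r0)%N by rewrite /r' mulnC divnK // dvdn_gcdl.
have eb : (d * b' = b)%N by rewrite /b' mulnC divnK // dvdn_gcdr.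
have r'0 : (0 < r')%N by rewrite lt0n; apply/eqP => h; move: r00; rewrite -er h muln0.
have crb : coprime r' b'.
  by rewrite /coprime -(eqn_pmul2l d0) muln_gcdr er eb muln1.
set Q := (K`! * b)%N; have Q0 : (0 < Q)%N by rewrite muln_gt0 fact_gt0.
(* The part of Q prime to r': it makes r' + b' * s prime to Q. *)
set s := (Q`_(\pi(r')^'))%N.
set u := (r' + b' * s)%N; have u0 : (0 < u)%N by rewrite addn_gt0 r'0.
have cuQ : coprime u Q.
  apply: contraT => /(not_coprime_prime u0)[p [pp pu pQ]].
  have [pr|pr] := boolP (p %| r')%N.
    have : (p %| b' * s)%N by rewrite -(dvdn_addr _ pr).
    rewrite Euclid_dvdM // => /orP[pb|ps].
      have : (p %| gcdn r' b')%N by rewrite dvdn_gcd pr.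
      by rewrite (eqP crb) dvdn1 => /eqP p1; rewrite p1 in pp.
    have /pnatP/(_ p pp ps) := part_pnat (\pi(r')^')%N Q; rewrite ?part_gt0 //.
    by move=> /(_ isT); rewrite !inE /= mem_primes pp r'0 pr.
  have ps : (p %| s)%N.
    have h : ((\pi(r')^').-nat p)%N.
      by rewrite pnatE // !inE /= mem_primes pp r'0.
    by rewrite -(part_pnat_id h); exact: partn_dvd.
  by move: pr; rewrite -(dvdn_addl _ (dvdn_mull b' ps)) pu.
set m0 := (d * u)%N.
have em0 : m0 = (r0 + b * s)%N by rewrite /m0 /u mulnDr er mulnA eb.
have gm : gcdn (m0 %% Q) Q = d.
  rewrite gcdn_modl /m0 -[Q](_ : d * (K`! * b') = _)%N; last by rewrite mulnCA eb.
  rewrite -muln_gcdr; suff -> : gcdn u (K`! * b') = 1%N by rewrite muln1.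
  apply/eqP; apply: coprime_dvdr cuQ; rewrite /Q -eb dvdn_mul // dvdn_mull //.
have KQ : (K`! * d %| Q)%N by rewrite /Q dvdn_mul // dvdn_gcdr.
have [l hl] := exists_realizing R Cp.
have [|||x x0 hx] := @taut_AP_freq R C l [:: 0%N] Q (m0 %% Q)%N 2^-1 Cp hl.
- exact: ltn_pmod.
- by move=> i; rewrite inE => /eqP -> X; rewrite addn0; exact: hK.
- by rewrite /= mul1r invf_lt1 // ltr1n.
have l0 := near_seq hl.1 (nbhs_infty_gt 0).
have [i [h1 h2]] : exists i, (0 < l i)%N /\ x * (l i)%:R <=
   freq R (fun n => (n %% Q == m0 %% Q)%N && all (fun j => ~~ mult C (n + j)) [:: 0%N]) (l i).
  by near \oo => i; exists i; split; near: i.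
move: h2; rewrite [freq _ _ _](_ : _ = 0); first by rewrite leNgt mulr_gt0 // ltr0n.
rewrite /freq big1 // => n _ /=; rewrite andbT addn0.
case: eqP => // nm; rewrite hr //.
have bQ : (b %| Q)%N by exact: dvdn_mull.
by rewrite -(modn_dvdm n bQ) nm (modn_dvdm _ bQ) em0 /r0 -addnA -mulnS addnC mulnC modnMDl.
Unshelve. all: by end_near. Qed.

(** If M_C missed a point of every class modulo b, a window containing all these points
would occur in eta_(B1) at some place k, and the class of - k gives a contradiction. *)
Lemma backward_taut B1 C b : C `<=` posn -> taut R C ->
  orbit_closure (eta_seq B1) (eta_seq C) -> (0 < b)%N -> B1 b -> mult C b.
Proof.
move=> Cp tC /orbit_closureP h b0 Bb; apply: contrapT => nC.
have hr r : exists n, n = r %[mod b] /\ ~~ mult C n.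
  apply: contrapT => H; apply: nC; apply: (@taut_class C r b) => // n nr.
  by apply: contrapT => /negP nCn; apply: H; exists n.
have [f hf] := choice hr.
pose w := (\sum_(0 <= r < b) f r)%N.
have [k hk] := h w.
pose r := `|(- k %% b%:Z)%Z|%N.
have bz : b%:Z != 0 by rewrite -lt0n.
have rE : r%:Z = (- k %% b%:Z)%Z by rewrite /r gez0_abs // modz_ge0.
have rb : (r < b)%N by rewrite -ltz_nat rE ltz_pmod.
have fw : (`|(f r)%:Z| <= w)%N.
  by rewrite /w absz_nat (bigD1_seq r) ?iota_uniq ?mem_index_iota //= leq_addr.
have := hk _ fw; rewrite /shiftz !eta_seqE absz_nat (hf r).2 => /negP; apply.
apply/multP; exists b => //.
have : (b%:Z %| (f r)%:Z + k)%Z.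
  have e : ((f r)%:Z = - k %[mod b%:Z])%Z.
    by rewrite modz_nat (hf r).1 -modz_nat rE modz_mod.
  by rewrite -[X in _ + X]opprK -eqz_mod_dvd; apply/eqP.
by [].
Qed.

(** Translated by k, the multiples of B1 are covered by one class modulo p^(v+1) for each
prime p of J, where v = v_p (c). An integer j in {0, 1} modulo p is chosen for each p so that
c * j avoids that class; this is possible because p^(v+1) does not divide c. *)
Lemma backward_exceeds B1 C J c : (0 < c)%N -> (0 < J)%N -> C c ->
  (forall b, B1 b -> exceeds J c b) ->
  ~ orbit_closure (eta_seq B1) (eta_seq C).
Proof.
move=> c0 J0 Cc hB /orbit_closureP h.
pose P := (\prod_(p <- primes J) p)%N.
have [k hk] := h (c * P)%N.
pose S p := ((p ^ (logn p c).+1)%N%:Z %| k)%Z.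
pose P1 := (\prod_(p <- primes J | S p) p)%N.
pose P0 := (\prod_(p <- primes J | ~~ S p) p)%N.
have PE : P = (P1 * P0)%N by rewrite /P (bigID S).
have pr p : p \in primes J -> prime p by rewrite mem_primes => /and3P[].
have P10 : (0 < P1)%N by rewrite /P1 big_seq_cond prodn_cond_gt0 // => p /andP[/pr/prime_gt0].
have P00 : (0 < P0)%N by rewrite /P0 big_seq_cond prodn_cond_gt0 // => p /andP[/pr/prime_gt0].
have co : coprime P1 P0.
  rewrite /P1 big_seq_cond; elim/big_ind: _ => [|m n hm hn|p /andP[pJ Sp]]; first exact: coprime1n.
    by rewrite coprimeMl hm.
  rewrite coprime_sym /P0 big_seq_cond; elim/big_ind: _ => [|m n hm hn|q /andP[qJ Sq]]; first exact: coprime1n.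
    by rewrite coprimeMl hm.
  rewrite prime_coprime ?pr // dvdn_prime2 ?pr //.
  by apply: contra Sq => /eqP ->.
(* j = 1 modulo the primes whose power divides k, j = 0 modulo the others. *)
pose j := (chinese P1 P0 1 0 %% P)%N.
have jP : (j < P)%N by rewrite ltn_pmod // PE muln_gt0 P10.
have j1 : j = 1 %[mod P1].
  by rewrite /j PE modn_dvdm ?dvdn_mulr // chinese_modl.
have j0 : (P0 %| j)%N.
  by rewrite /dvdn /j PE modn_dvdm ?dvdn_mull // chinese_modr // mod0n.
have cjw : (`|(c * j)%N%:Z| <= c * P)%N by rewrite absz_nat leq_mul2l (ltnW jP) orbT.
have := hk _ cjw; rewrite /shiftz !eta_seqE absz_nat.
have -> : mult C (c * j) by apply: mult_dvd (mult_self Cc) _; exact: dvdn_mulr.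
move=> /negbFE/multP[b Bb bk].
have [p [pp pJ pb]] := hB _ Bb.
have pJ' : p \in primes J by rewrite mem_primes pp J0.
set q := (p ^ (logn p c).+1)%N in pb.
have qk : (q%:Z %| (c * j)%N%:Z + k)%Z.
  by rewrite -[(_ %| _)%Z]/(q %| _)%N; exact: dvdn_trans bk.
have nqc : ~~ (q %| c)%N by rewrite /q pfactor_dvdn // ltnn.
have pvc : (p ^ logn p c %| c)%N by rewrite pfactor_dvdn.
have [Sp|nSp] := boolP (S p).
  have : (q%:Z %| (c * j)%N%:Z)%Z by rewrite -(rpredDr _ Sp).
  have pP1 : (p %| P1)%N by rewrite /P1 (big_rem p) //= Sp dvdn_mulr.
  have pj : j = 1 %[mod p] by rewrite -(modn_dvdm j pP1) j1 modn_dvdm.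
  have cpj : coprime p j.
    by rewrite -coprime_modr pj coprime_modr coprimen1.
  move=> qcj; case/negP: nqc.
  have : (q %| c * j)%N by [].
  by rewrite Gauss_dvdl // coprimeXl.
have pP0 : (p %| P0)%N by rewrite /P0 (big_rem p) //= nSp dvdn_mulr.
case/negP: nSp; rewrite /S -/q.
have : (q%:Z %| (c * j)%N%:Z)%Z.
  rewrite -[(_ %| _)%Z]/(q %| c * j)%N /q expnSr dvdn_mul //.
  exact: dvdn_trans j0.
by move=> hq; rewrite -(rpredDl _ hq).
Qed.

End Backward.

(** * Behrend divisors *)

Section BehrendDivisors.
Variable R : realType.

(** Suppose e * A is in B and A is Behrend. If e were not in M_C, then M_C would be sparse
in e * (1 + M * Z) for suitable M. But it contains e * M_A, and M_A has density 1 in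
1 + M * Z. *)
Lemma behrend_divisor_mult B C e : C `<=` posn -> taut R C ->
  (forall b, B b -> mult C b) -> behrend_divisors R B e -> mult C e.
Proof.
move=> Cp tC BC [e0 [A [Ap]]]; rewrite /behrend log_densityE // => dA eA.
apply: contrapT => /negP nCe.
have half : (0 : R) < 2^-1 by rewrite invr_gt0.
have [K hK] := taut_sparse_AP Cp tC e0 nCe half.
(* The factor 2 ensures that 1 is a reduced residue modulo M also for small K. *)
pose M := (K`! * 2)%N; pose Q := (M * e)%N.
have M1 : (1 < M)%N by exact: leq_trans (leqnn (1 * 2)) (leq_mul (fact_gt0 K) (leqnn 2)).
have M0 : (0 < M)%N by exact: ltnW.
have Q0 : (0 < Q)%N by rewrite muln_gt0 M0.
have M0' : 0 < M%:R :> R by rewrite ltr0n.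
have m40 : 0 < (4 * M%:R)^-1 :> R by rewrite invr_gt0 mulr_gt0.
have [Y] := delta_approx Ap m40; rewrite dA => hY.
set P := mult (below A Y) in hY.
have pP : periodic P by exact: periodic_mult_below.
have pP1 : periodic (fun t => P (1 + M * t)%N) by exact: periodic_affine.
have h1 : dens R (fun t => ~~ P (1 + M * t)%N) <= 4^-1.
  have h : M%:R^-1 * dens R (fun t => ~~ P (1 + M * t)%N) <= dens R (fun n => ~~ P n).
    rewrite -(dens_AP R M1 (periodicN pP)).
    apply: le_dens; [|exact: periodicN|by move=> n /andP[]].
    apply: (periodic_comp2 andb); last exact: periodicN.
    exact: (@periodic_modn _ (fun m => m == 1)%N).
  have {h} : M%:R^-1 * dens R (fun t => ~~ P (1 + M * t)%N) <= (4 * M%:R)^-1.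
    by apply: (le_trans h); rewrite densN //; lra.
  by rewrite invfM [leRHS]mulrC ler_pM2l ?invr_gt0.
have h2 : dens R (fun t => P (1 + M * t)%N) <= 2^-1.
  apply: le_trans (hK Q e Q0 _ _ (e * Y)%N).
  - apply: le_dens => //; first exact/periodic_affine/periodic_mult_below.
    move=> t /multP[a [Aa aY] at1].
    have [c Cc cea] := multP _ _ (BC _ (eA _ Aa)).
    apply/multP; exists c.
      split=> //; have a0 : (0 < a)%N := Ap _ Aa.
      by apply: leq_trans (dvdn_leq _ cea) _; rewrite ?muln_gt0 ?e0 // leq_mul2l aY orbT.
    apply: (dvdn_trans cea); have -> : (e + Q * t = e * (1 + M * t))%N by rewrite /Q mulnDr muln1 mulnA (mulnC e).
    by rewrite dvdn_pmul2l.
  - by rewrite /Q; apply/gcdn_idPl; exact: dvdn_mull.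
  - by rewrite /Q dvdn_mul // dvdn_mulr.
by move: h1; rewrite densN //; lra.
Qed.

Lemma Bprime_posn B : B `<=` posn -> Bprime R B `<=` posn.
Proof. by move=> Bp b [[/Bp//|[]]]. Qed.

Lemma mult_Bprime B b : B `<=` posn -> B b -> mult (Bprime R B) b.
Proof.
move=> Bp Bb; rewrite mult_prim; first by apply: mult_self; left.
by move=> a [/Bp|[]].
Qed.

Lemma Bprime_mult B C : C `<=` posn -> taut R C ->
  (forall b, B b -> mult C b) -> forall b, Bprime R B b -> mult C b.
Proof.
by move=> Cp tC BC b [[/BC//|/(behrend_divisor_mult Cp tC BC)]].
Qed.

Lemma Bprime_exceeds B J c : (0 < J)%N ->
  (forall b, B b -> exceeds J c b) -> forall b, Bprime R B b -> exceeds J c b.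
Proof.
move=> J0 hB b [[/hB//|[b0 [A [Ap bA hA]]]] _].
by apply: behrend_exceeds bA J0 b0 _ => // a /hA /hB.
Qed.

End BehrendDivisors.

(** * A uniformly distributed profinite integer *)

(** Reversal of factorial-base digits: the j-th of the K! equal subintervals of [0, 1) is
labelled by the integer whose digits are those of j in reverse order, so that refining the
subdivision refines the residue class of the label. *)
Fixpoint revdigits (K j : nat) : nat :=
  if K is K'.+1 then (revdigits K' (j %/ K) + K'`! * (j %% K))%N else 0%N.

Lemma revdigits_lt K j : (revdigits K j < K`!)%N.
Proof.
elim: K j => // K IH j; rewrite [revdigits _ _]/= factS mulSn addnC.
have := IH (j %/ K.+1)%N; have := fact_gt0 K; set r := revdigits _ _; set f := K`! => f0 rf.
have : (j %% K.+1 <= K)%N by rewrite -ltnS ltn_pmod.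
move=> jK; apply: (@leq_trans (f * (j %% K.+1) + f)%N); first by rewrite ltn_add2l.
by rewrite [leqRHS]addnC leq_add2r mulnC leq_mul2r jK orbT.
Qed.

Lemma revdigits_inj K j j' : (j < K`!)%N -> (j' < K`!)%N -> revdigits K j = revdigits K j' -> j = j'.
Proof.
elim: K j j' => [|K IH] j j'.
  by rewrite fact0 !ltnS !leqn0 => /eqP -> /eqP ->.
rewrite factS mulnC => jK jK' /= h.
have lt m : (m < K`! * K.+1)%N -> (m %/ K.+1 < K`!)%N by move=> mK; rewrite ltn_divLR.
have e1 : revdigits K (j %/ K.+1) = revdigits K (j' %/ K.+1).
  have := congr1 (modn^~ K`!) h.
  by rewrite /= -modnDmr modnMr addn0 modn_small ?revdigits_lt // -modnDmr modnMr addn0 modn_small ?revdigits_lt.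
have e2 : (j %/ K.+1 = j' %/ K.+1)%N by apply: IH => //; exact: lt.
move: h; rewrite e1 => /eqP; rewrite eqn_add2l eqn_pmul2l ?fact_gt0 // => /eqP e3.
by rewrite (divn_eq j K.+1) (divn_eq j' K.+1) e2 e3.
Qed.

Lemma dvdz_modeq c M r r' (n : int) : (c %| M)%N -> r = r' %[mod M] ->
  (c%:Z %| r%:Z + n)%Z = (c%:Z %| r'%:Z + n)%Z.
Proof.
move=> cM h; have e : (r %% c = r' %% c)%N by rewrite -(modn_dvdm r cM) h modn_dvdm.
rewrite {1}(divn_eq r c) [in RHS](divn_eq r' c) e !PoszD !PoszM -!addrA.
have H (q : nat) x : (c%:Z %| q%:Z * c%:Z + x)%Z = (c%:Z %| x)%Z.
  by apply: (rpredDl x); exact: dvdz_mull (dvdzz _).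
by rewrite !H.
Qed.

Section Residues.
Variable R : realType.

Definition digit K (u : R) : nat := Num.truncn (K`!%:R * u).
(** The residue modulo K! of a random profinite integer. *)
Definition res K (u : R) : nat := revdigits K (digit K u).

(** Passing to a coarser subdivision forgets the last digit. *)
Lemma digit_div K u : (digit K.+1 u %/ K.+1)%N = digit K u.
Proof.
have f0 k : 0 < k`!%:R :> R by rewrite ltr0n fact_gt0.
have [u0|u0] := ltP u 0.
  have h k : digit k u = 0%N.
    by apply/truncn0Pn; rewrite -ltNge (lt_trans _ ltr01) // pmulr_rlt0.
  by rewrite !h div0n.
apply/esym/truncn_def.
have x0 : 0 <= K.+1`!%:R * u by rewrite mulr_ge0 // ltW.
have /andP[h1 h2] := truncn_itv x0; rewrite -/(digit K.+1 u) in h1 h2.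
set j := digit _ _ in h1 h2 *.
have e : K.+1`!%:R * u = K.+1%:R * (K`!%:R * u) by rewrite factS natrM mulrA.
rewrite e in h1 h2; set x := K`!%:R * u in h1 h2 *.
have K0 : 0 < K.+1%:R :> R by rewrite ltr0n.
apply/andP; split.
  rewrite -(ler_pM2l K0); apply: le_trans h1; rewrite -natrM ler_nat mulnC.
  exact: leq_divM.
rewrite -(ltr_pM2l K0); apply: (lt_le_trans h2); rewrite -natrM ler_nat mulnC.
exact: ltn_ceil.
Qed.

Lemma res_coherent K K' u : (K <= K')%N -> res K' u = res K u %[mod K`!].
Proof.
move=> /subnK <-; elim: (K' - K)%N => // k IH; rewrite addSn -IH.
have d := dvdn_fact_fact (leq_addl k K).
rewrite -(modn_dvdm (res (k + K).+1 u) d) /res /= digit_div.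
by rewrite -modnDmr modnMr addn0 !modn_dvdm.
Qed.

Lemma measurable_digit_ge K n : measurable [set u : R | (n <= digit K u)%N].
Proof.
case: n => [|n].
  by rewrite (_ : [set _ | _] = setT) //; apply/seteqP; split.
have f0 : 0 < K`!%:R :> R by rewrite ltr0n fact_gt0.
rewrite (_ : [set _ | _] = `[n.+1%:R / K`!%:R, +oo[%classic).
  exact: measurable_itv.
apply/seteqP; split=> u /=; rewrite in_itv /= andbT /digit truncn_gt_nat.
  by rewrite ler_pdivrMr // mulrC.
by rewrite ler_pdivrMr // mulrC.
Qed.

Lemma measurable_digit_eq K n : measurable [set u : R | digit K u = n].
Proof.
rewrite (_ : [set _ | _] = [set u : R | (n <= digit K u)%N] `\` [set u : R | (n.+1 <= digit K u)%N]).
  by apply: measurableD; exact: measurable_digit_ge.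
apply/seteqP; split=> u /=; first by move=> ->; split=> //; rewrite ltnn.
by move=> [h /negP]; rewrite -leqNgt => h'; apply/eqP; rewrite eqn_leq h' h.
Qed.

Lemma measurable_digit K (T : pred nat) : measurable [set u : R | T (digit K u)].
Proof.
rewrite (_ : [set _ | _] = \bigcup_(n in T) [set u : R | digit K u = n]).
  by apply: bigcup_measurable => n _; exact: measurable_digit_eq.
by apply/seteqP; split=> u /=; [move=> h; exists (digit K u)|move=> [n Tn /= ->]].
Qed.

Definition unif01 : probability (measurableTypeR R) R := uniform_prob (@ltr01 R).

Lemma unif01_digit K j : (j < K`!)%N -> unif01 [set u | digit K u = j] = (K`!%:R^-1)%:E.
Proof.
move=> jK; have f0 : 0 < K`!%:R :> R by rewrite ltr0n fact_gt0.
rewrite /unif01 /= /uniform_prob integral_uniform_pdf.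
have -> : [set u | digit K u = j] `&` `[0, 1]%classic =
    `[j%:R / K`!%:R, j.+1%:R / K`!%:R[%classic.
  apply/seteqP; split=> u /=; rewrite !in_itv /=.
    move=> [dj /andP[u0 u1]].
    have := @truncn_itv R (K`!%:R * u); rewrite mulr_ge0 ?(ltW f0) // => /(_ isT).
    by rewrite -/(digit K u) dj ler_pdivrMr // ltr_pdivlMr // mulrC.
  rewrite ler_pdivrMr // ltr_pdivlMr // => /andP[h1 h2]; split.
    by apply: truncn_def; rewrite mulrC h1.
  apply/andP; split.
    by rewrite -(pmulr_lge0 _ f0); apply: le_trans h1.
  rewrite -(ler_pM2r f0) mul1r; apply: (le_trans (ltW h2)); by rewrite ler_nat.
rewrite (eq_integral (cst 1%E)); last first.
  move=> u; rewrite inE /= in_itv /= => /andP[h1 h2].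
  rewrite /uniform_pdf subr0 invr1 ifT //; apply/andP; split.
    by apply: le_trans h1; rewrite divr_ge0 // ltW.
  by apply: (le_trans (ltW h2)); rewrite ler_pdivrMr // mul1r ler_nat.
rewrite integral_cst //= mul1e lebesgue_measure_itv /= lte_fin ltr_pM2r ?invr_gt0 // ltr_nat ltnSn.
by rewrite -EFinB -mulrBl -natrB // subSnn mul1r.
Qed.

Lemma unif01_digit_lt K N (T : pred nat) : (N <= K`!)%N ->
  unif01 [set u | (digit K u < N)%N && T (digit K u)] =
  (K`!%:R^-1 * \sum_(0 <= j < N) (T j)%:R)%:E.
Proof.
elim: N => [|N IH] NK.
  rewrite (_ : [set _ | _] = set0) ?measure0 ?big_geq ?mulr0 //.
  by apply/seteqP; split.
rewrite big_nat_recr //= mulrDr EFinD -IH ?(ltnW NK) //.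
rewrite (_ : [set _ | _] = [set u | (digit K u < N)%N && T (digit K u)] `|`
   (if T N then [set u | digit K u = N] else set0)).
  rewrite measureU.
  - congr (_ + _)%E; case: (T N); last by rewrite measure0 mulr0.
    by rewrite mulr1; exact: unif01_digit.
  - exact: (measurable_digit K (fun n => (n < N)%N && T n)).
  - by case: (T N) => //; exact: measurable_digit_eq.
  - case: (T N); last by rewrite setI0.
    by apply/seteqP; split=> // u /= [/andP[+ _] e]; rewrite e ltnn.
apply/seteqP; split=> u /=.
  rewrite ltnS leq_eqVlt => /andP[/predU1P[e Te|lt Te]]; last by left; rewrite lt.
  by right; rewrite -e Te.
move=> [/andP[lt ->]|]; first by rewrite ltnS (ltnW lt).
by case: ifP => // TN /= ->; rewrite ltnS leqnn.
Qed.

(** Equality is obtained from the lower bound applied to S and to its complement, which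
disposes of the real numbers outside [0, 1) without computing their mass. *)
Lemma unif01_res K (S : pred nat) :
  unif01 [set u | S (res K u)] = (K`!%:R^-1 * \sum_(0 <= r < K`!) (S r)%:R)%:E.
Proof.
have sumE (T : pred nat) : \sum_(0 <= j < K`!) (T (revdigits K j))%:R = \sum_(0 <= r < K`!) (T r)%:R :> R.
  rewrite !big_mkord.
  pose s (i : 'I_(K`!)) : 'I_(K`!) := Ordinal (revdigits_lt K i).
  have sinj : injective s.
    by move=> i j /(congr1 val) /= h; apply/val_inj; exact: revdigits_inj h.
  by rewrite [RHS](reindex_inj sinj).
have lb (T : pred nat) :
   ((K`!%:R^-1 * \sum_(0 <= r < K`!) (T r)%:R)%:E <= unif01 [set u | T (res K u)])%E.
  rewrite -sumE -(unif01_digit_lt (T \o revdigits K)) //.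
  apply: le_measure; rewrite ?inE.
  - exact: (measurable_digit K (fun n => (n < K`!)%N && T (revdigits K n))).
  - exact: (measurable_digit K (fun n => T (revdigits K n))).
  - by move=> u /= /andP[].
apply/eqP; rewrite eq_le lb andbT.
have := lb (fun n => ~~ S n).
have -> : [set u | ~~ S (res K u)] = ~` [set u | S (res K u)].
  by apply/seteqP; split=> u /= /negP.
rewrite probability_setC; last exact: (measurable_digit K (fun n => S (revdigits K n))).
have -> : \sum_(0 <= r < K`!) (~~ S r)%:R = K`!%:R - \sum_(0 <= r < K`!) (S r)%:R :> R.
  apply/eqP; rewrite eq_sym subr_eq -big_split /=; apply/eqP/esym.
  rewrite (eq_bigr (fun=> 1)) ?sumr_const_nat ?subn0 //.
  by move=> r _; case: (S r); rewrite ?addr0 ?add0r.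
rewrite mulrBr mulVf ?pnatr_eq0 -?lt0n ?fact_gt0 // EFinB.
set p := unif01 _; have pf : p \is a fin_num by apply: fin_num_measure; exact: (measurable_digit K (fun n => S (revdigits K n))).
rewrite -(fineK pf) -!EFinB !lee_fin; lra.
Qed.

End Residues.

(** * Sets depending on finitely many coordinates *)

Definition word w := {ffun 'I_(2 * w).+1 -> bool}.

Definition window w (x : full_shift) : word w := [ffun i : 'I_(2 * w).+1 => x (i%:Z - w%:Z)].

Definition unwindow w (v : word w) : full_shift :=
  fun n => v (inord `|n + w%:Z|).

Lemma agree_window w x y : agree w x y <-> window w x = window w y.
Proof.
split=> [h|h n nw].
  by apply/ffunP => i; rewrite !ffunE h //; have := ltn_ord i; lia.
have nw' : (`|(n + w%:Z)%R| < (2 * w).+1)%N by lia.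
have := congr1 (fun v : word w => v (Ordinal nw')) h; rewrite !ffunE /=.
by have -> : `|(n + w%:Z)%R|%N%:Z - w%:Z = n by lia.
Qed.

Lemma unwindowK w : cancel (@unwindow w) (window w).
Proof.
move=> v; apply/ffunP => i; rewrite ffunE /unwindow; congr (v _).
by apply/val_inj; rewrite /= inordK; have := ltn_ord i; lia.
Qed.

(** U depends on the coordinates in the window only. *)
Definition determined w (U : set full_shift) : Prop :=
  forall x y, agree w x y -> U x -> U y.

Lemma open_determined w U : determined w U -> open U.
Proof.
move=> h; rewrite openE => x Ux; apply/nbhs_agree; exists w => y xy; exact: h Ux.
Qed.

Definition determined_sets : set (set full_shift) := [set U | exists w, determined w U].

Lemma measurable_open (U : set full_shift) : open U -> measurable (U : set borel_shift).
Proof. by move=> oU; exact: sub_gen_smallest. Qed.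

Lemma measurable_determined w U : determined w U -> measurable (U : set borel_shift).
Proof. by move=> /open_determined/measurable_open. Qed.

Definition cyl w (x : full_shift) : set full_shift := [set y | agree w x y].

Lemma determined_cyl w x : determined w (cyl w x).
Proof. by move=> y z yz xy; exact: agree_trans xy yz. Qed.

(** An open set is exhausted by its w-interiors, which are determined by windows. This is how
the countable base enters the measurability arguments. *)
Lemma open_bigcup_determined U : open U ->
  U = \bigcup_w [set x | cyl w x `<=` U].
Proof.
move=> oU; apply/seteqP; split=> x.
  by move=> Ux; have /nbhs_agree[w hw] := open_nbhs_nbhs (conj oU Ux); exists w.
by move=> [w _ /= h]; apply: h => n _.
Qed.

Lemma determined_interior w U : determined w [set x | cyl w x `<=` U].
Proof. by move=> x y xy h z yz; apply: h; exact: agree_trans xy yz. Qed.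

Lemma open_sub_gen_determined : @open full_shift `<=` <<s determined_sets >>.
Proof.
move=> U oU; rewrite (open_bigcup_determined oU).
apply: sigma_algebra_bigcup => w.
by apply: sub_sigma_algebra; exists w; exact: determined_interior.
Qed.

Section Integral.
Variable R : realType.

Lemma full_shift_compact : compact [set: full_shift].
Proof.
have := @tychonoff int (fun=> bool) (fun=> setT) (fun=> bool_compact).
by rewrite (_ : [set f | _] = setT) //; apply/seteqP; split.
Qed.

(** Uniform continuity on a compact space, in terms of windows. *)
Lemma uniformly_windowed (f : full_shift -> R) e : continuous f -> 0 < e ->
  exists w, forall x y, agree w x y -> `|f x - f y| <= e.
Proof.
move=> cf e0; have e2 : 0 < e / 2 by lra.
have /compact_near_coveringP := full_shift_compact.
move=> /(_ nat \oo (fun w x => forall y, agree w x y -> `|f x - f y| <= e)).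
case.
- move=> x _; have /cvgrPdist_le/(_ _ e2)/nbhs_agree[w hw] := cf x.
  exists ([set y | agree w x y], [set v | (w <= v)%N]).
    split; first by apply/nbhs_agree; exists w.
    exact: nbhs_infty_ge.
  move=> [x' v] [/= xx' wv] y x'y.
  have h1 := hw _ xx'; have h2 := hw y (agree_trans xx' (agree_le wv x'y)).
  have -> : f x' - f y = (f x - f y) - (f x - f x') by lra.
  apply: le_trans (ler_normB _ _) _; lra.
- move=> w _ hw; exists w => x y xy; exact: (hw w (leqnn w) x I y xy).
Qed.

Lemma measurable_continuous (f : full_shift -> R) : continuous f ->
  measurable_fun [set: borel_shift] (f : borel_shift -> R).
Proof.
move=> cf; apply: (measurability _ (RGenOInfty.measurableE R)) => _ [_ [a ->] <-].
rewrite setTI; apply: measurable_open.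
by apply: open_comp => [x _|]; [exact: cf|exact: interval_open].
Qed.

Variable mu : {measure set borel_shift -> \bar R}.
Hypothesis mu1 : mu setT = 1%E.

Lemma measure_fin_num U : measurable U -> mu U \is a fin_num.
Proof.
move=> mU; rewrite ge0_fin_numE //; apply: le_lt_trans (_ : mu U <= mu setT)%E _.
  by apply: le_measure; rewrite ?inE.
by rewrite mu1 ltry.
Qed.

Let word_set w (v : word w) : set borel_shift := [set x | window w x = v].

Let m_word w v : measurable (@word_set w v).
Proof.
apply: (@measurable_determined w); rewrite /word_set => x y /agree_window /= -> //.
Qed.

Let integrable_word_indic w (v : word w) :
  mu.-integrable setT (fun x => (\1_(word_set v) x)%:E).
Proof.
apply: measurable_bounded_integrable => //.
  by rewrite mu1 ltry.
exists 1; split; first exact: num_real.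
move=> M hM x _ /=; rewrite indicE ger0_norm //.
by apply: le_trans (ltW hM); case: (_ \in _).
Qed.

Lemma step_sum w (h : word w -> R) x :
  (h (window w x))%:E = (\sum_(v : word w) (h v)%:E * (\1_(word_set v) x)%:E)%E.
Proof.
rewrite (bigD1 (window w x)) //= big1 ?adde0.
  by rewrite indicE mem_set // mule1.
move=> v vx; rewrite indicE memNset ?mule0 // /word_set /= => e.
by rewrite e eqxx in vx.
Qed.

Lemma integrable_word w (v : word w) (c : R) :
  mu.-integrable setT (fun x => c%:E * (\1_(word_set v) x)%:E)%E.
Proof.
exact: integrableZl.
Qed.

(** A function of the window is a finite combination of indicators. *)
Lemma integral_step w (h : word w -> R) :
  mu.-integrable setT (fun x => (h (window w x))%:E) /\
  (\int[mu]_x (h (window w x))%:E =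
    (\sum_(v : word w) h v * fine (mu (word_set v)))%:E)%E.
Proof.
rewrite (_ : (fun x => _) = (fun x => \sum_(v : word w) (h v)%:E * (\1_(word_set v) x)%:E)%E); last first.
  by apply/funext => x; exact: step_sum.
split.
  by apply: integrable_sum => // v _; exact: integrable_word.
rewrite integral_sum //; last by move=> v; exact: integrable_word.
rewrite -sumEFin; apply: eq_bigr => v _.
rewrite integralZl //.
by rewrite integral_indic // setIT EFinM fineK // measure_fin_num.
Qed.

Lemma integrable_continuous (f : full_shift -> R) : continuous f ->
  mu.-integrable setT (fun x : borel_shift => (f x)%:E).
Proof.
move=> cf; apply: measurable_bounded_integrable => //.
- by rewrite mu1 ltry.
- exact: measurable_continuous.
have [w hw] := uniformly_windowed cf ltr01.
exists (\sum_(v : word w) `|f (unwindow v)| + 1); split; first exact: num_real.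
move=> M hM x _; apply: ltW; apply: le_lt_trans hM.
have h := hw x (unwindow (window w x)).
have {}h : `|f x - f (unwindow (window w x))| <= 1.
  by apply: h; apply/agree_window; rewrite unwindowK.
have h' : `|f (unwindow (window w x))| <= \sum_(v : word w) `|f (unwindow v)|.
  by rewrite (bigD1 (window w x)) //= lerDl sumr_ge0.
have -> : f x = (f x - f (unwindow (window w x))) + f (unwindow (window w x)) by lra.
by apply: le_trans (ler_normD _ _) _; lra.
Qed.

(** Test functions are replaced by functions of a window, uniformly with respect to the
probability measure. *)
Lemma integral_approx (f : full_shift -> R) w e : continuous f ->
  (forall x y, agree w x y -> `|f x - f y| <= e) ->
  exists2 r : R, (\int[mu]_x (f x)%:E)%E = r%:E &
    `|r - \sum_(v : word w) f (unwindow v) * fine (mu [set x | window w x = v])| <= e.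
Proof.
move=> cf hw; have If := integrable_continuous cf.
have fin : (\int[mu]_x (f x)%:E)%E \is a fin_num by exact: integrable_fin_num.
exists (fine (\int[mu]_x (f x)%:E)); first by rewrite fineK.
have [_ one] := integral_step (fun _ : word w => 1).
rewrite integral_cst // mu1 mule1 in one; case: one => one.
(* f is within e of the function of the window obtained by evaluating at a representative. *)
have hx x : `|f x - f (unwindow (window w x))| <= e.
  by apply: hw; apply/agree_window; rewrite unwindowK.
set s := \sum_v _.
have sumE (c : R) : \sum_(v : word w) (f (unwindow v) + c) * fine (mu (word_set v)) = s + c.
  transitivity (s + c * \sum_(v : word w) 1 * fine (mu (word_set v))); last by rewrite -one mulr1.
  by rewrite mulr_sumr -big_split /=; apply: eq_bigr => v _; rewrite mulrDl mul1r.
have [Iu eu] := integral_step (fun v : word w => f (unwindow v) + e).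
have [Il el] := integral_step (fun v : word w => f (unwindow v) + - e).
have hu : (\int[mu]_x (f x)%:E <= (s + e)%:E)%E.
  rewrite -(sumE e) -eu; apply: le_integral => // x _; rewrite lee_fin.
  by have := hx x; rewrite ler_norml => /andP[]; lra.
have hl : ((s - e)%:E <= \int[mu]_x (f x)%:E)%E.
  rewrite -(sumE (- e)) -el; apply: le_integral => // x _; rewrite lee_fin.
  by have := hx x; rewrite ler_norml => /andP[]; lra.
rewrite -(fineK fin) !lee_fin in hu hl.
by rewrite ler_norml; apply/andP; split; lra.
Qed.

End Integral.

(** * The random point attached to a set of multiples *)

Section Phi.
Variable R : realType.

(** The random analogue of the point eta_A, with the integer translation replaced by a
random profinite one. *)
Definition phi (A : set nat) (u : R) : full_shift :=
  fun n => ~~ `[< exists2 c, A c & (c%:Z %| (res c u)%:Z + n)%Z >].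

(** For a finite part of A only the residue modulo X! matters, and the random point is an
ordinary translate of eta. *)
Lemma phi_below A X u : A `<=` posn ->
  phi (below A X) u = shiftz (res X u)%:Z (eta_seq (below A X)).
Proof.
move=> Ap; apply/funext => n; rewrite /shiftz eta_seqE /phi; congr (~~ _).
have h c : below A X c -> (c%:Z %| (res c u)%:Z + n)%Z = (c %| `|(n + (res X u)%:Z)%R|)%N.
  move=> [Ac cX]; have c0 : (0 < c)%N := Ap _ Ac.
  have cc : (c %| c`!)%N by apply: dvdn_fact; rewrite c0 leqnn.
  by rewrite -(dvdz_modeq n cc (res_coherent u cX)) addrC.
by apply: asbool_equiv_eq; split=> -[c Ac cn]; exists c => //; move: cn; rewrite h.
Qed.

Lemma phi_below_sub A X u n : phi A u n -> phi (below A X) u n.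
Proof. by apply: contra => /asboolP[c [Ac _] cn]; apply/asboolP; exists c. Qed.

Lemma measurable_phi_coord A n : measurable [set u : R | phi A u n].
Proof.
rewrite (_ : [set _ | _] = ~` \bigcup_(c in A) [set u : R | (c%:Z %| (revdigits c (digit c u))%:Z + n)%Z]).
  apply: measurableC; apply: bigcup_measurable => c _.
  exact: (measurable_digit c (fun d => c%:Z %| (revdigits c d)%:Z + n)%Z).
apply/seteqP; split=> u /=.
  by move=> /asboolP h [c Ac /= cn]; apply: h; exists c.
by move=> h; apply/asboolP => -[c Ac cn]; apply: h; exists c.
Qed.

Lemma measurable_phi_determined A w U : determined w U ->
  measurable [set u : R | U (phi A u)].
Proof.
move=> hU.
rewrite (_ : [set _ | _] = \bigcup_(v in [set v : word w | U (unwindow v)])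
   \bigcap_(i in [set: 'I_(2 * w).+1]) [set u : R | phi A u (i%:Z - w%:Z) = v i]).
  apply: fin_bigcup_measurable; first exact: finite_finset.
  move=> v _; apply: fin_bigcap_measurable; first exact: finite_finset.
  move=> i _; case: (v i); first exact: measurable_phi_coord.
  rewrite (_ : [set _ | _] = ~` [set u : R | phi A u (i%:Z - w%:Z)]).
    by apply: measurableC; exact: measurable_phi_coord.
  by apply/seteqP; split=> u /=; [move=> ->|move=> /negP/negbTE].
apply/seteqP; split=> u /=.
  move=> Uu; exists (window w (phi A u)) => /=.
    by apply: hU Uu; apply/agree_window; rewrite unwindowK.
  by move=> i _ /=; rewrite ffunE.
move=> [v /= Uv h]; apply: hU Uv; apply/agree_window; rewrite unwindowK.
by apply/ffunP => i; rewrite ffunE; have /= -> := h i I.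
Qed.

Lemma measurable_phi A :
  measurable_fun [set: measurableTypeR R] (phi A : measurableTypeR R -> borel_shift).
Proof.
apply: (@measurability _ _ (measurableTypeR R) borel_shift setT _ (@open full_shift)) => //.
move=> _ [U oU <-]; rewrite setTI (open_bigcup_determined oU) preimage_bigcup.
apply: bigcupT_measurable => w.
apply: (@measurable_phi_determined A w); exact: determined_interior.
Qed.

Definition phi_rv A : {mfun measurableTypeR R >-> borel_shift} :=
  mfun_Sub (mem_set (measurable_phi A)).

(** The law of the random point; it is the Mirsky measure by [nu_is_mirsky]. *)
Definition nu A : probability borel_shift R := distribution (unif01 R) (phi_rv A).

Lemma nuE A U : nu A U = unif01 R [set u | U (phi A u)].
Proof. by []. Qed.

Lemma eta_below_shift A X n k : A `<=` posn ->
  eta_seq (below A X) (n + (k * X`!)%N%:Z) = eta_seq (below A X) n.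
Proof.
move=> Ap; rewrite !eta_seqE; congr (~~ _).
have h a : below A X a -> (a %| `|(n + (k * X`!)%N%:Z)%R|)%N = (a %| `|n|)%N.
  move=> [Aa aX]; have a0 : (0 < a)%N := Ap _ Aa.
  have aX' : (a %| X`!)%N by apply: dvdn_fact; rewrite a0.
  have H : (a%:Z %| (k * X`!)%N%:Z)%Z by exact: dvdn_mull.
  by rewrite -[LHS]/(a%:Z %| n + (k * X`!)%N%:Z)%Z (rpredDr n H).
by apply/multP/multP => -[a Aa an]; exists a => //; rewrite h in an * => //; rewrite h.
Qed.

Definition pattern (x : full_shift) (U : set full_shift) (m : nat) : bool :=
  `[< U (shiftz m%:Z x) >].

Lemma has_period_pattern A X U : A `<=` posn ->
  has_period X`! (pattern (eta_seq (below A X)) U).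
Proof.
move=> Ap; split=> [|m]; first exact: fact_gt0.
rewrite /pattern; congr (`[< U _ >]); apply/funext => n; rewrite /shiftz.
by rewrite PoszD addrA -[X`!]mul1n eta_below_shift.
Qed.

Lemma unif01_phi_below A X U : A `<=` posn ->
  unif01 R [set u | U (phi (below A X) u)] = (dens R (pattern (eta_seq (below A X)) U))%:E.
Proof.
move=> Ap.
rewrite (_ : [set _ | _] = [set u | pattern (eta_seq (below A X)) U (res X u)]).
  rewrite unif01_res /dens (meanE (q := X`!)) //.
  have := has_period_pattern X U Ap; move=> [q0 h].
  by split=> // n; rewrite h.
by apply/seteqP; split=> u /=; rewrite phi_below // => /asboolP.
Qed.

Lemma unif01_phi_below_coord A X n : A `<=` posn ->
  unif01 R [set u | ~~ phi (below A X) u n] = (dens R (mult (below A X)))%:E.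
Proof.
move=> Ap; rewrite (@unif01_phi_below A X (fun x => ~~ x n) Ap); congr (_%:E).
(* A nonnegative representative of n modulo X!. *)
pose h := `|(n + (`|n| * X`!)%N%:Z)%R|%N.
have hE : h%:Z = n + (`|n| * X`!)%N%:Z.
  rewrite /h gez0_abs //.
  have : `|n|%N%:Z <= (`|n| * X`!)%N%:Z by rewrite lez_nat leq_pmulr // fact_gt0.
  by move: (_ * _)%N => k; lia.
have pp : has_period X`! (fun m => (mult (below A X) m)%:R : R).
  have [q0 hq] := has_period_mult_below X Ap.
  by split=> // m; rewrite hq.
rewrite /dens -(mean_affine h pp (coprime1n _)); congr mean; apply/funext => m.
congr (_%:R); congr nat_of_bool; rewrite /pattern asboolb /shiftz.
rewrite mul1n -(@eta_below_shift A X _ `|n| Ap) addrAC -hE eta_seqE negbK.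
by rewrite -PoszD absz_nat.
Qed.

(** The probability that n is excluded by A but not by its elements up to X. The events
excluding n increase to their union as X grows, with probabilities at most delta A. *)
Lemma unif01_bad A X n : A `<=` posn ->
  (unif01 R [set u | ~~ phi A u n && phi (below A X) u n] <=
   (delta R A - dens R (mult (below A X)))%:E)%E.
Proof.
move=> Ap.
pose F Y := [set u : R | ~~ phi (below A Y) u n].
have mN B : measurable [set u : R | ~~ phi B u n].
  rewrite (_ : [set _ | _] = ~` [set u : R | phi B u n]).
    by apply: measurableC; exact: measurable_phi_coord.
  by apply/seteqP; split=> u /= /negP.
have FE : [set u : R | ~~ phi A u n] = \bigcup_Y F Y.
  apply/seteqP; split=> u /=.
    rewrite negbK => /asboolP[c Ac cn]; exists c => //=.
    by rewrite /F /= negbK; apply/asboolP; exists c.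
  by move=> [Y _]; apply: contra; exact: phi_below_sub.
have ndF : nondecreasing_seq F.
  move=> Y Z YZ; apply/subsetPset => u; rewrite /F /= !negbK => /asboolP[c [Ac cY] cn].
  by apply/asboolP; exists c => //; split=> //; exact: leq_trans YZ.
have lim : (unif01 R [set u : R | ~~ phi A u n] <= (delta R A)%:E)%E.
  rewrite FE; have mF : measurable (\bigcup_Y F Y) by rewrite -FE; exact: mN.
  have h := @nondecreasing_cvg_mu _ _ _ (unif01 R) F (fun Y => mN (below A Y)) mF ndF.
  rewrite -(cvg_lim _ h) //; apply: lime_le; first by apply/cvg_ex; eexists; exact: h.
  by apply: nearW => Y /=; rewrite unif01_phi_below_coord // lee_fin dens_le_delta.
set S := [set u | _ && _].
have mS : measurable S.
  rewrite (_ : S = [set u : R | ~~ phi A u n] `&` [set u : R | phi (below A X) u n]).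
    by apply: measurableI; [exact: mN|exact: measurable_phi_coord].
  by apply/seteqP; split=> u /= => [/andP|[nA pX]] //; apply/andP.
have SE : [set u : R | ~~ phi A u n] = S `|` F X.
  apply/seteqP; split=> u /=.
    move=> nA; have [p|p] := boolP (phi (below A X) u n); last by right.
    by left; apply/andP.
  by move=> [/andP[]//|]; apply: contra; exact: phi_below_sub.
have : unif01 R [set u : R | ~~ phi A u n] = (unif01 R S + unif01 R (F X))%E.
  rewrite SE measureU //; first exact: mN.
  apply/seteqP; split=> // u /= []; rewrite /S /F /= => /andP[_ ->] //.
move=> e; move: lim; rewrite e unif01_phi_below_coord // EFinB => h.
by rewrite leeBrDr.
Qed.

Lemma determined_differ w U x y : determined w U -> U x -> ~ U y ->
  exists j : 'I_(2 * w).+1, x (j%:Z - w%:Z) != y (j%:Z - w%:Z).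
Proof.
move=> hU Ux nUy; apply: contrapT => h; apply: nUy; apply: hU Ux.
apply/agree_window/ffunP => j; rewrite !ffunE; apply/eqP/negP => /negP e.
by apply: h; exists j.
Qed.

(** Replacing A by a finite part changes the random window with small probability, and for
the finite part the probability is the density of a periodic set of translations. *)
Lemma nu_approx A X w U : A `<=` posn -> determined w U ->
  `|fine (nu A U) - dens R (pattern (eta_seq (below A X)) U)| <=
  (2 * w).+1%:R * (delta R A - dens R (mult (below A X))).
Proof.
move=> Ap hU; set e := delta R A - _.
pose bad (j : nat) := [set u : R | ~~ phi A u (j%:Z - w%:Z) && phi (below A X) u (j%:Z - w%:Z)].
have mbad j : measurable (bad j).
  rewrite (_ : bad j = ~` [set u : R | phi A u (j%:Z - w%:Z)] `&` [set u : R | phi (below A X) u (j%:Z - w%:Z)]).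
    apply: measurableI; last exact: measurable_phi_coord.
    by apply: measurableC; exact: measurable_phi_coord.
  by apply/seteqP; split=> u /= => [/andP[/negP ? ?]|[/negP ? ?]] //; apply/andP.
pose D := \big[setU/set0]_(j < (2 * w).+1) bad j.
have mD : measurable D by apply: bigsetU_measurable.
have PD : (unif01 R D <= ((2 * w).+1%:R * e)%:E)%E.
  have B := @Boole_inequality _ _ _ (unif01 R) bad (2 * w).+1 (fun j _ => mbad j).
  apply: (le_trans B).
  apply: (@le_trans _ _ (\sum_(j < (2 * w).+1) e%:E)%E).
    by apply: lee_sum => j _; exact: unif01_bad.
  by rewrite sumEFin sumr_const card_ord mulr_natl.
pose S1 := [set u : R | U (phi A u)]; pose S2 := [set u : R | U (phi (below A X) u)].
have mS1 : measurable S1 by exact: measurable_phi_determined hU.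
have mS2 : measurable S2 by exact: measurable_phi_determined hU.
have inD u j : (j < (2 * w).+1)%N ->
   phi A u (j%:Z - w%:Z) != phi (below A X) u (j%:Z - w%:Z) -> D u.
  move=> jw h; rewrite /D -bigcup_mkord; exists j => //=.
  move: h (@phi_below_sub A X u (j%:Z - w%:Z)); rewrite /bad /=.
  by case: (phi A u _); case: (phi (below A X) u _) => //= _ /(_ isT).
have s12 : S1 `<=` S2 `|` D.
  move=> u S1u; have [S2u|nS2u] := pselect (S2 u); [by left|right].
  have [j hj] := determined_differ hU S1u nS2u; exact: inD hj.
have s21 : S2 `<=` S1 `|` D.
  move=> u S2u; have [S1u|nS1u] := pselect (S1 u); [by left|right].
  by have [j hj] := determined_differ hU S2u nS1u; apply: (inD _ j) => //; rewrite eq_sym.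
have le S S' : measurable S -> measurable S' -> S `<=` S' `|` D ->
    (unif01 R S <= unif01 R S' + unif01 R D)%E.
  move=> mS mS' ss; apply: (@le_trans _ _ (unif01 R (S' `|` D))).
    by apply: le_measure; rewrite ?inE //; exact: measurableU.
  exact: measureU2.
have h1 := le _ _ mS1 mS2 s12; have h2 := le _ _ mS2 mS1 s21.
rewrite nuE -/S1.
have e2 : unif01 R S2 = (dens R (pattern (eta_seq (below A X)) U))%:E by exact: unif01_phi_below.
rewrite e2 in h1 h2.
have f1 : unif01 R S1 \is a fin_num by apply: fin_num_measure.
have fD : unif01 R D \is a fin_num by apply: fin_num_measure.
move: h1 h2 PD; rewrite -(fineK f1) -(fineK fD) -!EFinD !lee_fin => h1 h2 PD.
by rewrite ler_norml /=; apply/andP; split; lra.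
Qed.

End Phi.

(** * Existence of the Mirsky measure *)

Section Mirsky.
Variable R : realType.

(** Translating backwards by k moves at most k integers out of the positive ones. *)
Lemma freq_dist (T : pred nat) k N : freq R (fun m => T (dist m k)) N <= freq R T N + k%:R.
Proof.
have h1 n : freq R (fun m => (k < m)%N && T (m - k)%N) n = freq R T (n - k)%N.
  elim: n => [|n IH]; first by rewrite sub0n /freq !big_geq.
  rewrite freqS IH ltnS; case: (leqP k n) => kn.
    by rewrite subSn // freqS.
  by rewrite addr0; congr freq; lia.
have h2 n : freq R (fun m => (m <= k)%N) n <= k%:R.
  elim: n => [|n IH]; first by rewrite /freq big_geq.
  case: (leqP n.+1 k) => nk; last by rewrite freqS leqNgt nk addr0.
  by apply: le_trans (freq_le _ _ _) _; rewrite ler_nat.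
apply: (@le_trans _ _ (freq R (fun m => (k < m)%N && T (m - k)%N) N + freq R (fun m => (m <= k)%N) N)).
  rewrite /freq -big_split /=; apply: ler_sum => m _; rewrite -natrD ler_nat /dist.
  case: (leqP m k) => mk /=; first by case: (T _).
  by rewrite (_ : k - m = 0)%N ?addn0 //; lia.
apply: lerD => //; rewrite h1 /freq.
by rewrite [leRHS](@big_cat_nat _ _ _ (N - k).+1) //= ?lerDl ?sumr_ge0 // ltnS leq_subr.
Qed.

Lemma freq_dist_window (T : pred nat) w j N : (j < (2 * w).+1)%N ->
  freq R (fun m => T (dist (m + j) w)) N <= freq R T N + w%:R.
Proof.
move=> jw; have [wj|wj] := leqP w j.
  rewrite (_ : (fun m => _) = (fun m => T (m + (j - w))%N)).
    by apply: le_trans (freq_shift _ _ _ _) _; rewrite lerD2l ler_nat; lia.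
  by apply/funext => m; congr T; rewrite /dist; lia.
rewrite (_ : (fun m => _) = (fun m => T (dist m (w - j)))).
  by apply: le_trans (freq_dist _ _ _) _; rewrite lerD2l ler_nat; lia.
by apply/funext => m; congr T; rewrite /dist; lia.
Qed.

(** The counterpart of [nu_approx] for orbits. *)
Lemma freq_pattern_approx A X w U N : determined w U ->
  `|freq R (pattern (eta_seq A) U) N - freq R (pattern (eta_seq (below A X)) U) N| <=
  (2 * w).+1%:R * (freq R (tail A X) N + w%:R).
Proof.
move=> hU; set x := eta_seq A; set y := eta_seq (below A X).
pose E := \sum_(j < (2 * w).+1) freq R (fun m => tail A X (dist (m + j) w)) N.
have hE : E <= (2 * w).+1%:R * (freq R (tail A X) N + w%:R).
  apply: (@le_trans _ _ (\sum_(j < (2 * w).+1) (freq R (tail A X) N + w%:R))).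
    by apply: ler_sum => j _; exact: freq_dist_window.
  by rewrite sumr_const card_ord mulr_natl.
have key a b : (a = x /\ b = y) \/ (a = y /\ b = x) ->
    freq R (pattern a U) N <= freq R (pattern b U) N + E.
  move=> ab; rewrite /E /freq exchange_big -big_split /=; apply: ler_sum => m _.
  rewrite -natr_sum -natrD ler_nat.
  case: (boolP (pattern a U m)) => // /asboolP Ua.
  case: (boolP (pattern b U m)) => // /asboolP nUb.
  have [j] := determined_differ hU Ua nUb.
  have hj : x (j%:Z - w%:Z + m%:Z) != y (j%:Z - w%:Z + m%:Z) -> tail A X (dist (m + j) w).
    rewrite /x /y !eta_seqE.
    have -> : `|(j%:Z - w%:Z + m%:Z)%R|%N = dist (m + j) w by rewrite /dist; lia.
    rewrite /tail; have := @sub_mult _ _ (dist (m + j) w) (@below_sub_id A X).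
    by case: (mult A _); case: (mult (below A X) _) => //= /(_ isT).
  move=> h; have {hj}h : tail A X (dist (m + j) w).
    by apply: hj; move: h; rewrite /shiftz; case: ab => -[-> ->] //; rewrite eq_sym.
  by rewrite (bigD1 j) //= h.
have k1 := key x y (or_introl (conj erefl erefl)).
have k2 := key y x (or_intror (conj erefl erefl)).
by rewrite ler_norml; apply/andP; split; lra.
Qed.

(** Both sides are close to the density of the translations at which a finite part of A shows
the pattern. *)
Lemma freq_pattern_cvg A w U l : A `<=` posn -> realizing R A l -> determined w U ->
  (l i)%:R^-1 * freq R (pattern (eta_seq A) U) (l i) @[i --> \oo] --> fine (nu R A U).
Proof.
move=> Ap hl hU; apply/cvgrPdist_le => e e0.
set W : R := (2 * w).+1%:R.
have W0 : 0 < W by rewrite ltr0n.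
have e4 : 0 < e / 4 by lra.
have e4W : 0 < e / 4 / W by rewrite divr_gt0.
have [X0 hX0] := realizing_tail Ap hl e4W.
have [X1 hX1] := delta_approx Ap e4W.
pose X := maxn X0 X1.
have {}hX0 := hX0 X (leq_maxl _ _).
have {}hX1 : delta R A - e / 4 / W < dens R (mult (below A X)).
  apply: (lt_le_trans hX1); apply: le_dens; [exact: periodic_mult_below..|].
  by move=> n; apply: sub_mult; apply: below_sub; exact: leq_maxr.
have pX : periodic (pattern (eta_seq (below A X)) U).
  by exists X`!; exact: has_period_pattern.
have l_oo := hl.1.
have l1 := near_seq l_oo (freq_near pX e4).
have l2 := near_seq l_oo (nbhs_infty_ger (W * w%:R / (e / 4))).
have l3 := near_seq l_oo (nbhs_infty_gt 0).
have n1 := @nu_approx R A X w U Ap hU.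
set d := dens R (pattern _ U) in n1 *.
have n1' : `|fine (nu R A U) - d| <= e / 4.
  apply: (le_trans n1); rewrite -/W mulrC -ler_pdivlMr //.
  by move: hX1; set t := e / 4 / W; lra.
near=> i.
have L0 : 0 < (l i)%:R :> R by rewrite ltr0n; near: i.
have : (d - e / 4) * (l i)%:R <= freq R (pattern (eta_seq (below A X)) U) (l i)
    <= (d + e / 4) * (l i)%:R by near: i.
move=> /andP[h1 h2].
have h3 : freq R (tail A X) (l i) <= e / 4 / W * (l i)%:R by near: i.
have h4 : W * w%:R <= (l i)%:R * (e / 4) by rewrite -ler_pdivrMr //; near: i.
have h5 := @freq_pattern_approx A X w U (l i) hU.
set L := (l i)%:R in L0 h1 h2 h3 h4 *.
set F := freq R (pattern (eta_seq A) U) (l i) in h5 *.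
set G := freq R (pattern _ U) (l i) in h1 h2 h5.
have h6 : `|F - G| <= e / 2 * L.
  apply: (le_trans h5); rewrite -/W mulrDr.
  have : W * freq R (tail A X) (l i) <= e / 4 * L.
    by rewrite mulrC -ler_pdivlMr // mulrAC.
  lra.
move: h6 n1'; rewrite !ler_norml => /andP[a1 a2] /andP[b1 b2].
have c1 : L^-1 * F <= d + e / 4 + e / 2 by rewrite mulrC ler_pdivrMr //; lra.
have c2 : d - e / 4 - e / 2 <= L^-1 * F by rewrite [leRHS]mulrC ler_pdivlMr //; lra.
by apply/andP; split; lra.
Unshelve. all: by end_near. Qed.

Lemma empiricalE x n (U : set borel_shift) : empirical R x n U =
  (n%:R^-1 * freq R (pattern x U) n)%:E.
Proof.
rewrite /empirical /= /mscale /= /msum /= EFinM; congr (_ * _)%E.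
rewrite /freq big_add1 /= big_mkord -sumEFin; apply: eq_bigr => k _.
by rewrite diracE; congr (_%:R%:E).
Qed.

Lemma empirical_setT x n : (0 < n)%N -> empirical R x n setT = 1%E.
Proof.
move=> n0; rewrite empiricalE /freq (eq_bigr (fun=> 1)); last by move=> m _; rewrite /pattern asboolT.
by rewrite sumr_const_nat subSS subn0 mulVf // pnatr_eq0 -lt0n.
Qed.

(** Windows take finitely many values, so convergence of their probabilities gives
convergence of the integrals of the window functions approximating a test function. *)
Lemma weakly_converges_of_windows (mu_ : nat -> {measure set borel_shift -> \bar R})
    (mu : {measure set borel_shift -> \bar R}) :
  (\forall i \near \oo, mu_ i setT = 1%E) -> mu setT = 1%E ->
  (forall w (v : word w),
     fine (mu_ i [set x | window w x = v]) @[i --> \oo] --> fine (mu [set x | window w x = v])) ->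
  weakly_converges mu_ mu.
Proof.
move=> h_ h hw f cf.
have fin : (\int[mu]_x (f x)%:E)%E \is a fin_num.
  by apply: integrable_fin_num => //; exact: integrable_continuous.
rewrite -(fineK fin); apply/fine_cvgP; split.
  near=> i; apply: integrable_fin_num => //; apply: integrable_continuous => //.
  by near: i.
apply/cvgrPdist_le => e e0; have e3 : 0 < e / 3 by lra.
have [w hf] := uniformly_windowed cf e3.
pose s_ (m : {measure set borel_shift -> \bar R}) :=
  \sum_(v : word w) f (unwindow v) * fine (m [set x | window w x = v]).
have cs : s_ (mu_ i) @[i --> \oo] --> s_ mu.
  apply: cvg_big => [|v _]; first exact: add_continuous.
  apply: cvgMl_tmp.
  exact: hw.
have [r er hr] := integral_approx h cf hf.
have /cvgrPdist_le/(_ _ e3) cs3 := cs.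
near=> i.
have hi : mu_ i setT = 1%E by near: i.
have [r' er' hr'] := integral_approx hi cf hf.
rewrite /= er er' /=.
have : `|s_ mu - s_ (mu_ i)| <= e / 3 by near: i.
move: hr hr'; rewrite -!/(s_ _) !ler_norml.
by move=> /andP[? ?] /andP[? ?] /andP[? ?]; apply/andP; split; lra.
Unshelve. all: by end_near. Qed.

Lemma nu_is_mirsky A : A `<=` posn -> is_mirsky A (nu R A).
Proof.
move=> Ap l l_oo hl.
have rl : realizing R A l by split.
have l0 := near_seq l_oo (nbhs_infty_gt 0).
apply: weakly_converges_of_windows.
- by near=> i; apply: empirical_setT; near: i.
- exact: probability_setT.
- move=> w v.
  have hU : determined w [set x | window w x = v].
    by move=> x y /agree_window /= ->.
  under eq_fun do rewrite empiricalE /=.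
  exact: freq_pattern_cvg hU.
Unshelve. all: by end_near. Qed.

Lemma mirskyP A : A `<=` posn -> is_mirsky A (mirsky R A).
Proof. by move=> Ap; apply: (@getPex _ (is_mirsky A)); exists (nu R A); exact: nu_is_mirsky. Qed.

End Mirsky.

(** * Support and invariance of the Mirsky measure *)

Section MirskyFacts.
Variable R : realType.

Lemma continuous_determined w U : determined w U ->
  continuous (\1_U : full_shift -> R).
Proof.
move=> hU x; apply/cvgrPdist_le => e e0; apply/nbhs_agree; exists w => y xy.
rewrite (_ : \1_U x = \1_U y :> R) ?subrr ?normr0 ?ltW //.
rewrite !indicE; congr (_%:R); congr nat_of_bool.
apply/idP/idP; rewrite !inE; first exact: hU.
by apply: hU; exact: agree_sym.
Qed.

(** The indicator of a set determined by a window is an admissible test function. *)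
Lemma mirsky_cvg A w U l : A `<=` posn -> realizing R A l -> determined w U ->
  (l i)%:R^-1 * freq R (pattern (eta_seq A) U) (l i) @[i --> \oo] -->
  fine (mirsky R A U).
Proof.
move=> Ap [l_oo hl] hU; have mU := measurable_determined hU.
have := mirskyP Ap l_oo hl (continuous_determined hU).
rewrite integral_indic // setIT => h.
have fin : mirsky R A U \is a fin_num by exact: fin_num_measure.
have {}h : (\int[empirical R (eta_seq A) (l i)]_x (\1_U x)%:E)%E @[i --> \oo] -->
    (fine (mirsky R A U))%:E by rewrite fineK.
have /fine_cvgP[_] := h; apply: cvg_trans; apply: near_eq_cvg; apply: nearW => i /=.
by rewrite integral_indic // setIT empiricalE.
Qed.

Lemma mirsky_null A w U : A `<=` posn -> determined w U ->
  (forall k, ~ U (shiftz k (eta_seq A))) -> mirsky R A U = 0%E.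
Proof.
move=> Ap hU nU; have [l hl] := exists_realizing R Ap.
have := mirsky_cvg Ap hl hU.
have -> : (fun i => (l i)%:R^-1 * freq R (pattern (eta_seq A) U) (l i)) = fun=> 0.
  apply/funext => i; rewrite /freq big1 ?mulr0 // => m _.
  by rewrite /pattern asboolF.
move=> /(cvg_unique _ (cvg_cst 0)) => e.
have fin : mirsky R A U \is a fin_num by apply: fin_num_measure; exact: measurable_determined hU.
by rewrite -(fineK fin) -e.
Qed.

Lemma measurable_orbit_closure x : measurable (orbit_closure x : set borel_shift).
Proof.
rewrite -[orbit_closure x]setCK; apply: measurableC; apply: measurable_open.
by apply: closed_openC; exact: closed_closure.
Qed.

(** The complement of the orbit closure is an increasing union of sets determined by windows,
and the orbit never visits them. *)
Lemma mirsky_orbit_closure A : A `<=` posn ->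
  mirsky R A (orbit_closure (eta_seq A)) = 1%E.
Proof.
move=> Ap; set X := orbit_closure _.
have mX : measurable (X : set borel_shift) by exact: measurable_orbit_closure.
suff h : mirsky R A (~` X) = 0%E.
  by rewrite -[X]setCK probability_setC ?h ?sube0 //; exact: measurableC.
have oX : open (~` X) by apply: closed_openC; exact: closed_closure.
pose F w : set borel_shift := [set x | cyl w x `<=` ~` X].
have FE : ~` X = \bigcup_w F w by exact: open_bigcup_determined.
have dF w : determined w (F w) by exact: determined_interior.
have mF w : measurable (F w) by exact: measurable_determined (dF w).
have ndF : nondecreasing_seq F.
  move=> v w vw; apply/subsetPset => x /= h y xy; apply: h; exact: agree_le xy.
have mUF : measurable (\bigcup_w F w) by rewrite -FE; exact: measurableC.
have := @nondecreasing_cvg_mu _ _ _ (mirsky R A) F mF mUF ndF.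
rewrite -FE; have -> : mirsky R A \o F = fun=> 0%E.
  apply/funext => w /=; apply: (mirsky_null Ap (dF w)) => k Fk.
  apply: (Fk (shiftz k (eta_seq A))); first by move=> n _.
  by apply/orbit_closureP => v; exists k.
by move=> /(cvg_unique _ (cvg_cst 0%E)) <-.
Qed.

Lemma determined_shift w U : determined w U -> determined w.+1 (shiftz 1 @^-1` U).
Proof. by move=> hU x y xy; apply: hU => n nw; apply: xy; lia. Qed.

Lemma measurable_shift :
  measurable_fun [set: borel_shift] (shiftz 1 : borel_shift -> borel_shift).
Proof.
apply: (@measurability _ _ borel_shift borel_shift setT _ (@open full_shift)) => //.
move=> _ [U oU <-]; rewrite setTI (open_bigcup_determined oU) preimage_bigcup.
apply: bigcupT_measurable => w.
apply: (@measurable_determined w.+1); apply: determined_shift; exact: determined_interior.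
Qed.

Definition shift_mfun : {mfun borel_shift >-> borel_shift} :=
  mfun_Sub (mem_set measurable_shift).

(** The frequencies of the visits at times m and m + 1 differ by at most one visit. *)
Lemma mirsky_shift_determined A w U : A `<=` posn -> determined w U ->
  mirsky R A (shiftz 1 @^-1` U) = mirsky R A U.
Proof.
move=> Ap hU; have [l hl] := exists_realizing R Ap.
have hU' := determined_shift hU.
have fin V v : determined v V -> mirsky R A V \is a fin_num.
  by move=> hV; apply: fin_num_measure; exact: measurable_determined hV.
rewrite -(fineK (fin _ _ hU)) -(fineK (fin _ _ hU')); congr (_%:E).
have c1 := mirsky_cvg Ap hl hU; have c2 := mirsky_cvg Ap hl hU'.
have c := cvgB c2 c1.
pose D (i : nat) : R := (l i)%:R^-1 * freq R (pattern (eta_seq A) (shiftz 1 @^-1` U)) (l i) -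
  (l i)%:R^-1 * freq R (pattern (eta_seq A) U) (l i).
have {}c : D i @[i --> \oo] --> fine (mirsky R A (shiftz 1 @^-1` U)) - fine (mirsky R A U) by exact: c.
suff c0 : D i @[i --> \oo] --> (0 : R).
  by apply/eqP; rewrite -subr_eq0; apply/eqP; exact: (cvg_unique _ c c0).
apply/cvgrPdist_le => e e0.
have l0 := near_seq hl.1 (nbhs_infty_gt 0).
have l1 := near_seq hl.1 (nbhs_infty_ger e^-1).
near=> i; rewrite /D sub0r normrN /= -mulrBr.
have L0 : 0 < (l i)%:R :> R by rewrite ltr0n; near: i.
have L1 : 1 <= e * (l i)%:R.
  by rewrite mulrC -ler_pdivrMr // div1r; near: i.
rewrite normrM gtr0_norm ?invr_gt0 // mulrC ler_pdivrMr //.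
apply: le_trans L1; set P := pattern (eta_seq A) U.
have -> : pattern (eta_seq A) (shiftz 1 @^-1` U) = fun m => P m.+1.
  apply/funext => m; rewrite /P /pattern; congr (`[< U _ >]).
  by apply/funext => n; rewrite /shiftz; congr (eta_seq A _); lia.
have e1 : freq R (fun m => P m.+1) (l i) + (P 1%N)%:R = freq R P (l i) + (P (l i).+1)%:R.
  by rewrite -freqS /freq [RHS]big_nat_recl // addrC big_add1.
have -> : freq R (fun m => P m.+1) (l i) - freq R P (l i) = (P (l i).+1)%:R - (P 1%N)%:R.
  by rewrite -[LHS](addrK ((P 1%N)%:R)); lra.
by case: (P _); case: (P _); rewrite ?subrr ?normr0 ?subr0 ?sub0r ?normrN ?normr1.
Unshelve. all: by end_near. Qed.

(** The sets determined by windows are stable under intersection and generate the Borel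
sets. *)
Lemma mirsky_invariant A : A `<=` posn -> forall U : set borel_shift, measurable U ->
  mirsky R A (shiftz 1 @^-1` U) = mirsky R A U.
Proof.
move=> Ap U mU.
pose m2 : probability borel_shift R := distribution (mirsky R A) shift_mfun.
rewrite -[LHS]/(m2 U).
apply: (@g_sigma_algebra_measure_unique _ R borel_shift determined_sets _ (fun=> setT)).
- by move=> V [w hV]; exact: measurable_determined hV.
- by move=> _; exists 0%N => x y.
- by rewrite bigcup_const //; exists 0%N.
- move=> V V' [w hV] [w' hV']; exists (maxn w w') => x y xy [Vx V'x]; split.
    by apply: hV Vx; apply: agree_le xy; exact: leq_maxl.
  by apply: hV' V'x; apply: agree_le xy; exact: leq_maxr.
- by move=> V [w hV]; exact: mirsky_shift_determined hV.
- by move=> _; rewrite -ge0_fin_numE //; exact: fin_num_measure.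
- move: U mU; apply: smallest_sub; first exact: smallest_sigma_algebra.
  exact: open_sub_gen_determined.
Qed.

Lemma mirsky_invariant_measure A : A `<=` posn ->
  invariant_measures (orbit_closure (eta_seq A)) (mirsky R A).
Proof. by move=> Ap; split; [exact: mirsky_orbit_closure|exact: mirsky_invariant]. Qed.

Lemma invariant_measures_sub x y : orbit_closure x `<=` orbit_closure y ->
  @invariant_measures R (orbit_closure x) `<=` @invariant_measures R (orbit_closure y).
Proof.
move=> xy mu [mu1 inv]; split=> //; apply/eqP; rewrite eq_le probability_le1 /=; last exact: measurable_orbit_closure.
by rewrite -mu1; apply: le_measure; rewrite ?inE //; exact: measurable_orbit_closure.
Qed.

(** [window_freq] with B = B1 = C, every c being approachable through d = c and a = 1. *)
Lemma mirsky_cyl_gt0 C w : C `<=` posn -> taut R C ->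
  (0 < mirsky R C (cyl w (eta_seq C)))%E.
Proof.
move=> Cp tC; have [l hl] := exists_realizing R Cp.
have hU := @determined_cyl w (eta_seq C).
have hC c : C c -> approachable C c.
  by move=> Cc J _; exists c, 1%N; rewrite muln1 coprime1n.
have [x x0 hx] := window_freq w Cp Cp tC hl (fun n h => h) (fun n h => h) hC.
set P := fun n => all _ _ in hx.
have fin : mirsky R C (cyl w (eta_seq C)) \is a fin_num.
  by apply: fin_num_measure; exact: measurable_determined hU.
rewrite -(fineK fin) lte_fin.
have x2 : 0 < x / 2 by lra.
apply: (lt_le_trans x2).
have c := mirsky_cvg Cp hl hU; rewrite -(cvg_lim _ c) //.
apply: limr_ge; first by apply/cvg_ex; eexists; exact: c.
have l0 := near_seq hl.1 (nbhs_infty_gt 0).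
have l1 := near_seq hl.1 (nbhs_infty_ger (w%:R / (x / 2))).
near=> i.
have L0 : 0 < (l i)%:R :> R by rewrite ltr0n; near: i.
have L1 : w%:R <= (l i)%:R * (x / 2) by rewrite -ler_pdivrMr //; near: i.
have h1 : x * (l i)%:R <= freq R P (l i) by near: i.
rewrite [leRHS]mulrC ler_pdivlMr //.
have h2 := @freq_shift R (pattern (eta_seq C) (cyl w (eta_seq C))) w (l i).
have h3 : freq R P (l i) <= freq R (fun n => pattern (eta_seq C) (cyl w (eta_seq C)) (n + w)%N) (l i).
  apply: le_freq => n _ /allP Pn; apply/asboolP => m mw.
  rewrite /shiftz !eta_seqE; congr (~~ _).
  have := Pn (`|(m + w%:Z)%R|%N); rewrite mem_iota add0n => /(_ _)/eqP.
  have -> : dist `|(m + w%:Z)%R|%N w = `|m|%N by rewrite /dist; lia.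
  have -> : (n + `|(m + w%:Z)%R| = `|(m + (n + w)%N%:Z)%R|)%N by lia.
  by move=> ->; lia.
lra.
Unshelve. all: by end_near. Qed.

(** A closed set of full measure meets every set of positive measure. *)
Lemma invariant_mirsky_orbit C y : C `<=` posn -> taut R C ->
  invariant_measures (orbit_closure y) (mirsky R C) ->
  orbit_closure y (eta_seq C).
Proof.
move=> Cp tC [m1 _]; apply/orbit_closureP => w.
have mX := measurable_orbit_closure y.
have mU : measurable (cyl w (eta_seq C) : set borel_shift).
  exact: measurable_determined (@determined_cyl _ _).
have [z [zX zU]] : orbit_closure y `&` cyl w (eta_seq C) !=set0.
  apply/set0P/eqP => XU.
  have : (mirsky R C (cyl w (eta_seq C)) <= mirsky R C (~` orbit_closure y))%E.
    apply: le_measure; rewrite ?inE //; first exact: measurableC.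
    by move=> z zU zX; have : (orbit_closure y `&` cyl w (eta_seq C)) z by []; rewrite XU.
  rewrite probability_setC // m1 subee // leNgt => /negP; apply.
  exact: mirsky_cyl_gt0.
have [k hk] := (orbit_closureP y z).1 zX w.
by exists k; apply: agree_trans hk _; exact: agree_sym.
Qed.

End MirskyFacts.

(** * The equivalences *)

Lemma mirsky_orbit_equivalences (R : realType) (C : set nat) (y : full_shift) :
  C `<=` posn -> taut R C ->
  [/\ orbit_closure (eta_seq C) `<=` orbit_closure y -> orbit_closure y (eta_seq C),
      orbit_closure y (eta_seq C) -> orbit_closure (eta_seq C) `<=` orbit_closure y,
      orbit_closure y (eta_seq C) -> invariant_measures (orbit_closure y) (mirsky R C),
      invariant_measures (orbit_closure y) (mirsky R C) ->
        @invariant_measures R (orbit_closure (eta_seq C)) `<=`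
        @invariant_measures R (orbit_closure y)
    & @invariant_measures R (orbit_closure (eta_seq C)) `<=`
        @invariant_measures R (orbit_closure y) -> orbit_closure y (eta_seq C)].
Proof.
move=> Cp tC; have m := mirsky_invariant_measure R Cp; split.
- by apply; exact: orbit_closure_self.
- exact: orbit_closure_trans.
- by move=> /orbit_closure_trans/(@invariant_measures_sub R); apply.
- by move=> /(invariant_mirsky_orbit Cp tC)/orbit_closure_trans; exact: invariant_measures_sub.
- by move=> /(_ _ m); exact: invariant_mirsky_orbit.
Qed.

Theorem propositionD (R : realType) (B C : set nat)
    (hB : B `<=` posn) (hC : C `<=` posn) (tautC : taut R C) :
  [<-> (* (a) *)
       (forall b : nat, B b -> exists2 c : nat, C c & (c %| b)%N) /\
       (forall c : nat, C c -> exists2 b : nat, Bstar B b & (b %| c)%N);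
       (* (b) *)
       le_coord (eta_seq (Bstar B)) (eta_seq C) /\ le_coord (eta_seq C) (eta_seq B);
       (* (c) *)
       orbit_closure (eta_seq C) `<=` orbit_closure (eta_seq B);
       (* (d) *)
       orbit_closure (eta_seq B) (eta_seq C);
       (* (e) *)
       invariant_measures (orbit_closure (eta_seq B)) (mirsky R C);
       (* (f) *)
       @invariant_measures R (orbit_closure (eta_seq C))
         `<=` @invariant_measures R (orbit_closure (eta_seq B));
       (* (a') *)
       (forall b : nat, Bprime R B b -> exists2 c : nat, C c & (c %| b)%N) /\
       (forall c : nat, C c -> exists2 b : nat, Bstar B b & (b %| c)%N);
       (* (b') *)
       le_coord (eta_seq (Bstar B)) (eta_seq C) /\ le_coord (eta_seq C) (eta_seq (Bprime R B));
       (* (c') *)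
       orbit_closure (eta_seq C) `<=` orbit_closure (eta_seq (Bprime R B));
       (* (d') *)
       orbit_closure (eta_seq (Bprime R B)) (eta_seq C);
       (* (e') *)
       invariant_measures (orbit_closure (eta_seq (Bprime R B))) (mirsky R C);
       (* (f') *)
       @invariant_measures R (orbit_closure (eta_seq C))
         `<=` @invariant_measures R (orbit_closure (eta_seq (Bprime R B)))].
Proof.
have hB' := @Bprime_posn R B hB.
have coarser D : (forall b, D b -> exists2 c, C c & (c %| b)%N) <-> (forall b, D b -> mult C b).
  by split=> h b /h; [move=> ?; apply/multP|move/multP].
have BB b : B b -> mult B b by exact: mult_self.
have BB' b : B b -> mult (Bprime R B) b by exact: mult_Bprime.
have star : (forall c, C c -> mult (Bstar B) c) -> forall c, C c -> approachable B c.
  by move=> h c Cc; apply/(Bstar_approachable hB (hC _ Cc)); exact: h.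
have le_star : le_coord (eta_seq (Bstar B)) (eta_seq C) <->
    (forall c, C c -> exists2 b, Bstar B b & (b %| c)%N).
  by rewrite le_eta; split=> h b /h; [move/multP|move=> ?; apply/multP].
have fwd B1 : (forall b, B b -> mult B1 b) ->
    le_coord (eta_seq (Bstar B)) (eta_seq C) /\ le_coord (eta_seq C) (eta_seq B1) ->
    orbit_closure (eta_seq B1) (eta_seq C).
  move=> BB1 [/le_eta s /le_eta B1C].
  exact: orbit_closure_eta hB hC tautC BB1 B1C (star s).
have bwd_star B1 : (forall J c, (0 < J)%N -> (forall b, B b -> exceeds J c b) ->
      forall b, B1 b -> exceeds J c b) ->
    orbit_closure (eta_seq B1) (eta_seq C) ->
    forall c, C c -> exists2 b, Bstar B b & (b %| c)%N.
  move=> hJ d c Cc; apply/multP/(Bstar_approachable hB (hC _ Cc)).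
  apply: contrapT => /(not_approachable hB (hC _ Cc))[J J0 /(hJ J c J0) hb].
  exact: backward_exceeds (hC _ Cc) J0 Cc hb d.
have back B1 : B1 `<=` posn -> orbit_closure (eta_seq B1) (eta_seq C) ->
    forall b, B1 b -> mult C b.
  by move=> B1p d b B1b; exact: backward_taut hC tautC d (B1p _ B1b) B1b.
have [cd dc de ef fd] := @mirsky_orbit_equivalences R C (eta_seq B) hC tautC.
have [cd' dc' de' ef' fd'] := @mirsky_orbit_equivalences R C (eta_seq (Bprime R B)) hC tautC.
tfae.
- by move=> [/coarser h1 h2]; split; [apply/le_star|apply/le_eta].
- by move=> /(fwd B BB)/dc.
- exact: cd.
- exact: de.
- exact: ef.
- move=> /fd d; split; last by apply: bwd_star d.
  by apply/coarser; apply: Bprime_mult hC tautC _; exact: back hB d.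
- by move=> [/coarser h1 h2]; split; [apply/le_star|apply/le_eta].
- by move=> /(fwd _ BB')/dc'.
- exact: cd'.
- exact: de'.
- exact: ef'.
- move=> /fd' d; split; last first.
    by apply: bwd_star d => J c J0; exact: Bprime_exceeds.
  apply/coarser => b /BB'; apply: mult_sub_mult; exact: back hB' d.
Qed.
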